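(* The class $\mathcal C$ of automorphism groups of $\aleph_0$-categorical structures (with domain $\omega$) that have weak elimination of imaginaries is smooth, i.e., topological isomorphism on $\mathcal C$ is smooth. Furthermore, if $M$ is an $\aleph_0$-categorical structure with weak elimination of imaginaries and $G=\mathrm{Aut}(M)$, then $\mathrm{Aut}(G)$ is quasi-oligomorphic and $\mathrm{Out}(G)$ is profinite.
   Context: All structures are countably infinite. For $G=\mathrm{Aut}(M)$ and $A\subseteq M$, $G_{(A)}$ and $G_{\{A\}}$ denote the pointwise and the setwise stabiliser of $A$ in $G$. An $\aleph_0$-categorical structure $M$, with $G=\mathrm{Aut}(M)$, has weak elimination of imaginaries if for every open subgroup $U\leq G$ there is a unique finite algebraically closed set $A\subseteq M$ such that $G_{(A)}\leq U\leq G_{\{A\}}$. The closed subgroups of $\mathrm{Sym}(\omega)$ form a standard Borel space, a Borel subspace of the Effros space of closed subsets of $\mathrm{Sym}(\omega)$ (whose $\sigma$-algebra is generated by the sets $\{F: F\cap W\neq\emptyset\}$, $W$ open). An equivalence relation on a Borel class is smooth if there is a Borel map $f$ from the class to $\mathbb R$ (equivalently, to some standard Borel space) such that two elements are equivalent iff they have the same image under $f$. A subgroup of $\mathrm{Sym}(\omega)$ is oligomorphic if for each $n$ its action on $\omega^n$ has only finitely many orbits. A topological group is quasi-oligomorphic if it is topologically isomorphic to an oligomorphic closed subgroup of $\mathrm{Sym}(\omega)$. $\mathrm{Aut}(G)$ denotes the group of continuous automorphisms of $G$, with the (Polish) group topology for which a neighbourhood basis of the identity consists of the subgroups $\{\Phi: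 \Phi(A_i)=A_i \text{ for } i=1,\dots,n\}$, where $A_1,\dots,A_n$ are cosets of open subgroups of $G$. $\mathrm{Out}(G)=\mathrm{Aut}(G)/\mathrm{Inn}(G)$ carries the quotient topology ($\mathrm{Inn}(G)$ is closed). *)

(* Defs.v *)
From HB Require Import structures.
From mathcomp Require Import all_boot all_order all_algebra.
From mathcomp Require Import all_classical all_reals all_analysis.

Set Implicit Arguments.
Unset Strict Implicit.
Unset Printing Implicit Defensive.

Local Open Scope classical_set_scope.
Local Open Scope group_scope.
Local Open Scope quotient_scope.

Record subgroup (G : groupType) := Subgroup {
  sg_set :> set G;
  sg1 : sg_set 1;
  sgM : forall x y, sg_set x -> sg_set y -> sg_set (x * y);
  sgV : forall x, sg_set x -> sg_set x^-1 }.

Section SubgroupIsGroup.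
Variables (G : groupType) (H : subgroup G).
Implicit Types x y z : H.

Definition sg_one : H := SigSub (mem_set (sg1 H)).
Definition sg_mul x y : H :=
  SigSub (mem_set (sgM (set_mem (valP x)) (set_mem (valP y)))).
Definition sg_inv x : H := SigSub (mem_set (sgV (set_mem (valP x)))).

Lemma sg_mulA : associative sg_mul.
Proof. by move=> x y z; apply/val_inj/mulgA. Qed.
Lemma sg_mul1g : left_id sg_one sg_mul.
Proof. by move=> x; apply/val_inj/mul1g. Qed.
Lemma sg_mulg1 : right_id sg_one sg_mul.
Proof. by move=> x; apply/val_inj/mulg1. Qed.
Lemma sg_mulVg : left_inverse sg_one sg_inv sg_mul.
Proof. by move=> x; apply/val_inj/mulVg. Qed.
Lemma sg_mulgV : right_inverse sg_one sg_inv sg_mul.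
Proof. by move=> x; apply/val_inj/mulgV. Qed.

HB.instance Definition _ := isGroup.Build (set_type (sg_set H))
  sg_mulA sg_mul1g sg_mulg1 sg_mulVg sg_mulgV.

Lemma val_sgM x y : val (x * y) = val x * val y. Proof. by []. Qed.
Lemma val_sgV x : val x^-1 = (val x)^-1. Proof. by []. Qed.
End SubgroupIsGroup.

HB.mixin Record isTopGroup G & Group G & Topological G := {
  mulg_continuous : continuous (fun x : G * G => x.1 * x.2);
  invg_continuous : continuous (fun x : G => x^-1)
}.

#[short(type="topGroupType")]
HB.structure Definition TopGroup :=
  { G of Group G & Topological G & isTopGroup G }.

(* The group topology for which a given family of subgroups is a basis of
   neighbourhoods of the identity. *)
HB.factory Record Group_isTopGroup_of_base G & Group G := {
  base1 : set (subgroup G);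
  base1_neq0 : base1 !=set0;
  base1I : forall B C, base1 B -> base1 C ->
    exists2 D, base1 D & D `<=` B `&` C;
  base1J : forall B g, base1 B ->
    exists2 D, base1 D & forall x, sg_set D x -> sg_set B (g^-1 * x * g)
}.

HB.builders Context G & Group_isTopGroup_of_base G.

Definition bopen (U : set G) :=
  forall x, U x -> exists2 B, base1 B & forall y, sg_set B y -> U (x * y).

Lemma bopenT : bopen setT.
Proof. by move=> x _; have [B bB] := base1_neq0; exists B. Qed.

Lemma bopenI : setI_closed bopen.
Proof.
move=> U V oU oV x [/oU[B bB BU] /oV[C bC CV]].
have [D bD DBC] := base1I bB bC.
by exists D => // y /DBC[By Cy]; split; [exact: BU|exact: CV].
Qed.

Lemma bopen_bigU (I : Type) (f : I -> set G) :
  (forall i, bopen (f i)) -> bopen (\bigcup_i f i).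
Proof.
by move=> of_ x [i _ /of_[B bB Bf]]; exists B => // y /Bf; exists i.
Qed.

HB.instance Definition _ := isOpenTopological.Build G bopenT bopenI bopen_bigU.

Lemma bopenM (x : G) (B : subgroup G) : base1 B -> nbhs x [set x * y | y in sg_set B].
Proof.
move=> bB; apply: open_nbhs_nbhs; split; last by exists 1; [exact: sg1|rewrite mulg1].
move=> _ [y By <-]; exists B => // z Bz.
by exists (y * z); [exact: sgM|rewrite mulgA].
Qed.

Lemma nbhs_bopen (x : G) (U : set G) : nbhs x U ->
  exists2 B, base1 B & forall y, sg_set B y -> U (x * y).
Proof.
rewrite nbhsE => -[V [oV Vx] VU].
by have [B bB BV] := oV x Vx; exists B => // y /BV/VU.
Qed.

Lemma bmul_continuous : continuous (fun x : G * G => x.1 * x.2).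
Proof.
move=> [x y] U /= /nbhs_bopen[B bB BU].
have [D bD DB] := base1J y bB.
exists ([set x * z | z in sg_set D], [set y * z | z in sg_set B]).
  by split; exact: bopenM.
move=> [_ _] /= [[a Da <-] [b Bb <-]].
have -> : x * a * (y * b) = x * y * (y^-1 * a * y * b) by rewrite !mulgA mulgK.
by apply: BU; apply: sgM => //; exact: DB.
Qed.

Lemma binv_continuous : continuous (fun x : G => x^-1).
Proof.
move=> x U /= /nbhs_bopen[B bB BU].
have [D bD DB] := base1J x^-1 bB.
have := bopenM x bD; apply: filterS => _ [a Da <-] /=.
have -> : (x * a)^-1 = x^-1 * (x * a^-1 * x^-1) by rewrite invgM !mulgA mulVg mul1g.
by apply: BU; have := DB _ (sgV Da); rewrite invgK.
Qed.

HB.instance Definition _ := isTopGroup.Build G bmul_continuous binv_continuous.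
HB.end.

Definition topological_iso (G H : topGroupType) :=
  exists (f : G -> H) (g : H -> G),
    [/\ cancel f g, cancel g f, {morph f : x y / x * y},
        continuous f & continuous g].

Section SubgroupIsTopGroup.
Variables (G : topGroupType) (H : subgroup G).

Let val_cont : continuous (val : H -> G).
Proof. exact: initial_continuous. Qed.

Let to_sub_cont (X : topologicalType) (f : X -> H) :
  continuous (val \o f) -> continuous f.
Proof.
move=> /continuousP cf; apply/continuousP => _ [A oA <-].
exact: (cf A oA).
Qed.

Lemma sg_mul_continuous : continuous (fun x : H * H => x.1 * x.2).
Proof.
apply: to_sub_cont => -[x y].
apply: (@continuous_comp _ _ _ (fun z : H * H => (val z.1, val z.2))
  (fun z => z.1 * z.2)); last exact: mulg_continuous.
apply: cvg_pair.
  exact: (@cvg_comp _ _ _ fst (val : H -> G) _ _ _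
    (@cvg_fst _ _ (nbhs x) (nbhs y) _) (@val_cont x)).
exact: (@cvg_comp _ _ _ snd (val : H -> G) _ _ _
  (@cvg_snd _ _ (nbhs x) (nbhs y) _) (@val_cont y)).
Qed.

Lemma sg_inv_continuous : continuous (fun x : H => x^-1).
Proof.
apply: to_sub_cont => x.
apply: (@continuous_comp _ _ _ (val : H -> G) (fun z => z^-1)).
  exact: val_cont.
exact: invg_continuous.
Qed.

HB.instance Definition _ := isTopGroup.Build (set_type (sg_set H))
  sg_mul_continuous sg_inv_continuous.
End SubgroupIsTopGroup.

Definition profinite (G : topGroupType) :=
  [/\ compact [set: G], hausdorff_space G & totally_disconnected [set: G]].

Record normal_subgroup (G : groupType) := NormalSubgroup {
  nsg_subgroup :> subgroup G;
  nsgJ : forall x g : G, sg_set nsg_subgroup x -> sg_set nsg_subgroup (g * x * g^-1) }.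

Section Quotient.
Variables (G : topGroupType) (N : normal_subgroup G).
Implicit Types x y : G.

Definition coset_eq x y := `[< sg_set N (x^-1 * y) >].

Lemma coset_eq_equiv : equiv_class_of coset_eq.
Proof.
split=> [x|x y|y x z].
- by apply/asboolP; rewrite mulVg; exact: sg1.
- by apply/asboolP/asboolP => /sgV; rewrite invgM invgK.
- move=> /asboolP Nxy /asboolP Nyz; apply/asboolP.
  by have := sgM Nxy Nyz; rewrite mulgA mulgK.
Qed.

Canonical coset_equivRel := EquivRelPack coset_eq_equiv.

Definition quotient_group : Type :=
  quotient_topology {eq_quot coset_equivRel}.

HB.instance Definition _ := Topological.on quotient_group.
HB.instance Definition _ := Quotient.on quotient_group.

Local Notation Q := quotient_group.
Local Notation "[q x ]" := (\pi_Q x : Q).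

Definition quo_one : Q := [q 1].
Definition quo_mul (a b : Q) : Q := [q repr a * repr b].
Definition quo_inv (a : Q) : Q := [q (repr a)^-1].

Lemma quo_eqP x y : [q x] = [q y] <-> sg_set N (x^-1 * y).
Proof.
have h := @eqmodP _ coset_equivRel x y.
by split=> [e|Nxy]; [exact/asboolP/h|exact/h/asboolP].
Qed.

Lemma quo_ind (P : Q -> Prop) : (forall x, P [q x]) -> forall a, P a.
Proof. by move=> Pq a; rewrite -[a]reprK. Qed.

Lemma quo_reprP x : sg_set N (x^-1 * repr [q x]).
Proof. by apply/quo_eqP; rewrite reprK. Qed.

Lemma quo_mulE x y : quo_mul [q x] [q y] = [q x * y].
Proof.
apply/esym/quo_eqP; set a := repr [q x]; set b := repr [q y].
have Na : sg_set N (x^-1 * a) := quo_reprP x.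
have Nb : sg_set N (y^-1 * b) := quo_reprP y.
have -> : (x * y)^-1 * (a * b) = (y^-1 * (x^-1 * a) * y^-1^-1) * (y^-1 * b).
  by rewrite invgK invgM !mulgA mulgK.
by apply: sgM => //; exact: nsgJ.
Qed.

Lemma quo_invE x : quo_inv [q x] = [q x^-1].
Proof.
apply/esym/quo_eqP; set a := repr [q x].
have Na : sg_set N (x^-1 * a) := quo_reprP x.
have -> : x^-1^-1 * a^-1 = x * (x^-1 * a)^-1 * x^-1.
  by rewrite invgK invgM invgK mulgA mulgK.
by apply: nsgJ; exact: sgV.
Qed.

Lemma quo_mulA : associative quo_mul.
Proof.
by elim/quo_ind=> x; elim/quo_ind=> y; elim/quo_ind=> z; rewrite !quo_mulE mulgA.
Qed.
Lemma quo_mul1g : left_id quo_one quo_mul.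
Proof. by elim/quo_ind=> x; rewrite quo_mulE mul1g. Qed.
Lemma quo_mulg1 : right_id quo_one quo_mul.
Proof. by elim/quo_ind=> x; rewrite quo_mulE mulg1. Qed.
Lemma quo_mulVg : left_inverse quo_one quo_inv quo_mul.
Proof. by elim/quo_ind=> x; rewrite quo_invE quo_mulE mulVg. Qed.
Lemma quo_mulgV : right_inverse quo_one quo_inv quo_mul.
Proof. by elim/quo_ind=> x; rewrite quo_invE quo_mulE mulgV. Qed.

HB.instance Definition _ := isGroup.Build Q
  quo_mulA quo_mul1g quo_mulg1 quo_mulVg quo_mulgV.

Lemma quo_piM x y : [q x * y] = [q x] * [q y].
Proof. by rewrite -quo_mulE. Qed.

Lemma quo_piV x : [q x^-1] = [q x]^-1.
Proof. by rewrite -quo_invE. Qed.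

Let pi_cont : continuous (fun x => [q x]).
Proof. exact: pi_continuous. Qed.

Lemma quo_pi_open (U : set G) : open U -> open [set [q x] | x in U].
Proof.
move=> oU; rewrite /open /= /quotient_open.
have -> : (fun x => [q x]) @^-1` [set [q x] | x in U] =
    \bigcup_(n in sg_set N) ((fun x => x * n) @^-1` U).
  apply/seteqP; split => x /=.
    move=> [y Uy /esym/quo_eqP Nxy]; exists (x^-1 * y) => //=.
    by rewrite mulgA mulgV mul1g.
  move=> [n Nn Uxn]; exists (x * n) => //; apply/esym/quo_eqP.
  by rewrite mulgA mulVg mul1g.
apply: bigcup_open => n _; move: U oU; apply/continuousP => x.
apply: (@continuous_comp _ _ _ (fun x => (x, n)) (fun z : G * G => z.1 * z.2)).
  by apply: cvg_pair; [exact: cvg_id|exact: cvg_cst].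
exact: mulg_continuous.
Qed.

Lemma quo_nbhs x (U : set G) : nbhs x U -> nbhs [q x] [set [q x] | x in U].
Proof.
rewrite !nbhsE => -[V [oV Vx] VU]; exists [set [q x] | x in V].
  by split; [exact: quo_pi_open|exists x].
by move=> _ [y /VU Uy <-]; exists y.
Qed.

Lemma quo_mul_continuous : continuous (fun x : Q * Q => x.1 * x.2).
Proof.
move=> [a b]; elim/quo_ind: a => x; elim/quo_ind: b => y U /=.
rewrite -quo_piM => /pi_cont UM.
have [[V W] /= [Vx Wy] VW] := @mulg_continuous G (x, y) _ UM.
exists ([set [q x] | x in V], [set [q x] | x in W]) => /=.
  by split; exact: quo_nbhs.
move=> [_ _] /= [[v Vv <-] [w Ww <-]]; rewrite -quo_piM.
by apply: (VW (v, w)).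
Qed.

Lemma quo_inv_continuous : continuous (fun x : Q => x^-1).
Proof.
move=> a; elim/quo_ind: a => x U /=; rewrite -quo_piV => /pi_cont.
move=> /(@invg_continuous G x)/quo_nbhs; apply: filterS => _ [y Uy <-].
by rewrite /= -quo_piV.
Qed.

HB.instance Definition _ := isTopGroup.Build Q
  quo_mul_continuous quo_inv_continuous.
End Quotient.

Record sym (T : Type) := Sym {
  sym_fun :> T -> T;
  sym_finv : T -> T;
  sym_funK : cancel sym_fun sym_finv;
  sym_finvK : cancel sym_finv sym_fun }.

Section SymGroup.
Variable T : Type.
Implicit Types g h : sym T.

Lemma symP g h : g =1 h -> g = h.
Proof.
case: g h => [f f' fK f'K] [k k' kK k'K] /= /funext fk; subst k.
have ? : f' = k' by apply/funext => x; rewrite -{1}(k'K x) fK.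
by subst k'; congr Sym; exact: Prop_irrelevance.
Qed.

HB.instance Definition _ := gen_eqMixin (sym T).
HB.instance Definition _ := gen_choiceMixin (sym T).

Definition sym_one : sym T := @Sym T id id (fun _ => erefl) (fun _ => erefl).
Definition sym_mul g h : sym T :=
  Sym (can_comp (sym_funK g) (sym_funK h)) (can_comp (sym_finvK h) (sym_finvK g)).
Definition sym_inv g : sym T := Sym (sym_finvK g) (sym_funK g).

Lemma sym_mulA : associative sym_mul.
Proof. by move=> g h k; exact: symP. Qed.
Lemma sym_mul1g : left_id sym_one sym_mul.
Proof. by move=> g; exact: symP. Qed.
Lemma sym_mulg1 : right_id sym_one sym_mul.
Proof. by move=> g; exact: symP. Qed.
Lemma sym_mulVg : left_inverse sym_one sym_inv sym_mul.
Proof. by move=> g; apply: symP => x /=; rewrite sym_funK. Qed.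
Lemma sym_mulgV : right_inverse sym_one sym_inv sym_mul.
Proof. by move=> g; apply: symP => x /=; rewrite sym_finvK. Qed.

HB.instance Definition _ := isGroup.Build (sym T)
  sym_mulA sym_mul1g sym_mulg1 sym_mulVg sym_mulgV.

Lemma symM g h x : (g * h) x = g (h x). Proof. by []. Qed.
Lemma symKV g x : g^-1 (g x) = x. Proof. exact: sym_funK. Qed.
Lemma symVK g x : g (g^-1 x) = x. Proof. exact: sym_finvK. Qed.

Definition pointwise_stab (A : set T) : set (sym T) :=
  [set g | forall x, A x -> g x = x].

Definition setwise_stab (A : set T) : set (sym T) := [set g | g @` A = A].

Program Definition pointwise_stab_subgroup (A : set T) : subgroup (sym T) :=
  @Subgroup _ (pointwise_stab A) _ _ _.
Next Obligation. by []. Qed.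
Next Obligation.
by move=> A g h /= gA hA x Ax; rewrite symM hA // gA.
Qed.
Next Obligation.
by move=> A g /= gA x Ax; rewrite -{1}(gA x Ax) symKV.
Qed.

(* The resulting topology is that of pointwise convergence, for [T] discrete. *)
Definition sym_base : set (subgroup (sym T)) :=
  [set pointwise_stab_subgroup A | A in [set A : set T | finite_set A]].

Lemma sym_base_neq0 : sym_base !=set0.
Proof. by exists (pointwise_stab_subgroup set0), set0; first exact: finite_set0. Qed.

Lemma sym_baseI B C : sym_base B -> sym_base C ->
  exists2 D, sym_base D & D `<=` B `&` C.
Proof.
move=> [A fA <-] [A' fA' <-]; exists (pointwise_stab_subgroup (A `|` A')).
  by exists (A `|` A') => //=; rewrite finite_setU.
by move=> g /= gA; split=> x Ax; apply: gA; [left|right].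
Qed.

Lemma sym_baseJ B g : sym_base B ->
  exists2 D, sym_base D & forall x, sg_set D x -> sg_set B (g^-1 * x * g).
Proof.
move=> [A fA <-]; exists (pointwise_stab_subgroup (g @` A)).
  by exists (g @` A) => //=; exact: finite_image.
by move=> h /= hA x Ax; rewrite !symM hA ?symKV//; exists x.
Qed.

HB.instance Definition _ := Group_isTopGroup_of_base.Build (sym T)
  sym_base_neq0 sym_baseI sym_baseJ.
End SymGroup.

Record closed_subgroup (G : topGroupType) := ClosedSubgroup {
  csg_subgroup :> subgroup G;
  csg_closed : closed (csg_subgroup : set G) }.

Definition oligomorphic (T : Type) (G : set (sym T)) :=
  forall n : nat,
    finite_set (range (fun x : 'I_n -> T => [set (g : T -> T) \o x | g in G])).

Definition quasi_oligomorphic (G : topGroupType) :=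
  exists H : closed_subgroup (sym nat), oligomorphic H /\ topological_iso G H.

Section ContinuousAutomorphisms.
Variable G : topGroupType.

(* Continuity of the inverse, needed for a group when [G] is arbitrary, is
   automatic when [G] is Polish. *)
Definition cont_automorphism : set (sym G) :=
  [set f : sym G | [/\ {morph (f : G -> G) : x y / x * y},
                      continuous (f : G -> G) &
                      continuous (f^-1%g : G -> G)]].

Program Definition cont_aut_subgroup : subgroup (sym G) :=
  @Subgroup _ cont_automorphism _ _ _.
Next Obligation. by split=> // x; exact: cvg_id. Qed.
Next Obligation.
move=> f g [/= fM cf cf'] [gM cg cg']; split.
- by move=> x y; rewrite !symM gM fM.
- by move=> x; apply: (continuous_comp (cg x) (cf (g x))).
- by move=> x; apply: (continuous_comp (cf' x) (cg' (f^-1 x))).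
Qed.
Next Obligation.
move=> f [/= fM cf cf']; split; [|exact: cf'|exact: cf].
by move=> x y; rewrite -{1}(symVK f x) -{1}(symVK f y) -fM symKV.
Qed.

(* A separate name, since [cont_aut] does not carry the topology induced by
   the one of [sym G]. *)
Definition cont_aut : Type := cont_aut_subgroup.
HB.instance Definition _ := Group.on cont_aut.


Definition cont_aut_fun (f : cont_aut) : G -> G := (val f : sym G).
Coercion cont_aut_fun : cont_aut >-> Funclass.

Implicit Types f g : cont_aut.

Lemma cont_autP f g : f =1 g -> f = g.
Proof. by move=> fg; apply/val_inj/symP. Qed.
Lemma cont_autM f g x : cont_aut_fun (f * g) x = f (g x). Proof. by []. Qed.
Lemma cont_autKV f x : cont_aut_fun f^-1 (f x) = x. Proof. exact: sym_funK. Qed.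
Lemma cont_autVK f x : f (cont_aut_fun f^-1 x) = x. Proof. exact: sym_finvK. Qed.
Lemma cont_aut_mulg f : {morph f : x y / x * y}.
Proof. by have [] := set_mem (valP f). Qed.
Lemma cont_aut_continuous f : continuous f.
Proof. by have [] := set_mem (valP f). Qed.

Lemma cont_autg1 f : f 1 = 1.
Proof. by apply: (mulgI (f 1)); rewrite -cont_aut_mulg !mulg1. Qed.
Lemma cont_autgV f x : f x^-1 = (f x)^-1.
Proof. by apply: (mulgI (f x)); rewrite -cont_aut_mulg !mulgV cont_autg1. Qed.

(* Left cosets suffice: the right coset [Ug] is the left coset [g(g^-1 U g)]. *)
Definition open_coset : set (set G) :=
  [set A | exists (U : subgroup G) (a : G),
     open (U : set G) /\ A = [set a * u | u in (U : set G)]].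

Lemma open_coset_cont_aut f A : open_coset A -> open_coset (f @` A).
Proof.
move=> [U [a [oU ->]]].
have sg1' : (f @` (U : set G)) 1 by exists 1; [exact: sg1|exact: cont_autg1].
have sgM' x y : (f @` (U : set G)) x -> (f @` (U : set G)) y ->
    (f @` (U : set G)) (x * y).
  move=> [u Uu <-] [v Uv <-].
  by exists (u * v); [exact: sgM|exact: cont_aut_mulg].
have sgV' x : (f @` (U : set G)) x -> (f @` (U : set G)) x^-1.
  by move=> [u Uu <-]; exists u^-1; [exact: sgV|exact: cont_autgV].
exists (Subgroup sg1' sgM' sgV'), (f a); split => /=.
  have -> : f @` (U : set G) = cont_aut_fun f^-1 @^-1` (U : set G).
    apply/seteqP; split => x /=; first by move=> [u Uu <-]; rewrite cont_autKV.
    by move=> Ux; exists (cont_aut_fun f^-1 x) => //; exact: cont_autVK.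
  by move/continuousP: (@cont_aut_continuous f^-1); apply.
apply/seteqP; split=> x /=.
  by move=> [_ [u Uu <-] <-]; rewrite cont_aut_mulg; exists (f u) => //; exists u.
by move=> [_ [u Uu <-] <-]; rewrite -cont_aut_mulg; exists (a * u) => //; exists u.
Qed.

Program Definition coset_stab (S : set (set G)) : subgroup cont_aut :=
  @Subgroup _ [set f : cont_aut | forall A, S A -> f @` A = A] _ _ _.
Next Obligation. by move=> S A _ /=; rewrite -[RHS]image_id. Qed.
Next Obligation.
by move=> S f g /= fS gS A SA; rewrite -{2}(fS A SA) -{2}(gS A SA) image_comp.
Qed.
Next Obligation.
move=> S f /= fS A SA; rewrite -{1}(fS A SA) image_comp -[RHS]image_id.
by apply: eq_imagel => x _ /=; exact: cont_autKV.
Qed.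

Definition cont_aut_base : set (subgroup cont_aut) :=
  [set coset_stab S | S in [set S | finite_set S /\ S `<=` open_coset]].

Lemma cont_aut_base_neq0 : cont_aut_base !=set0.
Proof. by exists (coset_stab set0), set0; split => //; exact: finite_set0. Qed.

Lemma cont_aut_baseI B C : cont_aut_base B -> cont_aut_base C ->
  exists2 D, cont_aut_base D & D `<=` B `&` C.
Proof.
move=> [S [fS oS] <-] [S' [fS' oS'] <-]; exists (coset_stab (S `|` S')).
  exists (S `|` S') => //=; split; first by rewrite finite_setU.
  by rewrite subUset.
by move=> f /= fSS; split=> A SA; apply: fSS; [left|right].
Qed.

Lemma cont_aut_baseJ B g : cont_aut_base B ->
  exists2 D, cont_aut_base D & forall f, sg_set D f -> sg_set B (g^-1 * f * g).
Proof.
move=> [S [fS oS] <-].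
exists (coset_stab [set g @` A | A in S]).
  exists [set g @` A | A in S] => //; split; first exact: finite_image.
  by move=> _ [A SA <-]; apply/open_coset_cont_aut/oS.
move=> f /= fgS A SA.
have /(congr1 (image^~ (cont_aut_fun g^-1))) : f @` (g @` A) = g @` A by apply: fgS; exists A.
rewrite !image_comp => E; rewrite -[RHS]image_id.
transitivity ((cont_aut_fun g^-1 \o g) @` A); last by apply: eq_imagel => x _; exact: cont_autKV.
by rewrite -E; apply: eq_imagel.
Qed.

HB.instance Definition _ := Group_isTopGroup_of_base.Build cont_aut
  cont_aut_base_neq0 cont_aut_baseI cont_aut_baseJ.

Program Definition inner_subgroup : subgroup cont_aut :=
  @Subgroup _ [set f : cont_aut | exists g : G, forall x, f x = g * x * g^-1] _ _ _.
Next Obligation. by exists 1 => x; rewrite invg1 mulg1 mul1g. Qed.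
Next Obligation.
move=> f f' [g fg] [g' f'g']; exists (g * g') => x.
by rewrite cont_autM fg f'g' invgM !mulgA.
Qed.
Next Obligation.
move=> f [g fg]; exists g^-1 => x; rewrite -{1}(cont_autVK f x).
by rewrite cont_autKV -{2}(cont_autVK f x) fg invgK !mulgA mulVg mul1g mulgVK.
Qed.

Program Definition inner : normal_subgroup cont_aut :=
  @NormalSubgroup _ inner_subgroup _.
Next Obligation.
move=> f h [g fg]; exists (cont_aut_fun h g) => x.
by rewrite !cont_autM fg !cont_aut_mulg cont_autgV cont_autVK.
Qed.

Definition out : topGroupType := quotient_group inner.
End ContinuousAutomorphisms.

Record closed_set (X : topologicalType) := ClosedSet {
  cs_set :> set X;
  cs_closed : closed cs_set }.

HB.instance Definition _ X := gen_eqMixin (closed_set X).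
HB.instance Definition _ X := gen_choiceMixin (closed_set X).
HB.instance Definition _ X := isPointed.Build (closed_set X) (ClosedSet closed0).

Definition effros_space (X : topologicalType) :=
  g_sigma_algebraType
    [set [set F : closed_set X | F `&` W !=set0] | W in [set W | open W]].

Definition full_subgroup (G : groupType) : subgroup G :=
  @Subgroup G setT I (fun _ _ _ _ => I) (fun _ _ => I).

HB.instance Definition _ G := gen_eqMixin (closed_subgroup G).
HB.instance Definition _ G := gen_choiceMixin (closed_subgroup G).
HB.instance Definition _ (G : topGroupType) := isPointed.Build
  (closed_subgroup G) (@ClosedSubgroup G (full_subgroup G) closedT).

Definition closed_set_of_csg (G : topGroupType) (H : closed_subgroup G) :
  effros_space G := ClosedSet (@csg_closed G H).

Definition closed_subgroup_space (G : topGroupType) :=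
  g_sigma_algebra_preimageType (@closed_set_of_csg G).

Definition smooth (R : realType) (d : measure_display) (X : measurableType d)
    (C : set X) (E : X -> X -> Prop) :=
  measurable C /\
  exists2 f : X -> R, measurable_fun C f &
    forall x y, C x -> C y -> (E x y <-> f x = f y).

(* Languages are countable: the symbols form countable types. *)
Record language := Language {
  fsymb : countType;
  farity : fsymb -> nat;
  rsymb : countType;
  rarity : rsymb -> nat }.

(* [term L n] and [formula L n]: all free variables are among ['I_n]. *)
Inductive term (L : language) (n : nat) : Type :=
| Var of 'I_n
| App (f : fsymb L) of ('I_(farity f) -> term L n).

Inductive formula (L : language) : nat -> Type :=
| Eq n of term L n & term L n : formula L n
| Rel n (r : rsymb L) of ('I_(rarity r) -> term L n) : formula L n
| Falsum n : formula L n
| Imp n of formula L n & formula L n : formula L n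
| All n of formula L n.+1 : formula L n.

Record structure (L : language) (T : Type) := Structure {
  finterp : forall f : fsymb L, ('I_(farity f) -> T) -> T;
  rinterp : forall r : rsymb L, ('I_(rarity r) -> T) -> Prop }.

Definition env_cons (T : Type) n (x : T) (e : 'I_n -> T) : 'I_n.+1 -> T :=
  fun i => oapp e x (unlift ord0 i).

Section Semantics.
Variables (L : language) (T : Type) (M : structure L T).

Fixpoint eval n (e : 'I_n -> T) (t : term L n) : T :=
  match t with
  | Var i => e i
  | App f ts => finterp M (fun i => eval e (ts i))
  end.

Fixpoint sat n (phi : formula L n) : ('I_n -> T) -> Prop :=
  match phi with
  | Eq _ t u => fun e => eval e t = eval e u
  | Rel _ r ts => fun e => rinterp M (fun i => eval e (ts i))
  | Falsum _ => fun=> False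
  | Imp _ phi psi => fun e => sat phi e -> sat psi e
  | All _ phi => fun e => forall x, sat phi (env_cons x e)
  end.

Definition models (phi : formula L 0) := forall e, sat phi e.

Definition acl (A : set T) : set T :=
  [set a | exists n (phi : formula L n.+1) (b : 'I_n -> T),
     [/\ forall i, A (b i),
         finite_set [set x | sat phi (env_cons x b)] &
         sat phi (env_cons a b)]].

Definition algebraically_closed (A : set T) := acl A = A.
End Semantics.

Definition isomorphism L T T' (M : structure L T) (N : structure L T')
    (h : T -> T') :=
  [/\ bijective h,
      forall f xs, h (finterp M (f := f) xs) = finterp N (f := f) (h \o xs) &
      forall r xs, rinterp M (r := r) xs <-> rinterp N (r := r) (h \o xs)].

Definition countably_infinite (T : Type) := ([set: T] #= [set: nat])%card.

(* [N] satisfies the complete theory of [M] iff the two are elementarily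
   equivalent, so it suffices to transfer sentences from [M] to [N]. *)
Definition aleph0_categorical L T (M : structure L T) :=
  countably_infinite T /\
  forall (T' : Type) (N : structure L T'), countably_infinite T' ->
    (forall phi, models M phi -> models N phi) ->
    exists h : T -> T', isomorphism M N h.

Section AutomorphismGroup.
Variables (L : language) (T : Type) (M : structure L T).

Program Definition aut : subgroup (sym T) :=
  @Subgroup _ [set g : sym T | isomorphism M M g] _ _ _.
Next Obligation.
by split=> //; exists id.
Qed.
Next Obligation.
move=> g h [/= bg fg rg] [bh fh rh]; split=> [|f xs|r xs].
- exact: bij_comp bg bh.
- exact: etrans (congr1 g (fh f xs)) (fg f (h \o xs)).
- exact: iff_trans (rh r xs) (rg r (h \o xs)).
Qed.
Next Obligation.
move=> g [/= bg fg rg].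
have gK n (xs : 'I_n -> T) : g \o (sym_finv g \o xs) = xs.
  by apply/funext => i; rewrite /= sym_finvK.
split=> [|f xs|r xs].
- by exists g => x; [exact: symVK|exact: symKV].
- by rewrite /= -{1}(gK _ xs) -fg sym_funK.
- by rewrite /= -{1}(gK _ xs) -rg.
Qed.

Definition weak_elimination_of_imaginaries :=
  forall U : subgroup aut, open (U : set aut) ->
    exists! A : set T,
      [/\ finite_set A, algebraically_closed M A,
          val @^-1` pointwise_stab A `<=` (U : set aut) &
          (U : set aut) `<=` val @^-1` setwise_stab A].
End AutomorphismGroup.

(* Main.v *)
(* In an aleph0-categorical structure [M] with weak elimination of imaginaries,
   the pointwise stabilisers of the finite algebraically closed sets are exactly
   the open subgroups of [G = Aut(M)] without proper open subgroups of finite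
   index ("connected" subgroups).  Hence the set of cosets of connected
   subgroups, ordered by inclusion and equipped with the relation
   [P * Q <= S], is an invariant of the topological group [G], and since [G] is
   closed it is determined up to isomorphism by this countable structure.
   Bounding the length of chains of connected subgroups above a given one
   grades the structure into levels, each of which splits into finitely many
   [G]-orbits, also over finitely many parameters.  So the structure behaves as
   an aleph0-categorical one: it is determined by its first-order theory with
   quantifiers bounded by the levels, which is a countable list of Borel
   invariants, and topological isomorphism is smooth.  [Aut(G)] acts on a level that generates all
   connected subgroups; already the inner automorphisms have finitely many
   orbits on tuples, and the image is closed because a coherent system of partial
   correspondences comes from an automorphism.  For the same reason an
   ultrafilter on [Out(G)] converges, since over a finite set of cosets there are
   only finitely many possibilities modulo inner automorphisms. *)
Require Import Defs.
From HB Require Import structures.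
From mathcomp Require Import all_boot all_order all_algebra.
From mathcomp Require Import all_classical all_reals all_analysis.
From mathcomp Require Import measurable_realfun lra.

Set Implicit Arguments.
Unset Strict Implicit.
Unset Printing Implicit Defensive.

Local Open Scope classical_set_scope.
Local Open Scope group_scope.
Local Open Scope quotient_scope.

(** * Back and forth *)

(** The class is defined by a quantifier over all languages and structures, which hides its Borel
    complexity. Ryll-Nardzewski is therefore proved in both directions: categoricity makes the group
    oligomorphic and algebraic closure a matter of finite orbits, and conversely an oligomorphic
    closed group on an infinite set is the group of its orbit structure, which is categorical.
    Membership thus becomes a countable condition on which finite tuples [H] carries to which, and
    each such fact is a generator of the Effros sigma-algebra. Categoricity speaks of isomorphic
    countable models, so compactness and atomicity of [M] are obtained by recognising countable
    hulls in an ultrapower, and a submodel built from isolated tuples, as copies of [M]. From then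
    on the comparison of groups and the results on [Aut(G)] and [Out(G)] rest on [tame], a list of
    statements about the topological group alone. Weak elimination enters by making closures of
    finite sets finite and by matching connected subgroups with finite closed sets. *)

Lemma finite_set_enum (X : Type) (S : set X) : finite_set S ->
  exists n (u : 'I_n -> X), S = range u.
Proof.
elim/Pchoice: X S => X S /finite_seqP[s ->].
exists (size s), (tnth (in_tuple s)).
apply/seteqP; split => x /=; first by move=> /(@tnthP _ _ (in_tuple s))[i ->]; exists i.
by move=> [i _ <-]; apply/(@tnthP _ _ (in_tuple s)); exists i.
Qed.

Lemma countable_inj (X : Type) (A : set X) : countable A ->
  exists a : X -> nat, forall x y, A x -> A y -> a x = a y -> x = y.
Proof.
move=> /countable_injP[a ainj]; exists a => x y Ax Ay.
by apply: ainj; exact/mem_set.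
Qed.

Lemma inj_enum (X : Type) (x0 : X) (c : X -> nat) : injective c ->
  exists F : nat -> X, forall x, exists k, F k = x.
Proof.
move=> cinj; have /choice[F FP] : forall k, exists x, forall y, c y = k -> x = y.
  move=> k; have [[y yk]|nk] := pselect (exists y, c y = k).
    by exists y => z zk; apply: cinj; rewrite yk zk.
  by exists x0 => y yk; exfalso; apply: nk; exists y.
by exists F => x; exists (c x); exact: FP.
Qed.

(* Listing [F] along [logn 2] repeats each value at arbitrarily large indices. *)
Lemma inj_enum_io (X : Type) (x0 : X) (c : X -> nat) : injective c ->
  exists F : nat -> X, forall x m, exists2 k, (m <= k)%N & F k = x.
Proof.
move=> /(inj_enum x0)[F FP]; exists (F \o logn 2) => x m.
have [a ax] := FP x; exists (2 ^ a * m.*2.+1)%N => /=.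
  rewrite (leq_trans (leq_addr m m))// addnn (leq_trans (leqnSn _))//.
  by rewrite leq_pmull// expn_gt0.
by rewrite lognM ?expn_gt0// pfactorK// lognE/= dvdn2/= odd_double/= addn0.
Qed.

Lemma inj_countable (X Y : Type) (A : set X) (B : set Y) (g : X -> Y) :
  countable B -> (forall x, A x -> B (g x)) ->
  (forall x y, A x -> A y -> g x = g y -> x = y) -> countable A.
Proof.
move=> /countable_inj[b binj] AB ginj; apply/countable_injP.
exists (b \o g) => x y /set_mem Ax /set_mem Ay /= /binj gxy.
by apply: ginj => //; apply: gxy; exact: AB.
Qed.

Section BackAndForth.
Variables (X Y : Type) (x0 : X) (y0 : Y) (A : set X) (B : set Y).
Variables (P : set (X * Y) -> Prop) (S0 : set (X * Y)).
Hypotheses (cA : countable A) (cB : countable B).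
Hypothesis P_sub : forall S, P S -> S `<=` A `*` B.
Hypothesis P_inj : forall S p q, P S -> S p -> S q -> p.1 = q.1 <-> p.2 = q.2.
Hypothesis P0 : P S0.
Hypothesis forth : forall S x, P S -> A x -> exists y, P ((x, y) |` S).
Hypothesis back : forall S y, P S -> B y -> exists x, P ((x, y) |` S).

(** The property [P] need not pass to subsets or unions, so nothing is claimed of the limit itself.
    Instead the last clause gives, for each finite part of the limit, one stage with [P] containing
    that part and [S0]; applications read the properties of the limit off these stages. *)
Lemma back_and_forth : exists (f : X -> Y) (g : Y -> X),
  [/\ forall x, A x -> B (f x) /\ g (f x) = x,
      forall y, B y -> A (g y) /\ f (g y) = y &
      forall l : set X, finite_set l -> l `<=` A ->
        exists2 S, P S & S0 `<=` S /\ forall x, l x -> S (x, f x)].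
Proof.
have [a ainj] := countable_inj cA; have [b binj] := countable_inj cB.
have stepA n S : P S -> exists2 S', P S' & S `<=` S' /\
    forall x, A x -> a x = n -> exists y, S' (x, y).
  move=> PS; have [[x [Ax axn]]|nx] := pselect (exists x, A x /\ a x = n).
    have [y Py] := forth PS Ax; exists ((x, y) |` S) => //.
    split=> [p Sp|z Az azn]; first by right.
    by exists y; left; rewrite (ainj z x)// axn azn.
  by exists S => //; split=> // x Ax axn; exfalso; apply: nx; exists x.
have stepB n S : P S -> exists2 S', P S' & S `<=` S' /\
    forall y, B y -> b y = n -> exists x, S' (x, y).
  move=> PS; have [[y [By byn]]|ny] := pselect (exists y, B y /\ b y = n).
    have [x Px] := back PS By; exists ((x, y) |` S) => //.
    split=> [p Sp|z Bz bzn]; first by right.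
    by exists x; left; rewrite (binj z y)// byn bzn.
  by exists S => //; split=> // y By byn; exfalso; apply: ny; exists y.
have /choice[nxt nxtP] : forall nS : nat * {S | P S}, exists S' : {S | P S},
    [/\ sval nS.2 `<=` sval S',
        forall x, A x -> a x = nS.1 -> exists y, sval S' (x, y) &
        forall y, B y -> b y = nS.1 -> exists x, sval S' (x, y)].
  move=> [n [S PS]] /=; have [S1 P1 [SS1 S1A]] := stepA n S PS.
  have [S2 P2 [SS2 S2B]] := stepB n S1 P1.
  exists (exist _ S2 P2); split=> //= [p /SS1/SS2//|x Ax /(S1A _ Ax)[y S1xy]].
  by exists y; exact: SS2.
(* Stage [n.+1] treats the at most one element of code [n] on either side. *)
pose c := fix c n := if n is m.+1 then nxt (m, c m) else exist _ S0 P0.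
have c_mono m n : (m <= n)%N -> sval (c m) `<=` sval (c n).
  elim: n => [|n IH]; first by rewrite leqn0 => /eqP ->.
  rewrite leq_eqVlt => /orP[/eqP -> //|/IH mn] p /mn.
  by have [+ _ _] := nxtP (n, c n); apply.
have /choice[f fP] : forall x, exists y, A x -> exists n, sval (c n) (x, y).
  move=> x; have [Ax|nAx] := pselect (A x); last by exists y0.
  have [_ /(_ x Ax erefl)[y xy] _] := nxtP (a x, c (a x)).
  by exists y => _; exists (a x).+1.
have /choice[g gP] : forall y, exists x, B y -> exists n, sval (c n) (x, y).
  move=> y; have [By|nBy] := pselect (B y); last by exists x0.
  have [_ _ /(_ y By erefl)[x xy]] := nxtP (b y, c (b y)).
  by exists x => _; exists (b y).+1.
have cinj m n p q : sval (c m) p -> sval (c n) q -> p.1 = q.1 <-> p.2 = q.2.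
  move=> /(c_mono _ _ (leq_maxl m n)) cp /(c_mono _ _ (leq_maxr m n)) cq.
  exact: (P_inj (svalP (c (maxn m n)))).
have cAB n p : sval (c n) p -> A p.1 /\ B p.2 by exact: (P_sub (svalP (c n))).
exists f, g; split=> [x Ax|y By|l].
- have [n xn] := fP x Ax; have [_ Bf] := cAB _ _ xn; split=> //.
  by have [m xm] := gP _ Bf; exact/(cinj _ _ _ _ xm xn).
- have [n yn] := gP y By; have [Ag _] := cAB _ _ yn; split=> //.
  by have [m ym] := fP _ Ag; exact/(cinj _ _ _ _ ym yn).
- move=> /finite_set_enum[k [u ->]] lA.
  have /choice[N NP] : forall i, exists n, sval (c n) (u i, f (u i)).
    by move=> i; apply/fP/lA; exists i.
  exists (sval (c (\max_i N i))); first exact: svalP.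
  split=> [p|_ [i _ <-]]; first by move: p; exact: (c_mono 0%N).
  by apply: c_mono (NP i); exact: leq_bigmax.
Qed.
End BackAndForth.

(** * First-order formulas *)

Arguments env_cons : simpl never.

Section Formulas.
Variable L : language.

(** Arguments of symbols are functions on ordinals, so countability of the syntax comes from an
    injection into finite trees. The number [n] of variables is not recorded: the code is injective
    for fixed [n]. *)
Fixpoint term_code n (t : term L n) : GenTree.tree nat :=
  match t with
  | Var i => GenTree.Leaf (val i)
  | App f ts => GenTree.Node (pickle f)
      [seq term_code (ts i) | i <- enum 'I_(farity f)]
  end.

Lemma map_enum_inj (X : Type) n (u v : 'I_n -> X) :
  [seq u i | i <- enum 'I_n] = [seq v i | i <- enum 'I_n] -> u =1 v.
Proof.
by move=> uv i; have /eq_in_map := uv; apply; rewrite mem_enum.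
Qed.

Lemma term_code_inj n : injective (@term_code n).
Proof.
elim=> [i|f ts IH] [j|f' us] //=; first by case=> /val_inj ->.
case=> /(pcan_inj pickleK_inv) ff'; subst f' => /map_enum_inj tu.
by congr App; apply/funext => i; apply: IH; exact: tu.
Qed.

Fixpoint formula_code n (phi : formula L n) : GenTree.tree nat :=
  match phi with
  | Eq _ t u => GenTree.Node 0 [:: term_code t; term_code u]
  | Rel n r ts => GenTree.Node 1 (GenTree.Leaf (pickle r) ::
      [seq term_code (ts i) | i <- enum 'I_(rarity r)])
  | Falsum _ => GenTree.Node 2 [::]
  | Imp _ phi psi => GenTree.Node 3 [:: formula_code phi; formula_code psi]
  | All _ phi => GenTree.Node 4 [:: formula_code phi]
  end.

Lemma formula_code_inj n : injective (@formula_code n).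
Proof.
move=> phi; elim: phi => {n} [n t u|n r ts|n|n phi IH1 psi IH2|n phi IH] psi'.
- move: t u; case: n / psi' => //= n t' u' t u.
  by case=> /term_code_inj -> /term_code_inj ->.
- move: ts; case: n / psi' => //= n r' ts' ts.
  case=> /(pcan_inj pickleK_inv) rr'; subst r' => /map_enum_inj tt'.
  by congr Rel; apply/funext => i; exact/term_code_inj/tt'.
- by case: n / psi'.
- move: phi psi IH1 IH2; case: n / psi' => //= n phi' psi' phi psi IH1 IH2.
  by case=> /IH1 -> /IH2 ->.
- by move: phi IH; case: n / psi' => //= n phi' phi IH [/IH ->].
Qed.

Definition Not n (phi : formula L n) := Imp phi (Falsum L n).
Definition And n (phi psi : formula L n) := Not (Imp phi (Not psi)).
Definition Ex n (phi : formula L n.+1) := Not (All (Not phi)).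
Definition Conj n (s : seq (formula L n)) := foldr (@And n) (Not (Falsum L n)) s.

Definition env_lift n m (s : 'I_n -> 'I_m) : 'I_n.+1 -> 'I_m.+1 :=
  env_cons ord0 (lift ord0 \o s).

Fixpoint trename n m (s : 'I_n -> 'I_m) (t : term L n) : term L m :=
  match t with
  | Var i => Var L (s i)
  | App f ts => App (fun i => trename s (ts i))
  end.

Fixpoint rename n (phi : formula L n) : forall m, ('I_n -> 'I_m) -> formula L m :=
  match phi with
  | Eq _ t u => fun m s => Eq (trename s t) (trename s u)
  | Rel _ r ts => fun m s => Rel (fun i => trename s (ts i))
  | Falsum _ => fun m s => Falsum L m
  | Imp _ phi psi => fun m s => Imp (rename phi s) (rename psi s)
  | All _ phi => fun m s => All (rename phi (env_lift s))
  end.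

Lemma env_cons0 (X : Type) n (x : X) (e : 'I_n -> X) : env_cons x e ord0 = x.
Proof. by rewrite /env_cons unlift_none. Qed.

Lemma env_consS (X : Type) n (x : X) (e : 'I_n -> X) i :
  env_cons x e (lift ord0 i) = e i.
Proof. by rewrite /env_cons liftK. Qed.

Lemma env_cons_eta (X : Type) n (e : 'I_n.+1 -> X) :
  env_cons (e ord0) (e \o lift ord0) = e.
Proof.
by apply/funext => i; case: (unliftP ord0 i) => [j|] ->; rewrite ?env_consS ?env_cons0.
Qed.

Lemma comp_env_cons (X Y : Type) (f : X -> Y) n x (e : 'I_n -> X) :
  f \o env_cons x e = env_cons (f x) (f \o e).
Proof.
by apply/funext => i /=; case: (unliftP ord0 i) => [j|] ->; rewrite ?env_consS ?env_cons0.
Qed.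

Lemma env_cons_lift (X : Type) n m (s : 'I_n -> 'I_m) x (e : 'I_m -> X) :
  env_cons x e \o env_lift s = env_cons x (e \o s).
Proof.
rewrite /env_lift comp_env_cons env_cons0; congr env_cons.
by apply/funext => i /=; rewrite env_consS.
Qed.

Section Sat.
Variables (T : Type) (M : structure L T).

Lemma eval_trename n m (s : 'I_n -> 'I_m) e t :
  Defs.eval M e (trename s t) = Defs.eval M (e \o s) t.
Proof. by elim: t => //= f ts IH; congr finterp; apply/funext. Qed.

Lemma sat_rename n (phi : formula L n) : forall m (s : 'I_n -> 'I_m) e,
  sat M (rename phi s) e <-> sat M phi (e \o s).
Proof.
elim: phi => {n} [n t u|n r ts|n|n phi IH1 psi IH2|n phi IH] m s e //=.
- by rewrite !eval_trename.
- by under eq_fun do rewrite eval_trename.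
- by rewrite IH1 IH2.
- by split=> H x; have := H x; rewrite IH env_cons_lift.
Qed.

Lemma sat_And n (phi psi : formula L n) e :
  sat M (And phi psi) e <-> sat M phi e /\ sat M psi e.
Proof.
split=> /=; first by move=> H; split; apply: contrapT => nH; apply: H.
by case=> H1 H2; apply.
Qed.

Lemma sat_Ex n (phi : formula L n.+1) e :
  sat M (Ex phi) e <-> exists x, sat M phi (env_cons x e).
Proof.
split=> /=; last by move=> [x Hx] /(_ x); apply.
by move=> H; apply: contrapT => nH; apply: H => x Hx; apply: nH; exists x.
Qed.

Lemma sat_Conj n (X : finType) (F : X -> formula L n) e :
  sat M (Conj [seq F i | i <- enum X]) e <-> forall i, sat M (F i) e.
Proof.
have: sat M (Conj [seq F i | i <- enum X]) e <->
    forall i, i \in enum X -> sat M (F i) e.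
  elim: (enum X) => [|i s IH]; first by split=> // _ /= [].
  rewrite [Conj _]/(And (F i) (Conj (map F s))) sat_And IH; split.
    by move=> [Hi Hs] j; rewrite inE => /orP[/eqP ->|/Hs].
  by move=> H; split=> [|j js]; apply: H; rewrite inE ?eqxx ?js ?orbT.
by move=> ->; split=> H i; [apply: H; rewrite mem_enum|move=> _].
Qed.
End Sat.

Lemma sat_iso (T T' : Type) (M : structure L T) (N : structure L T') h :
  isomorphism M N h -> forall n (phi : formula L n) e,
  sat M phi e <-> sat N phi (h \o e).
Proof.
move=> [[h' hK h'K] hf hr].
have hev n e (t : term L n) : Defs.eval N (h \o e) t = h (Defs.eval M e t).
  elim: t => //= f ts IH; rewrite hf; congr finterp; exact/funext.
move=> n; elim=> {n} [n t u|n r ts|n|n phi IH1 psi IH2|n phi IH] e //=.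
- by rewrite !hev; split=> [->//|/(can_inj hK)].
- rewrite hr; have -> // : h \o (fun i => Defs.eval M e (ts i)) =
    fun i => Defs.eval N (h \o e) (ts i) by apply/funext => i; rewrite hev.
- by rewrite IH1 IH2.
- split=> H x; last by rewrite IH comp_env_cons; exact: H.
  by rewrite -[x]h'K -comp_env_cons -IH.
Qed.
End Formulas.

(** * The Ryll-Nardzewski theorem *)

Section LosTheorem.
Variables (L : language) (T : Type) (M : structure L T) (I : Type).
Variables (U : set_system I) (F : set (I -> T)).
Hypotheses (catM : aleph0_categorical M) (ultraU : UltraFilter U) (cF : countable F).
Hypothesis TV : forall n (phi : formula L n.+1) (e : 'I_n -> I -> T),
  (forall j, F (e j)) -> exists2 f, F f &
  U [set k | (exists x, sat M phi (env_cons x (e ^~ k))) ->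
             sat M phi (env_cons (f k) (e ^~ k))].

(** [TV] is the Tarski-Vaught test modulo [U], so [F] modulo [U] is a countable elementary
    substructure of the ultrapower, hence elementarily equivalent to [M] and by categoricity
    isomorphic to it. [h] is that isomorphism followed by a choice of representatives; whatever the
    hull realises is thereby realised in [M]. *)
Lemma los_hull : exists h : T -> I -> T,
  [/\ forall t, F (h t),
      forall f, F f -> exists t, U [set k | h t k = f k] &
      forall n (phi : formula L n) e,
        sat M phi e <-> U [set k | sat M phi (fun j => h (e j) k)]].
Proof.
have FU : Filter U by exact: _.
have PU : ProperFilter U by exact: _.
pose cls (f : I -> T) := [set g | U [set k | f k = g k]].
have clsE f g : U [set k | f k = g k] -> cls f = cls g.
  move=> fg; apply/seteqP; split => x; rewrite /cls /=.
    by apply: filterS2 fg => k /= ->.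
  by apply: filterS2 fg => k /= ->.
pose C := cls @` F.
have /choice[rp rpP] : forall c : C, exists f, F f /\ val c = cls f.
  by move=> [c /= /set_mem[f Ff <-]]; exists f.
have rpF c : F (rp c) by have [] := rpP c.
have rp_inj c d : U [set k | rp c k = rp d k] -> c = d.
  move=> cd; apply: val_inj; have [_ ->] := rpP c; have [_ ->] := rpP d.
  exact: clsE.
have mk f : F f -> exists c, U [set k | rp c k = f k].
  move=> Ff; have [c ec] : exists c : C, val c = cls f.
    have Cf : C (cls f) by exists f.
    by exists (SigSub (mem_set Cf)).
  exists c; have [_ e] := rpP c.
  have : cls f f by apply: filterE.
  by rewrite -ec e.
have /choice[fi fiP] : forall fs : {f : fsymb L & 'I_(farity f) -> C}, exists c,
    U [set k | rp c k = finterp M (fun i => rp (tagged fs i) k)].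
  move=> [f xs] /=.
  (* Closure under function symbols is the witness property of the formula [x = f(...)]. *)
  pose phi := Eq (Var L (ord0 : 'I_(farity f).+1)) (App (fun i => Var L (lift ord0 i))).
  have [g Fg gU] := TV phi (fun i => rpF (xs i)).
  have [c cg] := mk g Fg; exists c; apply: filterS2 cg gU => k /= -> H.
  have := H (ex_intro _ (finterp M (fun i => rp (xs i) k)) _).
  rewrite !env_cons0 => ->; last first.
    by congr finterp; apply/funext => i; rewrite env_consS.
  by congr finterp; apply/funext => i; rewrite env_consS.
pose N : structure L C := @Structure L C
  (fun f xs => fi (existT _ f xs))
  (fun r xs => U [set k | rinterp M (fun i => rp (xs i) k)]).
have evalN n (t : term L n) e :
    U [set k | rp (Defs.eval N e t) k = Defs.eval M (fun j => rp (e j) k) t].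
  elim: t => [i|f ts IH] /=; first exact: filterE.
  have H : U [set k | forall i, rp (Defs.eval N e (ts i)) k =
      Defs.eval M (fun j => rp (e j) k) (ts i)] := filter_forall FU IH.
  apply: filterS2 (fiP (existT (fun f => _ -> C) f (fun i => Defs.eval N e (ts i)))) H => k /= -> H.
  by congr finterp; apply/funext.
have satN n (phi : formula L n) : forall e,
    sat N phi e <-> U [set k | sat M phi (fun j => rp (e j) k)].
  elim: phi => {n} [n t u|n r ts|n|n phi IH1 psi IH2|n phi IH] e /=.
  - split=> [tu|H].
      apply: filterS2 (evalN n t e) (evalN n u e) => k /= <- <-.
      by rewrite tu.
    apply: rp_inj; apply: filterS3 (evalN n t e) (evalN n u e) H => k /= -> -> //.
  - have E : U [set k | forall i, rp (Defs.eval N e (ts i)) k =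
        Defs.eval M (fun j => rp (e j) k) (ts i)].
      exact: filter_forall FU (fun i => evalN n (ts i) e).
    by split=> H; apply: filterS2 E H => k /= /funext ->.
  - by split=> // H; apply: (@filter_not_empty _ U).
  - rewrite IH1 IH2; split=> [H|H1 H2]; last by apply: filterS2 H1 H2 => k; apply.
    have [A1|nA1] := in_ultra_setVsetC [set k | sat M phi (fun j => rp (e j) k)] ultraU.
      by apply: filterS (H A1) => k /= Hk _.
    by apply: filterS nA1 => k /= nk /nk.
  - have envE c k : (fun j => rp (env_cons c e j) k) = env_cons (rp c k) (fun j => rp (e j) k).
      apply/funext => j.
      by case: (unliftP ord0 j) => [i|] ->; rewrite ?env_consS ?env_cons0.
    split=> [H|H c]; last first.
      by apply/IH; apply: filterS H => k /= H; rewrite envE; exact: H.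
    apply: contrapT => nU.
    have {nU} [//|nU] := in_ultra_setVsetC
      [set k | forall x, sat M phi (env_cons x (fun j => rp (e j) k))] ultraU.
    have [f Ff fU] := TV (Not phi) (fun i => rpF (e i)).
    have [c cf] := mk f Ff.
    have /IH Hc := H c.
    have [k [[/existsNP nk fk] [ck]]] := filter_ex (filterI (filterI nU fU) (filterI cf Hc)).
    by rewrite /= envE ck; exact: fk.
have cC : countable [set: C].
  apply: (inj_countable (g := rp) cF) => // c d _ _ cd; apply: rp_inj.
  by rewrite cd; apply: filterE.
have infT : infinite_set [set: T].
  by case: catM => /eq_finite_set e _; rewrite e; exact: infinite_nat.
have infC : infinite_set [set: C].
  move=> /finite_set_enum[n [u uE]].
  (* If the hull were listed by [u], a witness for differing from all [u i] would be a new element;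
     at every index such a point exists in the infinite [T]. *)
  pose phi := Conj [seq Not (Eq (Var L (ord0 : 'I_n.+1)) (Var L (lift ord0 i))) | i <- enum 'I_n].
  have [f Ff fU] := TV phi (fun i => rpF (u i)).
  have [c cf] := mk f Ff.
  have [i _ uic] : range u c by rewrite -uE.
  have [k [/= ck H]] := filter_ex (filterI cf fU).
  have {}H : sat M phi (env_cons (f k) (fun j => rp (u j) k)).
    apply: H; apply: contrapT => nx; apply: infT.
    have -> : [set: T] = range (fun j => rp (u j) k).
      apply/seteqP; split=> // x _; apply: contrapT => nxu; apply: nx; exists x.
      apply/sat_Conj => j /=; rewrite env_cons0 env_consS => xj.
      by apply: nxu; exists j.
    exact: finite_image.
  move/sat_Conj: H => /(_ i) /=; rewrite env_cons0 env_consS; apply.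
  by rewrite uic.
have [h hiso] := catM.2 C N (eq_card_nat cC infC) (fun phi Mphi e =>
  (satN 0 phi e).2 (filterE _ (fun k => Mphi _))).
exists (rp \o h); split=> [t|f Ff|n phi e]; first exact: rpF.
  have [c cf] := mk f Ff; have [[h' hK h'K] _ _] := hiso.
  by exists (h' c); apply: filterS cf => k /= <-; rewrite h'K.
by rewrite (sat_iso hiso) satN.
Qed.
End LosTheorem.

Section SkolemHull.
Variables (L : language) (T : countType) (M : structure L T) (t0 : T) (I : Type).

(** Trees serve as Skolem terms: leaf [i] is the generator [b i], a node labelled [c] applies the
    Skolem function of the formula [G c]. Terms are evaluated separately at each index, so witnesses
    are correct at every [k] and any ultrafilter may be used later. *)
Lemma skolem_hull (b : nat -> I -> T) : exists F : set (I -> T),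
  [/\ countable F, forall i, F (b i) &
      forall n (phi : formula L n.+1) (e : 'I_n -> I -> T), (forall j, F (e j)) ->
        exists2 f, F f & forall k, (exists x, sat M phi (env_cons x (e ^~ k))) ->
                         sat M phi (env_cons (f k) (e ^~ k))].
Proof.
pose X := {n & formula L n.+1}.
have [G GP] : exists G : nat -> X, forall x, exists k, G k = x.
  apply: (@inj_enum _ (existT _ 0 (Falsum L 1))
    (fun x => pickle (tag x, formula_code (tagged x)))).
  move=> [n phi] [m psi] /(pcan_inj pickleK_inv)[/= nm]; subst m.
  by move=> /formula_code_inj ->.
have /choice[sk skP] : forall xv : X * seq T, exists y,
    (exists y, sat M (tagged xv.1) (env_cons y (fun j => nth t0 xv.2 j))) ->
    sat M (tagged xv.1) (env_cons y (fun j => nth t0 xv.2 j)).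
  move=> [x v]; have [[y Hy]|nH] := pselect (exists y,
    sat M (tagged x) (env_cons y (fun j => nth t0 v j))); first by exists y.
  by exists t0.
pose ev := fix ev (t : GenTree.tree nat) : I -> T := match t with
  | GenTree.Leaf i => b i
  | GenTree.Node c ts => fun k => sk (G c, [seq ev t k | t <- ts])
  end.
exists (range ev); split=> [|i|n phi e eF].
- exact: sub_countable (card_image_le _ _) (countableP _).
- by exists (GenTree.Leaf i).
have /choice[t tE] : forall j, exists t, ev t = e j by move=> j; have [t _ ?] := eF j; exists t.
have [c cE] := GP (existT _ n phi).
exists (ev (GenTree.Node c [seq t j | j <- enum 'I_n])).
  by exists (GenTree.Node c [seq t j | j <- enum 'I_n]).
move=> k [x Hx] /=; have := skP (G c, [seq ev t0 k | t0 <- [seq t j | j <- enum 'I_n]]).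
rewrite /= cE /=; have -> : (fun j : 'I_n =>
    nth t0 [seq ev t0 k | t0 <- [seq t j | j <- enum 'I_n]] j) = e^~ k.
  apply/funext => j; rewrite -map_comp (nth_map j) ?size_enum_ord//=.
  by rewrite nth_ord_enum tE.
by apply; exists x.
Qed.
End SkolemHull.

Section RyllNardzewski.
Variables (L : language) (T : countType) (M : structure L T).
Hypothesis catM : aleph0_categorical M.

Lemma categorical_infinite : infinite_set [set: T].
Proof. by case: catM => /eq_finite_set e _; rewrite e; exact: infinite_nat. Qed.

(** The realisation lies in [M] itself, not in an extension: solutions [e k] of the first [k]
    formulas form a tuple of the ultrapower along a nonprincipal ultrafilter, and a hull containing
    its coordinates is a copy of [M]. *)
Lemma categorical_compactness n (phi : nat -> formula L n) :
  (forall k, exists e, forall i, (i < k)%N -> sat M (phi i) e) ->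
  exists e, forall i, sat M (phi i) e.
Proof.
move=> /choice[e eP]; have [t0 _] := infinite_setN0 categorical_infinite.
have [U [ultraU ooU]] := ultraFilterLemma eventually_filter.
pose b i k := if insub i is Some j then e k j else t0.
have [F [cF bF FP]] := skolem_hull M t0 b.
have [|h [_ hF hsat]] := los_hull catM ultraU cF.
  move=> m psi u uF; have [f Ff fP] := FP _ psi u uF.
  by exists f => //; apply: filterE.
have /choice[t tP] : forall j : 'I_n, exists t, U [set k | h t k = e k j].
  move=> j; have [t tb] := hF _ (bF j); exists t; apply: filterS tb => k /= ->.
  by rewrite /b valK.
exists t => i; apply/hsat.
have tU : U [set k | forall j, h (t j) k = e k j] by exact: filter_forall.
have iU : U [set k | (i < k)%N] by apply: ooU; exists i.+1.
by apply: filterS2 tU iU => k /= /funext -> /eP.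
Qed.

(** [phi] isolates a complete type. An unsatisfiable formula also qualifies, so satisfiability is
    always demanded separately. *)
Definition complete n (phi : formula L n) := forall psi : formula L n,
  (forall e, sat M phi e -> sat M psi e) \/ (forall e, sat M phi e -> ~ sat M psi e).

Definition isolated n (e : 'I_n -> T) := exists2 phi, sat M phi e & complete phi.

(** Otherwise every satisfiable formula below [phi] splits, and a suitable half avoids any given
    tuple. Avoiding the countably many tuples of [M] one after another gives a decreasing sequence
    of satisfiable formulas, which compactness realises by a tuple of [M]. *)
Lemma complete_below n (phi : formula L n) e0 : sat M phi e0 ->
  exists psi e, [/\ complete psi, sat M psi e & forall e', sat M psi e' -> sat M phi e'].
Proof.
move=> phi0; apply: contrapT => nC.
have [c cP] : exists c : nat -> 'I_n -> T, forall e, exists k, c k = e.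
  apply: (@inj_enum _ e0 (fun e => pickle [seq e i | i <- enum 'I_n])).
  by move=> e e' /(pcan_inj pickleK_inv)/map_enum_inj/funext.
pose X := {psi : formula L n | (exists e, sat M psi e) /\
  forall e', sat M psi e' -> sat M phi e'}.
have /choice[nxt nxtP] : forall kx : nat * X, exists y : X,
    (forall e, sat M (sval y) e -> sat M (sval kx.2) e) /\ ~ sat M (sval y) (c kx.1).
  move=> [k [psi [[e se] sphi]]] /=.
  have [chi] : exists chi : formula L n, ~ ((forall e, sat M psi e -> sat M chi e) \/
      (forall e, sat M psi e -> ~ sat M chi e)).
    by apply/existsNP => cpsi; apply: nC; exists psi, e.
  move=> /not_orP[/existsNP[e1 /not_implyP[p1 c1]] /existsNP[e2 /not_implyP[p2 /contrapT c2]]].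
  have [cc|ncc] := pselect (sat M chi (c k)).
    have X1 : (exists e, sat M (And psi (Not chi)) e) /\
        forall e', sat M (And psi (Not chi)) e' -> sat M phi e'.
      split; first by exists e1; apply/sat_And.
      by move=> e' /sat_And[/sphi].
    exists (exist _ (And psi (Not chi)) X1); split=> [e'|] /sat_And[]//.
    by move=> _; apply.
  have X1 : (exists e, sat M (And psi chi) e) /\
      forall e', sat M (And psi chi) e' -> sat M phi e'.
    split; first by exists e2; apply/sat_And.
    by move=> e' /sat_And[/sphi].
  by exists (exist _ (And psi chi) X1); split=> [e'|] /sat_And[].
have X0 : (exists e, sat M phi e) /\ forall e', sat M phi e' -> sat M phi e'.
  by split=> //; exists e0.
pose s := fix s n := if n is m.+1 then nxt (m, s m) else exist _ phi X0.
have s_mono k l e : (k <= l)%N -> sat M (sval (s l)) e -> sat M (sval (s k)) e.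
  elim: l => [|l IH]; first by rewrite leqn0 => /eqP ->.
  rewrite leq_eqVlt => /orP[/eqP -> //|/IH kl] H.
  by apply: kl; exact: (nxtP (l, s l)).1.
have [|e eP] := categorical_compactness (phi := fun k => sval (s k)).
  by move=> k; have [[e se] _] := svalP (s k); exists e => i /ltnW/s_mono; exact.
have [k ck] := cP e; have := (nxtP (k, s k)).2; rewrite ck; apply.
exact: eP k.+1.
Qed.

Lemma isolated_ext n (e : 'I_n -> T) (phi : formula L n.+1) x :
  isolated e -> sat M phi (env_cons x e) ->
  exists2 y, sat M phi (env_cons y e) & isolated (env_cons y e).
Proof.
move=> [psi psie cpsi] phix.
have [|chi [u [cchi chiu chiP]]] :=
    @complete_below _ (And phi (rename psi (lift ord0))) (env_cons x e).
  apply/sat_And; split=> //; apply/sat_rename.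
  by have -> : env_cons x e \o lift ord0 = e by apply/funext => i /=; rewrite env_consS.
have /chiP/sat_And[_ /sat_rename psiu] := chiu.
have exu : sat M (Ex chi) (u \o lift ord0).
  by apply/sat_Ex; exists (u ord0); rewrite env_cons_eta.
have [/(_ _ psie)/sat_Ex[y chiy]|/(_ _ psiu)//] := cpsi (Ex chi).
exists y; first by have /chiP/sat_And[] := chiy.
by exists chi.
Qed.

Lemma isolated_drop n (e : 'I_n -> T) x : isolated (env_cons x e) -> isolated e.
Proof.
move=> [phi phie cphi]; exists (Ex phi); first by apply/sat_Ex; exists x.
move=> psi; have [H|H] := cphi (rename psi (lift ord0)).
  left=> u /sat_Ex[y /H/sat_rename].
  by have -> : env_cons y u \o lift ord0 = u by apply/funext => i /=; rewrite env_consS.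
right=> u /sat_Ex[y /H]; rewrite sat_rename.
by have -> : env_cons y u \o lift ord0 = u by apply/funext => i /=; rewrite env_consS.
Qed.

Lemma isolated_range n (e : 'I_n -> T) m (u : 'I_m -> T) :
  range u = range e -> isolated e -> isolated u.
Proof.
move=> ue [phi phie cphi].
have /choice[f fE] : forall i, exists j, u i = e j.
  by move=> i; have : range e (u i) by [rewrite -ue; exists i]; case=> j _ <-; exists j.
have /choice[g gE] : forall i, exists j, e i = u j.
  by move=> i; have : range u (e i) by [rewrite ue; exists i]; case=> j _ <-; exists j.
(* The equations make a tuple a function of its part read through [g], and [phi] isolates the type
   of that part. *)
exists (And (rename phi g) (Conj [seq Eq (Var L i) (Var L (g (f i))) | i <- enum 'I_m])).
  apply/sat_And; split; first by apply/sat_rename; have <- : e = u \o g by apply/funext.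
  by apply/sat_Conj => i /=; rewrite -gE -fE.
move=> psi; have [H|H] := cphi (rename psi f); [left|right] => v;
  move=> /sat_And[/sat_rename phiv /sat_Conj vE];
  have -> : v = (v \o g) \o f by apply/funext.
  by apply/sat_rename; exact: H.
by rewrite -sat_rename; exact: H.
Qed.

Definition isolated_set (F : set T) :=
  exists n (e : 'I_n -> T), F = range e /\ isolated e.

Lemma isolated_set_ext (F : set T) n (e : 'I_n -> T) (phi : formula L n.+1) :
  isolated_set F -> range e `<=` F -> (exists x, sat M phi (env_cons x e)) ->
  exists2 y, sat M phi (env_cons y e) & isolated_set (y |` F).
Proof.
move=> [m [u [-> iu]]] eu [x phix].
have /choice[f fE] : forall i, exists j, u j = e i.
  by move=> i; have [|j _ <-] := eu (e i); [exists i|exists j].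
have env_f z : env_cons z e = env_cons z u \o env_lift f.
  by rewrite env_cons_lift; congr env_cons; apply/funext => i /=; rewrite fE.
have [|y + iy] := @isolated_ext _ u (rename phi (env_lift f)) x iu.
  by apply/sat_rename; rewrite -env_f.
move=> /sat_rename; rewrite -env_f => phiy; exists y => //.
exists m.+1, (env_cons y u); split=> //; apply/seteqP; split=> z /=.
  case=> [->|[i _ <-]]; first by exists ord0; rewrite ?env_cons0.
  by exists (lift ord0 i); rewrite ?env_consS.
move=> [i _ <-]; case: (unliftP ord0 i) => [j|] ->; rewrite ?env_consS ?env_cons0.
  by right; exists j.
by left.
Qed.

Lemma isolated_set_sub (F : set T) n (e : 'I_n -> T) :
  isolated_set F -> range e `<=` F -> isolated e.
Proof.
move=> [m [u [-> iu]]] eu.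
(* Prepending the whole list of [F] to [e] does not change the range, so the long tuple is isolated;
   the added entries are then dropped one by one. *)
pose app := fix app k (v : nat -> T) : 'I_(k + n) -> T :=
  if k is l.+1 then env_cons (v l) (app l v) else e.
have appE k v : range (app k v) = [set v i | i in `I_k] `|` range e.
  elim: k => [|k IH] /=; first by rewrite (_ : `I_0 = set0) ?image_set0 ?set0U//;
    apply/seteqP; split=> x.
  apply/seteqP; split=> z.
    move=> [i _ <-]; case: (unliftP ord0 i) => [j|] ->; rewrite ?env_consS ?env_cons0.
      have : range (app k v) (app k v j) by exists j.
      by rewrite IH => -[[l /= lk <-]|?]; [left; exists l => //=; exact: ltnW|right].
    by left; exists k => /=.
  move=> H; have [->|] : z = v k \/ range (app k v) z.
    rewrite IH; case: H => [[l /=]|]; last by right; right.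
    by rewrite ltnS leq_eqVlt => /orP[/eqP -> <-|lk <-]; [left|right; left; exists l].
  - by exists ord0 => //; rewrite env_cons0.
  - by case=> j _ <-; exists (lift ord0 j) => //; rewrite env_consS.
have drop k v : isolated (app k v) -> isolated e.
  by elim: k => //= k IH /isolated_drop.
have [t0 _] := infinite_setN0 categorical_infinite.
apply: (@drop m (fun i => if insub i is Some j then u j else t0)).
apply: isolated_range iu; rewrite appE; apply/seteqP; split=> z.
  by case=> [[i /= im <-]|/eu//]; rewrite insubT//; exists (Sub i im).
by move=> [i _ <-]; left; exists i => //=; rewrite valK.
Qed.

(* An elementary submodel built from isolated tuples is isomorphic to [M]. *)
Lemma categorical_atomic n (e : 'I_n -> T) : isolated e.
Proof.
pose X := {n & (formula L n.+1 * ('I_n -> T))%type}.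
have [t0 _] := infinite_setN0 categorical_infinite.
have [G GP] : exists G : nat -> X, forall x m, exists2 k, (m <= k)%N & G k = x.
  apply: (@inj_enum_io _ (existT _ 0 (Falsum L 1, fun=> t0))
    (fun x => pickle (tag x, formula_code (tagged x).1,
       [seq (tagged x).2 i | i <- enum 'I_(tag x)]))).
  move=> [k [phi u]] [m [psi v]] /(pcan_inj pickleK_inv)[/= km]; subst m.
  by move=> /formula_code_inj -> /map_enum_inj/funext ->.
pose S := {F : set T | isolated_set F}.
have S0 : isolated_set set0.
  have [psi [u [cpsi psiu _]]] := @complete_below 0 (Not (Falsum L 0)) (fun=> t0) id.
  exists 0, u; split; last by exists psi.
  by apply/seteqP; split=> // x [[]].
have /choice[nxt nxtP] : forall kF : nat * S, exists F' : S, sval kF.2 `<=` sval F' /\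
    (range (tagged (G kF.1)).2 `<=` sval kF.2 ->
     (exists x, sat M (tagged (G kF.1)).1 (env_cons x (tagged (G kF.1)).2)) ->
     exists2 y, sval F' y & sat M (tagged (G kF.1)).1 (env_cons y (tagged (G kF.1)).2)).
  move=> [i [F iF]] /=; case: (G i) => [k [phi u]] /=.
  have [[uF phiu]|nH] := pselect (range u `<=` F /\ exists x, sat M phi (env_cons x u)).
    have [y phiy iy] := isolated_set_ext iF uF phiu.
    by exists (exist _ _ iy); split=> [x Fx|_ _]; [right|exists y => //; left].
  by exists (exist _ F iF); split=> // uF phiu; exfalso; apply: nH.
pose s := fix s n := if n is m.+1 then nxt (m, s m) else exist _ set0 S0.
have s_mono k l : (k <= l)%N -> sval (s k) `<=` sval (s l).
  elim: l => [|l IH]; first by rewrite leqn0 => /eqP ->.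
  rewrite leq_eqVlt => /orP[/eqP -> //|/IH kl] x /kl.
  exact: (nxtP (l, s l)).1.
have s_range m (u : 'I_m -> T) : (forall j, exists k, sval (s k) (u j)) ->
    exists k, range u `<=` sval (s k).
  move=> /choice[k kP]; exists (\max_j k j) => _ [j _ <-].
  by apply: s_mono (kP j); exact: leq_bigmax.
(* With a one-point index set the ultrapower is [M], and [los_hull] becomes the statement that this
   elementary submodel is isomorphic to [M]. *)
pose N := [set fun _ : unit => y | y in \bigcup_k sval (s k)].
have [|m phi u uN|h [hN _ hsat]] :=
    @los_hull _ _ _ _ _ N catM (principal_filter_ultra tt).
- exact: sub_countable (card_image_le _ _) (countableP _).
- have [k uk] : exists k, range (fun j => u j tt) `<=` sval (s k).
    by apply: s_range => j; have [y [k _ ky] <-] := uN j; exists k.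
  have [k' kk' Gk'] := GP (existT _ m (phi, fun j => u j tt)) k.
  have [_] := nxtP (k', s k'); rewrite /= Gk' /= => H.
  have [phix|nphi] := pselect (exists x, sat M phi (env_cons x (u^~ tt))).
    have [y sy phiy] := H (subset_trans uk (s_mono _ _ kk')) phix.
    exists (fun=> y); first by exists y => //; exists k'.+1.
    by apply/principal_filterP => /=.
  (* No witness exists, but some element of the submodel must still be named; an always true formula
     provides one. *)
  have [l _ Gl] := GP (existT _ 0 (Not (Falsum L 1), fun=> t0)) 0.
  have [_] := nxtP (l, s l); rewrite /= Gl /= => -[_ [[]]//||y sy _].
    by exists t0.
  exists (fun=> y); first by exists y => //; exists l.+1.
  by apply/principal_filterP => /=.
have [k ek] : exists k, range (fun j => h (e j) tt) `<=` sval (s k).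
  by apply: s_range => j; have [y [k _ ky] <-] := hN (e j); exists k.
have [phi phie cphi] := isolated_set_sub (svalP (s k)) ek.
exists phi; last exact: cphi.
by apply/hsat/principal_filterP.
Qed.
End RyllNardzewski.

(* For [H = Aut(M)], [M] aleph0-categorical: the finite algebraically closed sets. *)
Definition orbit_closed (T : Type) (H : subgroup (sym T)) (A : set T) :=
  finite_set A /\ forall a,
    finite_set [set (g : sym T) a | g in (H : set (sym T)) `&` pointwise_stab A] -> A a.

(* [H] is closed in [sym T]. *)
Definition complete_subgroup (T : Type) (H : subgroup (sym T)) :=
  forall g : sym T, (forall F : set T, finite_set F ->
    exists2 h : sym T, sg_set H h & forall x, F x -> h x = g x) -> sg_set H g.

(** * Homogeneity, oligomorphy and algebraic closure by orbits *)

Section Homogeneity.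
Variables (L : language) (T : countType) (M : structure L T).
Hypothesis catM : aleph0_categorical M.

Lemma complete_agree n (phi psi : formula L n) u v : complete M phi ->
  sat M phi u -> sat M phi v -> sat M psi u <-> sat M psi v.
Proof.
move=> /(_ psi)[] H pu pv; have := H _ pu; have := H _ pv; tauto.
Qed.

(** Atomicity replaces saturation: the type of [x] over [u] is isolated by one formula, and that
    this formula has a solution belongs to the type of [u]. *)
Lemma type_ext n (u v : 'I_n -> T) x : (forall phi, sat M phi u <-> sat M phi v) ->
  exists y, forall phi, sat M phi (env_cons x u) <-> sat M phi (env_cons y v).
Proof.
move=> uv; have [chi chix cchi] := categorical_atomic catM (env_cons x u).
have : sat M (Ex chi) u by apply/sat_Ex; exists x.
by move=> /uv/sat_Ex[y chiy]; exists y => phi; exact: complete_agree cchi chix chiy.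
Qed.

Lemma homogeneous n (e e' : 'I_n -> T) : (forall phi, sat M phi e <-> sat M phi e') ->
  exists2 g : sym T, sg_set (aut M) g & g \o e = e'.
Proof.
move=> ee'; have [t0 _] := infinite_setN0 (categorical_infinite catM).
pose P (S : set (T * T)) := finite_set S /\ forall m (phi : formula L m) u,
  (forall i, S (u i)) -> sat M phi (fst \o u) <-> sat M phi (snd \o u).
have Pcons S m (v : 'I_m -> T * T) x y : S = range v ->
    (forall phi, sat M phi (env_cons x (fst \o v)) <-> sat M phi (env_cons y (snd \o v))) ->
    P ((x, y) |` S).
  move=> -> xy; split; first by rewrite finite_setU; split=> //; exact: finite_image.
  move=> k phi u uS.
  have /choice[f fE] : forall i, exists j, u i = env_cons (x, y) v j.
    move=> i; case: (uS i) => [->|[j _ <-]]; first by exists ord0; rewrite env_cons0.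
    by exists (lift ord0 j); rewrite env_consS.
  have -> : u = env_cons (x, y) v \o f by apply/funext.
  by rewrite 2!compA 2!comp_env_cons /= -2!sat_rename.
have P_inj S p q : P S -> S p -> S q -> p.1 = q.1 <-> p.2 = q.2.
  move=> [_ PS] Sp Sq.
  pose phi := Eq (Var L (ord0 : 'I_2)) (Var L (lift ord0 ord0)).
  have [|] := PS 2 phi (env_cons p (fun=> q)).
    by move=> i; case: (unliftP ord0 i) => [j|] ->; rewrite ?env_consS ?env_cons0.
  by rewrite /= env_cons0 env_consS.
have [||||f [g [fg gf fS]]] := @back_and_forth T T t0 t0 setT setT P
    (range (fun i => (e i, e' i))) (countableP _) (countableP _) _ P_inj.
- by [].
- split=> [|m phi u uS]; first exact: finite_image.
  have /choice[k kE] : forall i, exists j, (e j, e' j) = u i.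
    by move=> i; have [j _ ?] := uS i; exists j.
  have -> : fst \o u = e \o k by apply/funext => i /=; rewrite -kE.
  have -> : snd \o u = e' \o k by apply/funext => i /=; rewrite -kE.
  by rewrite -2!sat_rename.
- move=> S x [/finite_set_enum[m [v vE]] PS] _.
  have [|y xy] := @type_ext _ (fst \o v) (snd \o v) x.
    by move=> phi; apply: PS => i; rewrite vE; exists i.
  by exists y; exact: Pcons vE xy.
- move=> S y [/finite_set_enum[m [v vE]] PS] _.
  have [|x xy] := @type_ext _ (snd \o v) (fst \o v) y.
    by move=> phi; apply: iff_sym; apply: PS => i; rewrite vE; exists i.
  by exists x; apply: Pcons vE _ => phi; exact: iff_sym.
have fK : cancel f g by move=> x; have [] := fg x I.
have gK : cancel g f by move=> x; have [] := gf x I.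
have satf m (phi : formula L m) u : sat M phi u <-> sat M phi (f \o u).
  have [|//|S PS [_ uS]] := fS (range u); first exact: finite_image.
  by apply: (PS.2 m phi (fun i => (u i, f (u i)))) => i; apply: uS; exists i.
exists (Sym fK gK).
  split; first by exists g.
    move=> F xs /=.
    pose phi := Eq (Var L (ord0 : 'I_(farity F).+1)) (App (fun i => Var L (lift ord0 i))).
    have := satf _ phi (env_cons (finterp M xs) xs).
    rewrite comp_env_cons /= !env_cons0 => -[+ _].
    have -> : (fun i => env_cons (finterp M xs) xs (lift ord0 i)) = xs.
      by apply/funext => i; rewrite env_consS.
    move=> /(_ erefl) ->; congr finterp; apply/funext => i.
    by rewrite env_consS.
  by move=> r xs; exact: satf _ (Rel (fun i => Var L i)) xs.
apply/funext => i /=; have [|//|S PS [S0 /(_ (e i))uS]] := fS [set e i]; first exact: finite_set1.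
by apply/(P_inj S (e i, f (e i)) (e i, e' i) PS) => //=; [exact: uS|apply: S0; exists i].
Qed.

Lemma orbit_eq (H : subgroup (sym T)) n (u : 'I_n -> T) (g : sym T) : sg_set H g ->
  [set (h : T -> T) \o (g \o u) | h in (H : set (sym T))] =
  [set (h : T -> T) \o u | h in (H : set (sym T))].
Proof.
move=> Hg; apply/seteqP; split=> _ [h Hh <-].
  by exists (h * g) => //; exact: sgM.
exists (h * g^-1); first by apply: sgM => //; exact: sgV.
by apply/funext => i /=; rewrite sym_funK.
Qed.

(** If no finite number of complete formulas covered all [n]-tuples, their negations (with
    incomplete formulas replaced by truth) would be finitely satisfiable, and a tuple realising all
    of them would not be isolated. Each complete formula defines at most one orbit by
    homogeneity. *)
Lemma categorical_oligomorphic : oligomorphic (aut M : set (sym T)).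
Proof.
move=> n; have [t0 _] := infinite_setN0 (categorical_infinite catM).
have [F FP] : exists F : nat -> formula L n, forall phi, exists k, F k = phi.
  apply: (@inj_enum _ (Falsum L n) (fun phi => pickle (formula_code phi))).
  by move=> phi psi /(pcan_inj pickleK_inv)/formula_code_inj.
have [k kP] : exists k, forall e, exists i, [/\ (i < k)%N, complete M (F i) & sat M (F i) e].
  apply: contrapT => nk.
  pose phi i := if pselect (complete M (F i)) then Not (F i) else Not (Falsum L n).
  have [|e eP] := categorical_compactness catM (phi := phi).
    move=> k; apply: contrapT => ne; apply: nk; exists k => e; apply: contrapT => ni.
    apply: ne; exists e => i ik; rewrite /phi; case: pselect => [cF|_ []] sF.
    by apply: ni; exists i.
  have [psi psie cpsi] := categorical_atomic catM e.
  have [i iE] := FP psi; have := eP i; rewrite /phi iE.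
  by case: pselect => //= _; exact.
have /choice[r rP] : forall i, exists e, (exists u, sat M (F i) u) -> sat M (F i) e.
  move=> i; have [[e He]|ne] := pselect (exists u, sat M (F i) u); first by exists e.
  by exists (fun=> t0).
apply: sub_finite_set (finite_image (fun i =>
  [set (h : T -> T) \o r i | h in (aut M : set (sym T))]) (finite_II k)).
move=> _ [e _ <-]; have [i [ik cF Fe]] := kP e; exists i => //.
have Fr : sat M (F i) (r i) by apply: rP; exists e.
have [g Mg gE] := homogeneous (fun phi => complete_agree phi cF Fr Fe).
by rewrite -gE orbit_eq.
Qed.

(** A formula over [A] that holds at [a] contains the orbit of [a] over [A], and the formula
    isolating [a] over a listing of [A] defines exactly this orbit. *)
Lemma acl_orbit_closed (A : set T) : finite_set A ->
  algebraically_closed M A <-> orbit_closed (aut M) A.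
Proof.
move=> fA; have [n [b bA]] := finite_set_enum fA.
split=> [aclA|[_ gA]].
  split=> // a fa; rewrite -aclA.
  have [phi phia cphi] := categorical_atomic catM (env_cons a b).
  exists n, phi, b; split=> //; first by move=> i; rewrite bA; exists i.
  apply: sub_finite_set fa => x phix.
  have [g Mg gE] := homogeneous (fun psi => complete_agree psi cphi phia phix).
  have gb i : g (b i) = b i.
    by have /(congr1 (@^~ (lift ord0 i))) := gE; rewrite /= !env_consS.
  exists g; first by split=> // y; rewrite bA => -[i _ <-].
  by have /(congr1 (@^~ ord0)) := gE; rewrite /= !env_cons0.
apply/seteqP; split=> a; last first.
  move=> Aa; exists 1%N, (Eq (Var L ord0) (Var L (lift ord0 ord0))), (fun=> a).
  split=> //; last by rewrite /= env_cons0 env_consS.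
  by apply: sub_finite_set (finite_set1 a) => x; rewrite /= env_cons0 env_consS.
move=> [m [phi [c [cA fphi phia]]]]; apply: gA.
apply: sub_finite_set fphi => _ [g [Mg gA] <-] /=.
have := (sat_iso Mg phi (env_cons a c)).1 phia; rewrite comp_env_cons.
by have -> : g \o c = c by apply/funext => i /=; exact: gA.
Qed.
End Homogeneity.

Lemma aut_complete L T (M : structure L T) : complete_subgroup (aut M).
Proof.
move=> g H; split.
- exact: (Bijective (symKV g) (symVK g)).
- move=> F xs; have [|h [_ hf _] hg] := H (range xs `|` [set finterp M xs]).
    by rewrite finite_setU; split; [exact: finite_image|exact: finite_set1].
  rewrite -hg; last by right.
  rewrite hf; congr finterp; apply/funext => i /=.
  by apply: hg; left; exists i.
- move=> r xs; have [|h [_ _ hr] hg] := H (range xs); first exact: finite_image.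
  rewrite hr; suff -> : h \o xs = g \o xs by [].
  by apply/funext => i /=; apply: hg; exists i.
Qed.

(** * The orbit structure of an oligomorphic group *)

Lemma oligomorphicP (T : Type) (H : subgroup (sym T)) :
  oligomorphic (H : set (sym T)) <-> forall n, exists k (r : 'I_k -> 'I_n -> T),
    forall e, exists i, exists2 g : sym T, sg_set H g & g \o r i = e.
Proof.
split=> [olig n|olig n].
  have [k [u uE]] := finite_set_enum (olig n).
  have /choice[r rP] : forall i, exists e : 'I_n -> T,
      [set (g : T -> T) \o e | g in (H : set (sym T))] = u i.
    by move=> i; have : range u (u i) by [exists i]; rewrite -uE => -[e _ <-]; exists e.
  exists k, r => e; have : range u [set (g : T -> T) \o e | g in (H : set (sym T))].
    by rewrite -uE; exists e.
  move=> [i _ iE]; exists i; have : u i e by rewrite iE; exists 1 => //; exact: sg1.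
  by rewrite -rP => -[g Hg ge]; exists g.
have [k [r rP]] := olig n; apply: sub_finite_set (finite_image (fun i =>
  [set (g : T -> T) \o r i | g in (H : set (sym T))]) (finite_finset (X := [set: 'I_k]))).
move=> _ [e _ <-]; have [i [g Hg <-]] := rP e; exists i => //; apply/seteqP; split=> _ [h Hh <-].
  exists (h * g^-1); first by apply: sgM => //; exact: sgV.
  by apply/funext => j /=; rewrite sym_funK.
by exists (h * g) => //; exact: sgM.
Qed.

Section CloseAll.
Variables (L : language).
Fixpoint close_all n : formula L n -> formula L 0 :=
  if n is m.+1 then fun phi => close_all (All phi) else id.

Lemma models_close_all (T : Type) (M : structure L T) n (phi : formula L n) :
  models M (close_all phi) <-> forall e, sat M phi e.
Proof.
elim: n phi => [|n IH] phi; first by split.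
rewrite /= IH; split=> [H e|H e x]; last exact: H.
by rewrite -[e]env_cons_eta; exact: H.
Qed.
End CloseAll.

Section OrbitStructure.
Variables (T : countType) (H : subgroup (sym T)).

(** The language of the canonical structure of a permutation group: every finite tuple is a symbol
    naming its own orbit, so the language is countable whatever the group. *)
Definition orbit_language : language :=
  @Language void (fun v => match v with end) (seq T) size.

Definition orbit_structure : structure orbit_language T :=
  @Structure orbit_language T (fun f => match f with end)
    (fun (r : seq T) xs => exists2 g : sym T, sg_set H g &
       forall i, xs i = g (tnth (in_tuple r) i)).

Local Notation L := orbit_language.
Local Notation M := orbit_structure.

Lemma aut_orbit_structure : complete_subgroup H -> aut M = H :> set (sym T).
Proof.
move=> cH; apply/seteqP; split=> g.
  move=> [_ _ gr]; apply: cH => F /finite_seqP[r ->].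
  have /gr[h Hh hE] : rinterp M (r := r) (tnth (in_tuple r)) by exists 1 => //; exact: sg1.
  by exists h => // x /(@tnthP _ _ (in_tuple r))[i ->]; rewrite -hE.
move=> Hg; split; [exact: (Bijective (symKV g) (symVK g))|by case|].
move=> r xs; split=> [] [h Hh hE].
  by exists (g * h); [exact: sgM|move=> i /=; rewrite hE].
exists (g^-1 * h); first by apply: sgM => //; exact: sgV.
by move=> i; rewrite symM -hE /= sym_funK.
Qed.

Lemma orbit_formula n (u : 'I_n -> T) : exists phi : formula L n,
  forall e, sat M phi e <-> exists2 g : sym T, sg_set H g & g \o u = e.
Proof.
pose r := [seq u i | i <- enum 'I_n].
have rn : size r = n by rewrite size_map size_enum_ord.
exists (@Rel L n r (fun i => Var L (cast_ord rn i))) => e /=; split=> -[g Hg gE].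
  exists g => //; apply/funext => i /=.
  have := gE (cast_ord (esym rn) i); rewrite cast_ordKV => ->.
  congr (g _); rewrite (tnth_nth (u i)) /= (nth_map i) ?size_enum_ord//.
  by congr u; apply: val_inj; rewrite /= nth_enum_ord.
exists g => // i; rewrite -gE /=; congr (g _).
rewrite (tnth_nth (u (cast_ord rn i))) /= (nth_map (cast_ord rn i)) ?size_enum_ord//=.
  by congr u; apply: val_inj; rewrite /= nth_enum_ord//= -rn.
by rewrite -rn.
Qed.

Lemma oligomorphic_ext n (u : 'I_n -> T) (t0 : T) : oligomorphic (H : set (sym T)) ->
  exists k (x : 'I_k -> T), forall y, exists i,
    exists2 g : sym T, sg_set H g & g \o env_cons (x i) u = env_cons y u.
Proof.
move=> /oligomorphicP/(_ n.+1)[k [r rP]].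
have /choice[x xP] : forall i, exists x, forall y,
    (exists2 g : sym T, sg_set H g & g \o r i = env_cons y u) ->
    exists2 g : sym T, sg_set H g & g \o r i = env_cons x u.
  move=> i; have [[y yP]|ny] := pselect (exists y, exists2 g : sym T, sg_set H g &
    g \o r i = env_cons y u); first by exists y.
  by exists t0 => y yP; exfalso; apply: ny; exists y.
exists k, x => y; have [i [g Hg gE]] := rP (env_cons y u).
have [|h Hh hE] := xP i y; first by exists g.
exists i, (g * h^-1); first by apply: sgM => //; exact: sgV.
by rewrite -gE -hE; apply/funext => j /=; rewrite sym_funK.
Qed.

(** Back-and-forth along orbit formulas. Forth is the sentence that every tuple in the orbit of [u]
    extends to one in the orbit of [(x, u)]; back says that every extension falls into one of
    finitely many such orbits, which is a sentence only because of oligomorphicity. Both hold in the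
    orbit structure and so in [N]. *)
Lemma orbit_structure_categorical : infinite_set [set: T] ->
  oligomorphic (H : set (sym T)) -> aleph0_categorical M.
Proof.
move=> infT olig; split; first exact: eq_card_nat (countableP _) infT.
move=> T' N cT' MN.
have [t0 _] := infinite_setN0 infT.
have [t0' _] : [set: T'] !=set0.
  by apply: infinite_setN0; rewrite (eq_finite_set cT'); exact: infinite_nat.
have cT : countable [set: T'] by rewrite (eq_countable cT'); exact: countableP.
have transfer n (phi : formula L n) : (forall e, sat M phi e) -> forall e, sat N phi e.
  by move=> /models_close_all/MN/models_close_all.
have /(_ _)/choice orb_choice := orbit_formula.
pose O n : ('I_n -> T) -> formula L n := projT1 (orb_choice n).
have OP n u e : sat M (O n u) e <-> exists2 g : sym T, sg_set H g & g \o u = e.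
  exact: (projT2 (orb_choice n)).
have Orename n m (u : 'I_n -> T) (k : 'I_m -> 'I_n) e :
    sat N (O n u) e -> sat N (O m (u \o k)) (e \o k).
  have : forall e, sat N (Imp (O n u) (rename (O m (u \o k)) k)) e.
    apply: transfer => e' /=; rewrite sat_rename !OP => -[g Hg <-].
    by exists g.
  by move=> /(_ e)/=; rewrite sat_rename.
pose P (S : set (T * T')) := finite_set S /\
  forall n (w : 'I_n -> T * T'), (forall i, S (w i)) -> sat N (O n (fst \o w)) (snd \o w).
have Prange n (v : 'I_n -> T * T') : sat N (O n (fst \o v)) (snd \o v) -> P (range v).
  move=> Ov; split=> [|m w wv]; first exact: finite_image.
  have /choice[k kE] : forall i, exists j, v j = w i by move=> i; have [j _ <-] := wv i; exists j.
  have -> : w = v \o k by apply/funext => i /=; rewrite kE.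
  exact: (Orename _ _ (fst \o v) k (snd \o v)).
have Pcons S n (v : 'I_n -> T * T') x y : S = range v ->
    sat N (O n.+1 (env_cons x (fst \o v))) (env_cons y (snd \o v)) -> P ((x, y) |` S).
  move=> -> Ov; have -> : (x, y) |` range v = range (env_cons (x, y) v).
    apply/seteqP; split=> z.
      case=> [->|[i _ <-]]; first by exists ord0; rewrite ?env_cons0.
      by exists (lift ord0 i); rewrite ?env_consS.
    move=> [i _ <-]; case: (unliftP ord0 i) => [j|] ->; rewrite ?env_consS ?env_cons0.
      by right; exists j.
    by left.
  by apply: Prange; rewrite 2!comp_env_cons.
have P_inj S p q : P S -> S p -> S q -> p.1 = q.1 <-> p.2 = q.2.
  move=> [_ PS] Sp Sq; pose w := env_cons p (fun _ : 'I_1 => q).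
  have Ow : sat N (O 2 (fst \o w)) (snd \o w).
    by apply: PS => i; rewrite /w; case: (unliftP ord0 i) => [j|] ->; rewrite ?env_consS ?env_cons0.
  pose eq01 := Eq (Var L (ord0 : 'I_2)) (Var L (lift ord0 ord0)).
  have w0 (X : Type) (f : T * T' -> X) : (f \o w) ord0 = f p by rewrite /w /= env_cons0.
  have w1 (X : Type) (f : T * T' -> X) : (f \o w) (lift ord0 ord0) = f q by rewrite /w /= env_consS.
  have [pq|pq] := pselect (p.1 = q.1); split=> // e.
    have /(_ (snd \o w) Ow) : forall e, sat N (Imp (O 2 (fst \o w)) eq01) e.
      by apply: transfer => u /= /OP[g Hg <-]; rewrite -2![(g \o _) _]/(g _) w0 w1 pq.
    by move=> E; rewrite -(w0 _ snd) -(w1 _ snd); exact: E.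
  have /(_ (snd \o w) Ow) : forall e, sat N (Imp (O 2 (fst \o w)) (Not eq01)) e.
    apply: transfer => u /= /OP[g Hg <-]; rewrite -2![(g \o _) _]/(g _) w0 w1.
    by move=> /(can_inj (symKV g)).
  move=> E; exfalso; apply: E.
  suff : (snd \o w) ord0 = (snd \o w) (lift ord0 ord0) by [].
  by rewrite w0 w1.
have O_ext n (u : 'I_n -> T) x e : sat N (O n u) e ->
    exists y, sat N (O n.+1 (env_cons x u)) (env_cons y e).
  move=> Oe; have /(_ e Oe)/sat_Ex : forall e, sat N (Imp (O n u) (Ex (O n.+1 (env_cons x u)))) e.
    apply: transfer => v /OP[g Hg <-]; apply/sat_Ex; exists (g x); apply/OP.
    by exists g => //; rewrite comp_env_cons.
  by [].
have O_back n (u : 'I_n -> T) y e : sat N (O n u) e ->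
    exists x, sat N (O n.+1 (env_cons x u)) (env_cons y e).
  move=> Oe; have [k [x xP]] := oligomorphic_ext u t0 olig.
  pose psi := Not (Conj [seq Not (O n.+1 (env_cons (x i) u)) | i <- enum 'I_k]).
  have /(_ e Oe y) : forall e, sat N (Imp (O n u) (All psi)) e.
    apply: transfer => v /OP[g Hg <-] z /sat_Conj H'.
    have [i [h Hh hE]] := xP (g^-1 z); apply: (H' i); apply/OP.
    exists (g * h); first exact: sgM.
    have -> : (g * h : sym T) \o env_cons (x i) u = g \o (h \o env_cons (x i) u) by [].
    by rewrite hE comp_env_cons symVK.
  move=> H'; apply: contrapT => nx; apply: H'; apply/sat_Conj => i Oi.
  by apply: nx; exists (x i).
have [||||f [g [fg gf fS]]] := @back_and_forth T T' t0 t0' setT setT P set0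
  (countableP _) cT _ P_inj.
- by [].
- have -> : set0 = range (fun i : 'I_0 => (t0, t0')) by apply/seteqP; split=> // z [[]].
  apply: Prange.
  have [phi] : exists phi : formula L 0, phi = O 0 (fst \o (fun=> (t0, t0'))) by eexists.
  move=> E; rewrite -E; apply: (transfer 0 phi) => e; rewrite E OP.
  by exists 1; [exact: sg1|apply/funext => -[]].
- move=> S x [/finite_set_enum[n [v vE]] PS] _.
  have [|y Oy] := @O_ext n (fst \o v) x (snd \o v).
    by apply: PS => i; rewrite vE; exists i.
  by exists y; exact: Pcons vE Oy.
- move=> S y [/finite_set_enum[n [v vE]] PS] _.
  have [|x Ox] := @O_back n (fst \o v) y (snd \o v).
    by apply: PS => i; rewrite vE; exists i.
  by exists x; exact: Pcons vE Ox.
exists f; split; [|by case|].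
  by exists g => x; [have [] := fg x I|have [] := gf x I].
move=> r xs.
have [|//|S [_ PS] [_ xsS]] := fS (range xs); first exact: finite_image.
have Oxs : sat N (O _ xs) (f \o xs).
  by apply: (PS _ (fun i => (xs i, f (xs i)))) => i; apply: xsS; exists i.
have [rxs|nrxs] := pselect (rinterp M xs); split=> //.
  have : forall e, sat N (Imp (O _ xs) (Rel (r := r) (fun i => Var L i))) e.
    apply: transfer => e /OP[h Hh <-].
    have [k Hk kE] := rxs; exists (h * k); first exact: sgM.
    by move=> i /=; rewrite kE.
  by move=> /(_ _ Oxs).
have : forall e, sat N (Imp (O _ xs) (Not (Rel (r := r) (fun i => Var L i)))) e.
  apply: transfer => e /OP[h Hh <-] [k Hk kE].
  apply: nrxs; exists (h^-1 * k); first by apply: sgM => //; exact: sgV.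
  by move=> i; rewrite symM -kE /= sym_funK.
by move=> /(_ _ Oxs) nr /nr.
Qed.
End OrbitStructure.

(** * Connected subgroups and their cosets *)

Section TameGroups.
Variable G : topGroupType.
Implicit Types (U V W P Q : set G) (g a x : G).

Definition open_sub U := [/\ open U, U 1, forall x y, U x -> U y -> U (x * y) &
  forall x, U x -> U x^-1].

Definition lcos a U : set G := [set x | U (a^-1 * x)].

Definition finite_index V U := exists2 F : set G, finite_set F &
  forall x, U x -> exists2 a, F a & lcos a V x.

(* In [Aut(M)]: the pointwise stabilisers of finite algebraically closed sets. *)
Definition conn U := open_sub U /\ forall V, open_sub V -> V `<=` U ->
  finite_index V U -> U `<=` V.

(* Chains of connected subgroups above [U] have at most [n] strict steps. *)
Fixpoint rk n U := forall V, conn V -> U `<=` V ->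
  V `<=` U \/ (if n is m.+1 then rk m V else False).

Definition coset n P := exists U a, [/\ conn U, rk n U & P = lcos a U].

Definition cosets P := exists n, coset n P.

Definition conjs g P : set G := [set x | P (g^-1 * x * g)].

(** The interface between permutation groups and abstract topological groups: no field mentions
    points of a domain. [tame_complete] stands for closedness in the symmetric group: a coherent
    choice of left cosets has a common point, and its last premise, that every [W] has a right coset
    among the chosen ones, is what makes the limit map onto. [tame_orbits] is oligomorphicity of
    conjugation on one level over finitely many parameters, and [tame_norm] bounds the ambiguity of
    conjugating elements. *)
Record tame : Prop := Tame {
  tame_base : forall U, open U -> U 1 -> exists2 V, conn V & V `<=` U;
  tame_sep : forall x, (forall U, conn U -> U x) -> x = 1;
  tame_complete : forall c : set G -> set G,
    (forall U, conn U -> exists a, c U = lcos a U) ->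
    (forall U V, conn U -> conn V -> U `<=` V -> c U `<=` c V) ->
    (forall W, conn W -> exists U a, conn U /\ c U = [set x | W (x * a^-1)]) ->
    exists h, forall U, conn U -> c U h;
  tame_countable : countable [set P | cosets P];
  tame_rk : forall U, conn U -> exists n, rk n U;
  tame_orbits : forall n (S : set (set G)), finite_set S -> S `<=` cosets ->
    exists2 L : set (set G), finite_set L &
      L `<=` coset n /\ forall Q, coset n Q -> exists2 Q', L Q' &
        exists2 g, Q = conjs g Q' & forall P, S P -> conjs g P = P;
  tame_gen : exists r, forall V, conn V -> exists S : set (set G),
    [/\ finite_set S, forall W, S W -> conn W /\ rk r W & V = \bigcap_(W in S) W];
  tame_index : forall U, open_sub U -> exists V, [/\ conn V, V `<=` U & finite_index V U];
  tame_norm : forall U, conn U -> finite_index U [set g | conjs g U = U];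
  tame_infinite : forall r, (forall V, conn V -> exists S : set (set G),
    [/\ finite_set S, forall W, S W -> conn W /\ rk r W & V = \bigcap_(W in S) W]) ->
    infinite_set [set P | coset r P] }.

Lemma rk_mono m n U : (m <= n)%N -> rk m U -> rk n U.
Proof.
elim: n m U => [|n IH] [|m] U // mn rU V cV UV.
  by have [?|[]] := rU V cV UV; left.
by have [?|rV] := rU V cV UV; [left|right; apply: IH rV].
Qed.

Lemma conjs1 P : conjs 1 P = P.
Proof. by apply/seteqP; split=> x; rewrite /conjs /= invg1 mul1g mulg1. Qed.

Lemma conjsM g h P : conjs (g * h) P = conjs g (conjs h P).
Proof. by apply/seteqP; split=> x; rewrite /conjs /= invgM !mulgA. Qed.

Lemma conjsK g P : conjs g^-1 (conjs g P) = P.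
Proof. by rewrite -conjsM mulVg conjs1. Qed.

Lemma conjg_continuous g : continuous (fun x : G => g^-1 * x * g).
Proof.
move=> x; apply: (@continuous_comp _ _ _ (fun x => (g^-1 * x, g))
  (fun z : G * G => z.1 * z.2)); last exact: mulg_continuous.
apply: cvg_pair; last exact: cvg_cst.
apply: (@continuous_comp _ _ _ (fun x => (g^-1, x))
  (fun z : G * G => z.1 * z.2)); last exact: mulg_continuous.
by apply: cvg_pair; [exact: cvg_cst|exact: cvg_id].
Qed.
End TameGroups.

(** * Invariance under topological isomorphisms *)

Record group_homeo (G K : topGroupType) (f : G -> K) (f' : K -> G) : Prop := GroupHomeo {
  ghK : cancel f f';
  ghVK : cancel f' f;
  ghM : {morph f : x y / x * y};
  gh_cont : continuous f;
  gh_cont' : continuous f' }.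

Lemma group_homeo_sym (G K : topGroupType) (f : G -> K) (f' : K -> G) :
  group_homeo f f' -> group_homeo f' f.
Proof.
move=> [fK f'K fM cf cf']; split=> // x y.
by apply: (can_inj fK); rewrite fM !f'K.
Qed.

Lemma group_homeo_conj (G : topGroupType) (g : G) :
  group_homeo (fun x => g^-1 * x * g) (fun x => g * x * g^-1).
Proof.
split=> [x|x|x y||].
- by rewrite !mulgA mulgV mul1g mulgK.
- by rewrite !mulgA mulVg mul1g mulgVK.
- by rewrite !mulgA mulgK.
- exact: conjg_continuous.
- by have := @conjg_continuous G g^-1; rewrite invgK.
Qed.

Section GroupHomeo.
Variables (G K : topGroupType) (f : G -> K) (f' : K -> G).
Hypothesis ff' : group_homeo f f'.

Lemma gh1 : f 1 = 1.
Proof. by apply: (mulgI (f 1)); rewrite -(ghM ff') !mulg1. Qed.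

Lemma ghV x : f x^-1 = (f x)^-1.
Proof. by apply: (mulgI (f x)); rewrite -(ghM ff') !mulgV gh1. Qed.

Lemma gh_preimK (P : set K) : f' @^-1` (f @^-1` P) = P.
Proof. by apply/seteqP; split=> x; rewrite /= (ghVK ff'). Qed.

Lemma gh_image (P : set G) : f @` P = f' @^-1` P.
Proof.
apply/seteqP; split=> x /=; first by move=> [y Py <-]; rewrite (ghK ff').
by move=> Px; exists (f' x) => //; rewrite (ghVK ff').
Qed.

Lemma open_sub_preim U : open_sub U -> open_sub (f @^-1` U).
Proof.
move=> [oU U1 UM UV]; split=> [||x y|x] /=.
- by move/continuousP: (gh_cont ff'); apply.
- by rewrite gh1.
- by rewrite (ghM ff'); exact: UM.
- by rewrite ghV; exact: UV.
Qed.

Lemma lcos_preim a U : f @^-1` (lcos (f a) U) = lcos a (f @^-1` U).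
Proof. by apply/seteqP; split=> x; rewrite /lcos /= (ghM ff') ghV. Qed.

Lemma finite_index_preim V U : finite_index V U -> finite_index (f @^-1` V) (f @^-1` U).
Proof.
move=> [F fF UF]; exists (f' @` F); first exact: finite_image.
move=> x /= /UF[a Fa Va]; exists (f' a); first by exists a.
by rewrite -lcos_preim (ghVK ff').
Qed.
End GroupHomeo.

Section GroupHomeoConn.
Variables (G K : topGroupType) (f : G -> K) (f' : K -> G).
Hypothesis ff' : group_homeo f f'.
Let f'f := group_homeo_sym ff'.

Lemma conn_preim U : conn U -> conn (f @^-1` U).
Proof.
move=> [oU cU]; split; first exact: (open_sub_preim ff').
move=> V oV VU iV; rewrite -(gh_preimK f'f V) => x /=.
apply: (cU (f' @^-1` V)); first exact: (open_sub_preim f'f).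
  by rewrite -(gh_preimK ff' U) => y; exact: VU.
by rewrite -(gh_preimK ff' U); exact: (finite_index_preim f'f).
Qed.
End GroupHomeoConn.

Section GroupHomeoCoset.
Variables (G K : topGroupType) (f : G -> K) (f' : K -> G).
Hypothesis ff' : group_homeo f f'.
Let f'f := group_homeo_sym ff'.

Lemma rk_preim n U : rk n U -> rk n (f @^-1` U).
Proof.
elim: n U => [|n IH] U rU V cV UV; have [||VU|rV] // := rU (f' @^-1` V);
    try exact: (conn_preim f'f);
    try (by rewrite -(gh_preimK ff' U) => y; exact: UV);
    try (by left; rewrite -(gh_preimK f'f V) => y; exact: VU).
by right; rewrite -(gh_preimK f'f V); exact: IH.
Qed.

Lemma coset_preim n P : coset n P -> coset n (f @^-1` P).
Proof.
move=> [U [a [cU rU ->]]]; exists (f @^-1` U), (f' a); split.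
- exact: (conn_preim ff').
- exact: rk_preim.
- by rewrite -(lcos_preim ff') (ghVK ff').
Qed.

End GroupHomeoCoset.

Lemma conn_conjs (G : topGroupType) (g : G) U : conn U -> conn (conjs g U).
Proof. exact: (conn_preim (group_homeo_conj g)). Qed.

Lemma rk_conjs (G : topGroupType) (g : G) n U : rk n U -> rk n (conjs g U).
Proof. exact: (rk_preim (group_homeo_conj g)). Qed.

Lemma coset_conjs (G : topGroupType) (g : G) n P : coset n P -> coset n (conjs g P).
Proof. exact: (coset_preim (group_homeo_conj g)). Qed.

(** * Permutation groups with weak elimination of imaginaries *)

Lemma sym_open (T : Type) (V : set (sym T)) (g : sym T) : open V -> V g ->
  exists2 F : set T, finite_set F & forall h : sym T, (forall x, F x -> h x = g x) -> V h.
Proof.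
move=> oV Vg; have [B [F fF <-] BV] := oV g Vg; exists F => // h hF.
have -> : h = g * (g^-1 * h) by rewrite mulgA mulgV mul1g.
by apply: BV => x Fx; rewrite symM hF// symKV.
Qed.

Lemma sym_open_agree (T : Type) (F : set T) (g : T -> T) : finite_set F ->
  open [set h : sym T | forall x, F x -> h x = g x].
Proof.
move=> fF; suff H : forall h : sym T, (forall x, F x -> h x = g x) ->
    exists2 B, sym_base B & forall k, sg_set B k -> forall x, F x -> (h * k) x = g x.
  exact: H.
move=> h hF; exists (pointwise_stab_subgroup F); first by exists F.
by move=> k kF x Fx; rewrite symM kF// hF.
Qed.

Section Permutation.
Variables (T : countType) (H : subgroup (sym T)).
Implicit Types (A B F : set T) (x g a : H) (U V : set H) (t : T).

Definition act x : T -> T := (val x : sym T).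

Lemma actM x y t : act (x * y) t = act x (act y t). Proof. by []. Qed.
Lemma act1 t : act 1 t = t. Proof. by []. Qed.
Lemma actK x : cancel (act x) (act x^-1). Proof. exact: sym_funK. Qed.
Lemma actVK x : cancel (act x^-1) (act x). Proof. exact: sym_finvK. Qed.
Lemma act_inj x : injective (act x). Proof. exact: can_inj (actK x). Qed.

Lemma actP x y : act x =1 act y -> x = y.
Proof. by move=> xy; apply/val_inj/symP. Qed.

Lemma act_ex (g : sym T) : sg_set H g -> exists x : H, act x = g.
Proof. by move=> Hg; exists (SigSub (mem_set Hg)). Qed.

Lemma act_mem x : sg_set H (val x).
Proof. exact: set_mem (valP x). Qed.

Definition stab A : set H := [set x | forall t, A t -> act x t = t].

Lemma stabS A B : A `<=` B -> stab B `<=` stab A.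
Proof. by move=> AB x xB t /AB/xB. Qed.

Lemma open_agree F (f : T -> T) : finite_set F ->
  open [set x : H | forall t, F t -> act x t = f t].
Proof.
by move=> fF; exists [set h : sym T | forall t, F t -> h t = f t] => //; exact: sym_open_agree.
Qed.

Lemma open_subset U x : open U -> U x ->
  exists2 F, finite_set F & forall y, (forall t, F t -> act y t = act x t) -> U y.
Proof.
move=> [V oV <-] Vx; have [F fF FV] := sym_open oV Vx.
by exists F => // y yF; exact: FV.
Qed.

Lemma open_sub_stab A : finite_set A -> open_sub (stab A).
Proof.
move=> fA; split=> //.
- exact: (open_agree id fA).
- by move=> x y xA yA t At; rewrite actM yA// xA.
- by move=> x xA t At; rewrite -{1}(xA t At) actK.
Qed.

Lemma orbit_closedP A : orbit_closed H A <->
  finite_set A /\ forall t, finite_set [set act x t | x in stab A] -> A t.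
Proof.
suff E t : [set (g : sym T) t | g in (sg_set H) `&` pointwise_stab A] =
    [set act x t | x in stab A].
  by split=> -[fA cA]; split=> // t; [rewrite -E|rewrite E]; exact: cA.
apply/seteqP; split=> [_ [g [Hg gA] <-]|_ [x xA <-]].
  by have [x xg] := act_ex Hg; exists x; rewrite // /stab /= xg.
by exists (val x) => //; split; [exact: act_mem|].
Qed.

Lemma finite_orbit U A t : (forall x, U x -> act x @` A = A) -> finite_set A -> A t ->
  finite_set [set act x t | x in U].
Proof.
by move=> UA fA At; apply: sub_finite_set fA => _ [x Ux <-]; rewrite -(UA x Ux); exists t.
Qed.

Lemma finite_index_stab U A : finite_set A ->
  (forall x, U x -> act x @` A = A) -> finite_index (stab A) U.
Proof.
move=> /finite_set_enum[n [u uE]] UA.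
have /choice[r rP] : forall s : {ffun 'I_n -> 'I_n}, exists y,
    (exists2 x, U x & forall i, act x (u i) = u (s i)) -> forall i, act y (u i) = u (s i).
  move=> s; have [[x Ux xs]|nx] := pselect (exists2 x, U x & forall i, act x (u i) = u (s i)).
    by exists x.
  by exists 1.
exists (range r); first exact/finite_image/finite_finset.
move=> x Ux; have /choice[s sP] : forall i, exists j, act x (u i) = u j.
  move=> i; have : A (act x (u i)) by rewrite -(UA x Ux); exists (u i) => //; rewrite uE; exists i.
  by rewrite uE => -[j _ <-]; exists j.
exists (r [ffun i => s i]); first by exists [ffun i => s i].
have H' := rP [ffun i => s i].
rewrite /lcos /stab /= => t; rewrite uE => -[i _ <-]; rewrite actM sP.
have := H' _ i; rewrite ffunE => <-; first by rewrite actK.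
by exists x => // j; rewrite ffunE.
Qed.

Definition weak_elim := forall U, open_sub U -> exists A,
  [/\ orbit_closed H A, stab A `<=` U & forall x, U x -> act x @` A = A].

Hypothesis wH : weak_elim.

(** Weak elimination applied to the pointwise stabiliser of [F] yields the closure: points of [F]
    are fixed by [stab A], and for closed [B] containing [F] the group [stab B] permutes the finite
    set [A]. *)
Lemma closure_ex F : finite_set F -> exists A, [/\ orbit_closed H A, F `<=` A &
  forall B, orbit_closed H B -> F `<=` B -> A `<=` B].
Proof.
move=> fF; have [A [cA AF FA]] := wH (open_sub_stab fF); exists A; split=> //.
  have [_ cA'] := (orbit_closedP A).1 cA; move=> t Ft; apply: cA'.
  by apply: sub_finite_set (finite_set1 t) => _ [x /AF xF <-] /=; exact: xF.
move=> B cB FB t At; have [_ cB'] := (orbit_closedP B).1 cB; apply: cB'.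
apply: sub_finite_set (finite_orbit FA cA.1 At) => _ [x xB <-]; exists x => //.
exact: stabS xB.
Qed.

Lemma stab_sub A B : orbit_closed H A -> (stab A `<=` stab B) <-> B `<=` A.
Proof.
move=> /orbit_closedP[fA cA]; split=> [AB t Bt|]; last exact: stabS.
by apply: cA; apply: sub_finite_set (finite_set1 t) => _ [x /AB xB <-] /=; exact: xB.
Qed.

Lemma stab_inj A B : orbit_closed H A -> orbit_closed H B -> stab A = stab B -> A = B.
Proof.
move=> cA cB AB; apply/seteqP; split.
  by apply/(stab_sub A cB); rewrite AB.
by apply/(stab_sub B cA); rewrite AB.
Qed.

(** If [V] has finite index in [stab A] and weak elimination gives it the set [B], then the orbit
    over [A] of a point of [B] lies in finitely many translates of [B]. So [B] is inside [A], and
    [stab A] is inside [stab B], hence inside [V]. *)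
Lemma conn_stab A : orbit_closed H A -> conn (stab A).
Proof.
move=> gA; have [fA cA] := (orbit_closedP A).1 gA; split; first exact: open_sub_stab.
move=> V oV VA [F fF AF]; have [B [gB BV VB]] := wH oV.
suff BA : B `<=` A by apply: subset_trans BV; exact: stabS.
move=> t Bt; apply: cA; apply: (@sub_finite_set _ _ (\bigcup_(a in F) (act a @` B))).
  move=> _ [x /AF[a Fa Va] <-]; exists a => //; exists (act (a^-1 * x) t).
    by rewrite -(VB _ Va); exists t.
  by rewrite -actM mulgA mulgV mul1g.
by apply: bigcup_finite => // a _; apply: finite_image; exact: gB.1.
Qed.

Lemma open_sub_conn U : open_sub U -> exists A,
  [/\ orbit_closed H A, stab A `<=` U & finite_index (stab A) U].
Proof.
move=> oU; have [A [cA AU UA]] := wH oU; exists A; split=> //.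
exact: finite_index_stab cA.1 UA.
Qed.

Lemma connP U : conn U <-> exists2 A, orbit_closed H A & U = stab A.
Proof.
split=> [[oU cU]|[A cA ->]]; last exact: conn_stab.
have [A [cA AU iA]] := open_sub_conn oU; exists A => //.
by apply/seteqP; split=> //; apply: cU => //; exact: (conn_stab cA).1.
Qed.

Lemma act_stab g A : stab (act g @` A) = conjs g (stab A).
Proof.
apply/seteqP; split=> x; rewrite /stab /conjs /= => xA t.
  by move=> At; rewrite !actM xA ?actK//; exists t.
by move=> [s As <-]; have := xA s As; rewrite !actM => /(congr1 (act g)); rewrite actVK.
Qed.

Lemma orbit_closed_act g A : orbit_closed H A -> orbit_closed H (act g @` A).
Proof.
move=> /orbit_closedP[fA cA]; apply/orbit_closedP; split; first exact: finite_image.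
move=> t ft; exists (act g^-1 t); last exact: actVK.
apply: cA; have := finite_image (act g^-1) ft; apply: sub_finite_set => _ [x xA <-].
exists (act (g * x * g^-1) t); last by rewrite !actM actK.
exists (g * x * g^-1) => //; rewrite act_stab /conjs /=.
by rewrite !mulgA mulVg mul1g mulgVK.
Qed.

Lemma orbit_closedI A B : orbit_closed H A -> orbit_closed H B -> orbit_closed H (A `&` B).
Proof.
move=> /orbit_closedP[fA cA] /orbit_closedP[fB cB]; apply/orbit_closedP; split.
  exact: finite_setIl.
move=> t ft; split; [apply: cA|apply: cB]; apply: sub_finite_set ft => _ [x xA <-];
  by exists x => //; apply: stabS xA => ? [].
Qed.

Lemma orbit_closed_seq A : orbit_closed H A -> exists s : seq T, A = [set` s].
Proof. by move=> [/finite_seqP]. Qed.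

Lemma rk_stabE n A : orbit_closed H A -> rk n (stab A) <->
  forall B, orbit_closed H B -> B `<=` A ->
    A `<=` B \/ if n is m.+1 then rk m (stab B) else False.
Proof.
move=> gA; split=> rA.
  move=> B gB BA.
  have := rA; rewrite [rk n _](_ : _ = forall V, conn V -> stab A `<=` V ->
    V `<=` stab A \/ if n is m.+1 then rk m V else False); last by case: n {rA}.
  move=> /(_ (stab B) (conn_stab gB) (stabS BA))[/(stab_sub _ gB)|]; by [left|right].
rewrite [rk n _](_ : _ = forall V, conn V -> stab A `<=` V ->
  V `<=` stab A \/ if n is m.+1 then rk m V else False); last by case: n {rA}.
move=> V /connP[B gB ->] /(stab_sub _ gA) BA.
by have [AB|] := rA B gB BA; [left; exact: stabS|right].
Qed.
End Permutation.

(** * Ranks of closed sets and bounds on their listings *)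

Section Tame.
Variables (T : countType) (H : subgroup (sym T)).
Implicit Types (A B F : set T) (x g a : H) (U V : set H) (t : T) (s f : seq T).
Hypotheses (wH : weak_elim H) (olig : oligomorphic (sg_set H)).

(* If [s] lists a finite set [A], this is either empty (always so if the sizes
   differ) or a left coset of the pointwise stabiliser of [A]. *)
Definition agree s f : set H := [set x | map (act x) s = f].

Lemma agree_stab s : agree s s = stab [set` s].
Proof.
apply/seteqP; split=> x; rewrite /agree /stab /=.
  by rewrite -{2}[s]map_id => /eq_in_map.
by move=> xs; rewrite -[RHS]map_id; apply/eq_in_map.
Qed.

Lemma lcos_stab a s : lcos a (stab [set` s]) = agree s (map (act a) s).
Proof.
rewrite -agree_stab; apply/seteqP; split=> x; rewrite /lcos /agree /= => xs.
  rewrite -{2}xs -map_comp; apply: eq_map => t /=.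
  by rewrite -actM mulgA mulgV mul1g.
have -> : map (act (a^-1 * x)) s = map (act a^-1) (map (act x) s) by rewrite -map_comp.
by rewrite xs mapK//; exact: actK.
Qed.

Lemma conjs_agree g s f : conjs g (agree s f) = agree (map (act g) s) (map (act g) f).
Proof.
apply/seteqP; split=> x; rewrite /conjs /agree /=.
  by move=> <-; rewrite -!map_comp; apply: eq_map => t /=; rewrite -!actM !mulgA mulgV mul1g.
move=> xs; apply: (inj_map (@act_inj _ _ g)); rewrite -xs -!map_comp.
by apply: eq_map => t /=; rewrite -!actM !mulgA mulgV mul1g.
Qed.

Definition coset_code n s f := [/\ orbit_closed H [set` s], rk n (stab (H := H) [set` s]) &
  agree s f !=set0].

Lemma cosetP n P : coset n P <-> exists s f, coset_code n s f /\ P = agree s f.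
Proof.
split=> [[U [a [/(connP wH)[A gA ->] rU ->]]]|[s [f [[gs rs [a /= af]] ->]]]].
  have [s sE] := orbit_closed_seq gA; subst A.
  by exists s, (map (act a) s); split; [split=> //; exists a|rewrite -lcos_stab].
exists (stab [set` s]), a; split=> //; first exact: conn_stab.
by rewrite lcos_stab af.
Qed.

(** [D] is not assumed invariant: representatives of all orbits on tuples of length at most [m] are
    exchanged, where possible, for members of [D] in the same orbit. *)
Lemma orbit_reps (D : set (seq T)) m : (forall s, D s -> (size s <= m)%N) ->
  exists2 L : set (seq T), finite_set L & L `<=` D /\
    forall s, D s -> exists2 t : seq T, L t & exists x, map (act x) t = s.
Proof.
move=> Dm; have [[s0 Ds0]|nD] := pselect (D !=set0); last first.
  exists set0; first exact: finite_set0.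
  by split=> // s Ds; exfalso; apply: nD; exists s.
have [K KP] := all_sig (fun k => cid ((oligomorphicP H).1 olig k)).
have [r rP] := all_sig (fun k => cid (KP k)).
have /choice[p pP] : forall t : seq T, exists s, D s /\
    ((exists s, D s /\ exists x, map (act x) t = s) -> exists x, map (act x) t = s).
  move=> t; have [[s [Ds st]]|ns] := pselect (exists s, D s /\ exists x, map (act x) t = s).
    by exists s.
  by exists s0.
exists (p @` (\bigcup_(k in `I_m.+1) range (fun i : 'I_(K k) => [seq r k i j | j <- enum 'I_k]))).
  apply/finite_image/bigcup_finite; first exact: finite_II.
  by move=> k _; exact/finite_image/finite_finset.
split=> [_ [t _ <-]|s Ds]; first by have [] := pP t.
have [i [g Hg gE]] := rP (size s) (tnth (in_tuple s)).
have [x xg] := act_ex Hg.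
pose t := [seq r (size s) i j | j <- enum 'I_(size s)].
have ts : map (act x) t = s.
  rewrite -[RHS](map_tnth_enum (in_tuple s)) /t -map_comp xg.
  by apply: eq_map => j; rewrite -gE.
have [Dp] := pP t; case; first by exists s; split=> //; exists x.
move=> y yp; exists (p t).
  by exists t => //; exists (size s); [exact: Dm|exists i].
exists (x * y^-1); rewrite -yp -map_comp -[RHS]ts.
by apply: eq_map => j /=; rewrite actM actK.
Qed.

Lemma filter_notin_size A B s : A = [set` s] -> B `<=` A -> ~ A `<=` B ->
  (size ([seq t <- s | `[< B t >]]) < size s)%N /\
  B = [set` [seq t <- s | `[< B t >]]].
Proof.
move=> -> BA nAB; split.
  rewrite size_filter ltn_neqAle count_size andbT -all_count.
  by apply/negP => /allP sB; apply: nAB => t /sB/asboolP.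
apply/seteqP; split=> t /=; rewrite mem_filter; last by move=> /andP[/asboolP].
by move=> Bt; apply/andP; split; [exact/asboolP|exact: BA].
Qed.

(** Going up among connected subgroups means passing to smaller closed subsets of [A], and each
    strict step shortens the filtered listing. *)
Lemma rk_exists A : orbit_closed H A -> exists n, rk n (stab (H := H) A).
Proof.
move=> gA; have [s sE] := orbit_closed_seq gA; exists (size s).
have [n sn] := ubnP (size s); elim: n => // n IH in A s gA sE sn *.
apply/(rk_stabE wH _ gA) => B gB BA.
have [AB|nAB] := pselect (A `<=` B); [by left|right].
have [s's BE] := filter_notin_size sE BA nAB.
have s'n := leq_trans s's sn; case sz : (size s) s's => [|m] // s'm.
apply: (@rk_mono _ (size ([seq t <- s | `[< B t >]]))); first exact: s'm.
exact: IH.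
Qed.

(* A maximal proper closed subset together with one further point generates. *)
Lemma rk_generated n A : orbit_closed H A -> rk n (stab (H := H) A) ->
  exists s, [/\ (size s <= n)%N, [set` s] `<=` A &
    forall B, orbit_closed H B -> [set` s] `<=` B -> A `<=` B].
Proof.
elim: n A => [|n IH] A gA rA.
  exists [::]; split=> // B gB _; have gAB := orbit_closedI gA gB.
  by have /(rk_stabE wH _ gA)/(_ _ gAB)[t []//|AAB|[]] := rA; move=> t /AAB[].
have [s sE] := orbit_closed_seq gA.
(* [m] counts the entries of [s] outside a proper closed subset [B]; the least such [m] belongs to a
   maximal [B]. *)
pose p m := `[< exists B, [/\ orbit_closed H B, B `<=` A, ~ A `<=` B &
  m = size ([seq t <- s | ~~ `[< B t >]])] >].
have [[m pm]|np] := pselect (exists m, p m); last first.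
  exists [::]; split=> // B gB _; have gAB := orbit_closedI gA gB.
  apply: contrapT => nAB; apply: np; eexists; apply/asboolP.
  by exists (A `&` B); split=> // AAB; apply: nAB => t /AAB[].
have [k /asboolP[B [gB BA nAB kE]] kmin] := ex_minnP (ex_intro _ m pm).
have [//|rB] := (rk_stabE wH _ gA).1 rA B gB BA.
have [u [un uB Bu]] := IH B gB rB.
have [t [At Bt]] : exists t, A t /\ ~ B t.
  by apply: contrapT => nt; apply: nAB => t At; apply: contrapT => Bt; apply: nt; exists t.
exists (t :: u); split=> // [z|C gC tuC]; first by rewrite /= inE => /orP[/eqP ->//|/uB/BA].
have gAC := orbit_closedI gA gC.
have BAC : B `<=` A `&` C.
  by apply: Bu => // z zu; split; [exact/BA/uB|apply: tuC; rewrite /= inE [_ \in u]zu orbT].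
apply: contrapT => nAC.
have /kmin : p (size ([seq t <- s | ~~ `[< (A `&` C) t >]])).
  by apply/asboolP; exists (A `&` C); split=> // AAC; apply: nAC => z /AAC[].
rewrite kE leqNgt => /negP; apply; rewrite !size_filter.
apply: (@leq_trans (count (predU (pred1 t) (fun t => ~~ `[< (A `&` C) t >])) s)); last first.
  apply: sub_count => z /orP[/eqP -> |]; first exact/asboolPn.
  by move=> /asboolPn nz; apply/asboolPn => /BAC.
rewrite -(ltn_add2r (count (predI (pred1 t) (fun t => ~~ `[< (A `&` C) t >])) s)).
rewrite count_predUI -addnS addnC leq_add2r -addn1.
have -> : count (predI (pred1 t) (fun t => ~~ `[< (A `&` C) t >])) s = 0%N.
  apply/eqP; rewrite -leqn0 leqNgt -has_count; apply/hasPn => z _ /=.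
  apply/negP => /andP[/eqP -> /asboolPn]; apply; split=> //.
  by apply: tuC; rewrite /= inE eqxx.
by rewrite add0n -has_count has_pred1; move: At; rewrite sE.
Qed.

(** A closed set of rank at most [n] is the closure of a tuple of length at most [n]. There are
    finitely many such tuples up to [H], and closure commutes with [H]. *)
Lemma closure_bound n : exists m, forall A, orbit_closed H A -> rk n (stab (H := H) A) ->
  exists2 s, (size s <= m)%N & A = [set` s].
Proof.
have [L fL [_ LP]] := @orbit_reps [set s | (size s <= n)%N] n (fun _ => id).
have /choice[c cP] : forall s, exists s', [/\ orbit_closed H [set` s'],
    [set` s] `<=` [set` s'] &
    forall B, orbit_closed H B -> [set` s] `<=` B -> [set` s'] `<=` B].
  move=> s; have [A [gA sA As]] := closure_ex wH (finite_seq s).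
  by have [s' s'E] := orbit_closed_seq gA; exists s'; rewrite -s'E.
have [l lE] := (finite_seqP _).1 fL.
exists (\max_(t <- l) size (c t)) => A gA /(rk_generated gA)[s [sn sA As]].
have [t Lt [x xt]] := LP s sn; exists (map (act x) (c t)).
  by rewrite size_map; apply: leq_bigmax_seq => //; rewrite lE in Lt.
have mapE u : [set` map (act x) u] = act x @` [set` u].
  apply/seteqP; split=> z /=; first by move=> /mapP[y yu ->]; exists y.
  by move=> [y yu <-]; exact: map_f.
have [gct tct ctP] := cP t; rewrite mapE; apply/seteqP; split.
  apply: As; first exact: orbit_closed_act.
  by rewrite -xt mapE => _ [z zt <-]; exists z => //; exact: tct.
have : [set` c t] `<=` act x^-1 @` A.
  apply: ctP => [|z zt]; first exact: orbit_closed_act.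
  exists (act x z); last exact: actK.
  by apply: sA; rewrite -xt /=; exact: map_f.
by move=> ctA _ [z /ctA[y Ay <-] <-]; rewrite actVK.
Qed.
End Tame.

(** * Verification of tameness *)

Section TamePermutation.
Variables (T : countType) (H : subgroup (sym T)).
Implicit Types (A B F : set T) (x g a : H) (U V : set H) (t : T) (s f : seq T).
Hypotheses (wH : weak_elim H) (olig : oligomorphic (sg_set H)).
Hypotheses (cH : complete_subgroup H) (infT : infinite_set [set: T]).

Lemma conn_base U : open U -> U 1 -> exists2 V, conn V & V `<=` U.
Proof.
move=> oU U1; have [F fF FU] := open_subset oU U1.
have [A [gA FA _]] := closure_ex wH fF.
by exists (stab A); [exact: conn_stab|move=> x xA; apply: FU => t /FA/xA ->].
Qed.

Lemma conn_separated x : (forall U, conn U -> U x) -> x = 1.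
Proof.
move=> xU; apply: actP => t; have [A [gA tA _]] := closure_ex wH (finite_set1 t).
by apply: (xU (stab A)); [exact: conn_stab|exact: tA].
Qed.

(** The chosen cosets prescribe a map on each finite closed set, coherently because two such sets
    lie in a third. The union is injective, and it belongs to the closed group [H] once it is a
    permutation; surjectivity is extracted from the condition on right cosets. *)
Lemma conn_complete (c : set H -> set H) :
  (forall U, conn U -> exists a, c U = lcos a U) ->
  (forall U V, conn U -> conn V -> U `<=` V -> c U `<=` c V) ->
  (forall W, conn W -> exists U a, conn U /\ c U = [set x | W (x * a^-1)]) ->
  exists h, forall U, conn U -> c U h.
Proof.
move=> cl cm cr.
have /choice[a aP] : forall A, exists a, orbit_closed H A -> c (stab A) = lcos a (stab A).
  move=> A; have [gA|ngA] := pselect (orbit_closed H A); last by exists 1.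
  by have [a ->] := cl _ (conn_stab wH gA); exists a.
have aS A B t : orbit_closed H A -> orbit_closed H B -> A `<=` B -> A t ->
    act (a A) t = act (a B) t.
  move=> gA gB AB At.
  have : lcos (a A) (stab A) (a B).
    rewrite -aP//; apply: (cm (stab B)); [exact: conn_stab|exact: conn_stab|exact: stabS|].
    by rewrite aP// /lcos /= mulVg => ? _; rewrite act1.
  by move=> /(_ t At); rewrite actM => /(congr1 (act (a A))); rewrite actVK.
have aE A B t : orbit_closed H A -> orbit_closed H B -> A t -> B t ->
    act (a A) t = act (a B) t.
  move=> gA gB At Bt; have fAB : finite_set (A `|` B).
    by rewrite finite_setU; split; [exact: gA.1|exact: gB.1].
  have [C [gC ABC _]] := closure_ex wH fAB.
  rewrite (aS A C)// ?(aS B C)// => ? ?; apply: ABC; [by right|by left].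
have /choice[cl1 cl1P] : forall t, exists A, orbit_closed H A /\ A t.
  move=> t; have [A [gA tA _]] := closure_ex wH (finite_set1 t).
  by exists A; split=> //; exact: tA.
pose h t := act (a (cl1 t)) t.
have hE A t : orbit_closed H A -> A t -> h t = act (a A) t.
  by move=> gA At; have [? ?] := cl1P t; exact: aE.
have h_inj : injective h.
  move=> t t' htt'; have [A [gA tA _]] := closure_ex wH (finite_set2 t t').
  apply: (@act_inj _ _ (a A)).
  by rewrite -(hE A)//; [rewrite -(hE A)//|]; apply: tA; [right|left].
have h_surj t : exists t', h t' = t.
  have [gB Bt] := cl1P t; set B := cl1 t in gB Bt.
  have [U [b [/(connP wH)[A gA ->]]]] := cr _ (conn_stab wH gB).
  rewrite aP// => abE.
  (* A left coset of [stab A] that is also a right coset of [stab B] makes the two conjugate by its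
     element [a A], so [B] is the image of [A] and [t] has a preimage. *)
  have aAB : stab (H := H) B = stab (act (a A) @` A).
    have Bab : stab (H := H) B (a A * b^-1).
      have : lcos (a A) (stab A) (a A) by rewrite /lcos /= mulVg => ? _; rewrite act1.
      by rewrite abE.
    have [_ _ BM BV] := @open_sub_stab _ H _ gB.1.
    rewrite act_stab; apply/seteqP; split=> x.
      move=> xB; have : lcos (a A) (stab A) (x * a A).
        by rewrite abE /= -mulgA; exact: BM.
      by rewrite /lcos /conjs /= mulgA.
    rewrite /conjs /= => xA; have : lcos (a A) (stab A) (x * a A).
      by rewrite /lcos /= mulgA.
    rewrite abE /= => xab; have := BM _ _ xab (BV _ Bab).
    by rewrite !invgM invgK !mulgA !mulgVK mulgK.
  have BE := stab_inj gB (orbit_closed_act (a A) gA) aAB.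
  have [t' At' tE] : (act (a A) @` A) t by rewrite -BE.
  by exists t'; rewrite (hE A).
have /choice[h' h'K] := h_surj.
have hK : cancel h h' by move=> t; apply: h_inj; rewrite h'K.
have Hh : sg_set H (Sym hK h'K).
  apply: cH => F fF; have [A [gA FA _]] := closure_ex wH fF.
  by exists (val (a A)) => [|t /FA At]; [exact: act_mem|rewrite /= (hE A)].
have [x xh] := act_ex Hh; exists x => U /(connP wH)[A gA ->].
by rewrite aP// => t At; rewrite actM xh /= (hE A)// actK.
Qed.

Lemma cosets_countable : countable [set P : set H | cosets P].
Proof.
have cN : countable (range (fun sf : seq T * seq T => agree (H := H) sf.1 sf.2)).
  exact: sub_countable (card_image_le _ _) (countableP _).
apply: sub_countable cN; apply: subset_card_le => P [n /(cosetP wH)[s [f [_ ->]]]].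
by exists (s, f).
Qed.

Lemma agree_conjs_fix g s f : map (act g) s = s -> map (act g) f = f ->
  conjs g (agree s f) = agree s f.
Proof. by move=> gs gf; rewrite conjs_agree gs gf. Qed.

(** The parameters are put into one tuple [D] of points, and a coset is coded by [D ++ s ++ f] of
    bounded length. Two codes in one orbit are related by an element fixing [D], which therefore
    fixes every coset in [S] under conjugation. *)
Lemma coset_orbits n (S : set (set H)) : finite_set S -> S `<=` cosets (G := H) ->
  exists2 L : set (set H), finite_set L & L `<=` coset n /\
    forall Q, coset n Q -> exists2 Q', L Q' &
      exists2 g, Q = conjs g Q' & forall P, S P -> conjs g P = P.
Proof.
move=> /finite_set_enum[k [u ->]] uS.
have /choice[d dP] : forall i, exists sf : seq T * seq T, u i = agree sf.1 sf.2.
  move=> i; have [|m /(cosetP wH)[s [f [_ ->]]]] := uS (u i); first by exists i.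
  by exists (s, f).
pose D := flatten [seq (d i).1 ++ (d i).2 | i <- enum 'I_k].
have Dfix g : map (act g) D = D -> forall P, range u P -> conjs g P = P.
  rewrite -{2}[D]map_id => /eq_in_map gD _ [i _ <-]; rewrite dP.
  have iD t : t \in (d i).1 ++ (d i).2 -> act g t = t.
    move=> ti; apply: gD; apply/flattenP; exists ((d i).1 ++ (d i).2) => //.
    by apply: map_f; rewrite mem_enum.
  by apply: agree_conjs_fix; rewrite -[RHS]map_id; apply/eq_in_map => t ti;
    apply: iD; rewrite mem_cat ti ?orbT.
have [m mP] := closure_bound wH olig n.
pose E := [set w | exists s f, [/\ w = D ++ s ++ f, coset_code H n s f & (size s <= m)%N]].
have [|L fL [LE LP]] := @orbit_reps _ H olig E (size D + (m + m)).
  move=> _ [s [f [-> [_ _ [x /= xs]] sm]]]; rewrite !size_cat leq_add2l.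
  by rewrite -xs size_map leq_add.
(* For a nonempty coset [s] and [f] have equal length, so the code is recovered by halving the
   tail. *)
pose dec w := let r := drop (size D) w in
  agree (H := H) (take (size r)./2 r) (drop (size r)./2 r).
have decE s f : size s = size f -> dec (D ++ s ++ f) = agree s f.
  move=> sf; rewrite /dec drop_size_cat// size_cat -sf addnn doubleK.
  by rewrite take_size_cat// drop_size_cat.
have szE n' s f : coset_code H n' s f -> size s = size f.
  by move=> [_ _ [x /= <-]]; rewrite size_map.
exists (dec @` L); first exact: finite_image.
split=> [_ [w /LE[s [f [-> sf sm]] <-]]|Q].
  by rewrite (decE _ _ (szE _ _ _ sf)); apply/(cosetP wH); exists s, f.
move=> /(cosetP wH)[s0 [f0 [[gs0 rs0 [x /= xs0]] ->]]].
(* [s0] may repeat entries, so it is replaced by a listing of the same set of bounded length. *)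
have [s sm sE] := mP _ gs0 rs0.
have QE : agree (H := H) s0 f0 = agree s (map (act x) s).
  by rewrite -lcos_stab -sE lcos_stab xs0.
have cs : coset_code H n s (map (act x) s) by split; rewrite -?sE//; exists x.
have [w Lw [g gw]] : exists2 w, L w & exists g, map (act g) w = D ++ s ++ map (act x) s.
  by apply: LP; exists s, (map (act x) s).
have [s' [f' [wE cs' s'm]]] := LE _ Lw.
exists (dec w); first by exists w.
move: gw; rewrite wE !map_cat => /eqP.
rewrite eqseq_cat ?size_map// => /andP[/eqP gD /eqP gsf].
have ss' : size (map (act g) s') = size s.
  have := congr1 size gsf; rewrite !size_cat !size_map -(szE _ _ _ cs').
  by rewrite !addnn => /double_inj.
move/eqP: gsf; rewrite eqseq_cat// => /andP[/eqP gs /eqP gf].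
exists g; last exact: Dfix.
by rewrite QE (decE _ _ (szE _ _ _ cs')) conjs_agree gs gf.
Qed.

(** Rank is invariant under [H], and [H] has finitely many orbits on points. *)
Lemma rk_bound : exists r, forall t, exists A, [/\ orbit_closed H A, A t,
  forall B, orbit_closed H B -> B t -> A `<=` B & rk r (stab (H := H) A)].
Proof.
have [L fL [_ LP]] := @orbit_reps _ H olig [set s | (size s <= 1)%N] 1 (fun _ => id).
have /choice[c cP] : forall t, exists A, [/\ orbit_closed H A, A t &
    forall B, orbit_closed H B -> B t -> A `<=` B].
  move=> t; have [A [gA tA At]] := closure_ex wH (finite_set1 t).
  exists A; split=> //; first exact: tA.
  by move=> B gB Bt; apply: At => // _ ->.
have /choice[n nP] : forall t, exists n, rk n (stab (H := H) (c t)).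
  by move=> t; have [gc _ _] := cP t; exact: rk_exists.
have [l lE] := (finite_seqP _).1 fL.
exists (\max_(w <- l) \max_(t <- w) n t) => t.
have [w Lw [x xw]] := LP [:: t] (leqnn 1).
case: w Lw xw => [|t' [|]] // Lw [xt'].
have [gc ct' cmin] := cP t'.
exists (act x @` c t'); split; first exact: orbit_closed_act.
- by exists t'.
- move=> B gB Bt; have : c t' `<=` act x^-1 @` B.
    apply: cmin; first exact: orbit_closed_act.
    by exists t => //; rewrite -xt' actK.
  by move=> cB _ [z /cB[y By <-] <-]; rewrite actVK.
- rewrite act_stab; apply: rk_conjs; apply: rk_mono (nP t').
  apply: (@leq_trans (\max_(t <- [:: t']) n t)); first by rewrite big_seq1.
  by apply: (@leq_bigmax_seq _ _ xpredT (fun w => \max_(t <- w) n t)) => //; rewrite lE in Lw.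
Qed.

(** A closed set is the union of the closures of its points, so its stabiliser is the intersection
    of theirs. *)
Lemma conn_generated : exists r, forall V, conn V -> exists S : set (set H),
  [/\ finite_set S, forall W, S W -> conn W /\ rk r W & V = \bigcap_(W in S) W].
Proof.
have [r /choice[c cP]] := rk_bound; exists r => V /(connP wH)[A gA ->].
exists [set stab (c t) | t in A]; split; first exact/finite_image/gA.1.
  by move=> _ [t _ <-]; have [gc _ _ rc] := cP t; split=> //; exact: conn_stab.
apply/seteqP; split=> [x xA _ [t At <-]|x xA t At].
  by have [_ _ cmin _] := cP t; apply: stabS xA; exact: cmin.
have [_ ct _ _] := cP t; apply: (xA (stab (c t))) => //; by exists t.
Qed.

(** Were the level finite, the closed sets of its subgroups would lie in one finite closed [C];
    since the level generates, the closure of every point would then lie in [C]. *)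
Lemma coset_infinite r : (forall V, conn V -> exists S : set (set H),
    [/\ finite_set S, forall W, S W -> conn W /\ rk r W & V = \bigcap_(W in S) W]) ->
  infinite_set [set P : set H | coset r P].
Proof.
move=> rP fr; apply: infT.
have /choice[d dP] : forall P : set H, exists A, finite_set A /\
    forall B, orbit_closed H B -> P = stab B -> B `<=` A.
  move=> P; have [[B [gB ->]]|nP] := pselect (exists B, orbit_closed H B /\ P = stab B).
    by exists B; split=> [|C gC /(stab_inj gB gC) -> //]; exact: gB.1.
  by exists set0; split=> // B gB PB; exfalso; apply: nP; exists B.
have fD : finite_set (\bigcup_(P in [set P : set H | coset r P]) d P).
  by apply: bigcup_finite => // P _; have [] := dP P.
have [C [gC DC _]] := closure_ex wH fD; apply: sub_finite_set gC.1 => t _.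
have [A [gA tA _]] := closure_ex wH (finite_set1 t).
have [S [fS SP AE]] := rP _ (conn_stab wH gA).
suff: A `<=` C by apply; exact: tA.
apply/(stab_sub _ gC); rewrite AE => x xC W SW.
have [cW rW] := SP W SW; have [B gB WB] := (connP wH _).1 cW.
rewrite WB; apply: stabS xC => z Bz; apply: DC; exists W.
  by exists W, 1; split=> //; apply/seteqP; split=> y; rewrite /lcos /= invg1 mul1g.
by have [_ /(_ B gB WB)] := dP W; apply.
Qed.

Lemma conn_normalizer U : conn U -> finite_index U [set g | conjs g U = U].
Proof.
move=> /(connP wH)[A gA ->].
apply: finite_index_stab; first exact: gA.1.
by move=> g; rewrite /= -act_stab => /(stab_inj (orbit_closed_act g gA) gA).
Qed.

Theorem tame_permutation : tame H.
Proof.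
split.
- exact: conn_base.
- exact: conn_separated.
- exact: conn_complete.
- exact: cosets_countable.
- by move=> U /(connP wH)[A gA ->]; exact: (rk_exists wH).
- exact: coset_orbits.
- exact: conn_generated.
- move=> U /(open_sub_conn wH)[A [gA AU iA]]; exists (stab A); split=> //.
  exact: conn_stab.
- exact: conn_normalizer.
- exact: coset_infinite.
Qed.
End TamePermutation.

(** * Reconstruction of a group from its cosets *)

Section Translations.
Variable G : topGroupType.
Implicit Types (g a x y : G) (U V W P : set G).

Lemma lcos1 U : lcos 1 U = U.
Proof. by apply/seteqP; split=> x; rewrite /lcos /= invg1 mul1g. Qed.

Lemma mulg_continuousl a : continuous (fun x => a * x).
Proof.
move=> x; apply: (@continuous_comp _ _ _ (fun x => (a, x))
  (fun z : G * G => z.1 * z.2)); last exact: mulg_continuous.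
by apply: cvg_pair; [exact: cvg_cst|exact: cvg_id].
Qed.

Lemma lcos_open a U : open U -> open (lcos a U).
Proof. by move=> oU; move/continuousP: (@mulg_continuousl a^-1); apply. Qed.

Lemma lcos_mem a U : conn U -> lcos a U a.
Proof. by move=> [[_ U1 _ _] _]; rewrite /lcos /= mulVg. Qed.

Lemma lcos_eq a g U : conn U -> lcos a U g -> lcos a U = lcos g U.
Proof.
move=> [[_ U1 UM UV] _] ag; apply/seteqP; split=> x; rewrite /lcos /= => ax.
  by have := UM _ _ (UV _ ag) ax; rewrite invgM invgK !mulgA mulgK.
by have := UM _ _ ag ax; rewrite !mulgA mulgK.
Qed.

Lemma lcos_sub a U V : conn U -> lcos a U `<=` lcos a V <-> U `<=` V.
Proof.
move=> cU; split=> UV x; last exact: UV.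
by move=> Ux; have := UV (a * x); rewrite /lcos /= !mulgA mulVg mul1g; apply.
Qed.

Lemma lcos_conjs a U : lcos a U = [set x | conjs a U (x * a^-1)].
Proof. by apply/seteqP; split=> x; rewrite /lcos /conjs /= mulgA mulgVK. Qed.

Hypothesis tG : tame G.

Lemma conn_coset a U : conn U -> cosets (lcos a U).
Proof. by move=> cU; have [n rU] := tame_rk tG cU; exists n, U, a. Qed.

Lemma tame_nbhs x P : nbhs x P -> exists2 U, conn U & lcos x U `<=` P.
Proof.
rewrite nbhsE => -[N [oN Nx] NP].
have [] := @tame_base _ tG ((fun y => x * y) @^-1` N).
- by move/continuousP: (@mulg_continuousl x); apply.
- by rewrite /= mulg1.
move=> U cU UO; exists U => // y /UO /=; rewrite mulgA mulgV mul1g; exact: NP.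
Qed.

Lemma nbhs_lcos x U : conn U -> nbhs x (lcos x U).
Proof.
move=> cU; apply: open_nbhs_nbhs; split; last exact: lcos_mem.
by apply: lcos_open; have [[]] := cU.
Qed.
End Translations.

Definition mul_sub (G : topGroupType) (P Q S : set G) :=
  forall x y, P x -> Q y -> S (x * y).

Record coset_iso (G K : topGroupType) (f : set G -> set K) (f' : set K -> set G) : Prop :=
  CosetIso {
    ci_K : forall P, cosets P -> cosets (f P) /\ f' (f P) = P;
    ci_VK : forall P, cosets P -> cosets (f' P) /\ f (f' P) = P;
    ci_sub : forall P Q, cosets P -> cosets Q -> P `<=` Q <-> f P `<=` f Q;
    ci_mul : forall P Q S, cosets P -> cosets Q -> cosets S ->
      mul_sub P Q S <-> mul_sub (f P) (f Q) (f S) }.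

Lemma coset_iso_sym (G K : topGroupType) (f : set G -> set K) f' :
  coset_iso f f' -> coset_iso f' f.
Proof.
move=> [fK f'K fS fM]; split=> // [P Q cP cQ|P Q S cP cQ cS].
  have [cP' PE] := f'K _ cP; have [cQ' QE] := f'K _ cQ.
  by rewrite -{1}PE -{1}QE fS.
have [cP' PE] := f'K _ cP; have [cQ' QE] := f'K _ cQ; have [cS' SE] := f'K _ cS.
by rewrite -{1}PE -{1}QE -{1}SE fM.
Qed.

Lemma ci_mulL (G K : topGroupType) (f : set G -> set K) f' (P Q S : set G) :
  coset_iso f f' -> cosets P -> cosets Q -> cosets S ->
  mul_sub P Q S -> mul_sub (f P) (f Q) (f S).
Proof. by move=> ff' cP cQ cS /(proj1 (ci_mul ff' cP cQ cS)). Qed.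

Lemma ci_mulR (G K : topGroupType) (f : set G -> set K) f' (P Q S : set G) :
  coset_iso f f' -> cosets P -> cosets Q -> cosets S ->
  mul_sub (f P) (f Q) (f S) -> mul_sub P Q S.
Proof. by move=> ff' cP cQ cS /(proj2 (ci_mul ff' cP cQ cS)). Qed.

Section CosetIsoConn.
Variables (G K : topGroupType) (f : set G -> set K) (f' : set K -> set G).
Hypotheses (tG : tame G) (tK : tame K) (ff' : coset_iso f f').
Implicit Types (g : G) (U P : set G).

Let conn_cosets U : conn U -> cosets U.
Proof. by move=> cU; rewrite -[U]lcos1; exact: conn_coset. Qed.

(** Among cosets the subgroups are singled out by [P * P <= P]: for [P = b V] this puts [b] into
    [V]. *)
Lemma ci_conn U : conn U -> conn (f U).
Proof.
move=> cU; have [[n [V [b [cV rV fU]]]] _] := ci_K ff' (conn_cosets cU).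
have UU : mul_sub U U U by move: cU => [[_ _ UM _] _] x y; exact: UM.
have := ci_mulL ff' (conn_cosets cU) (conn_cosets cU) (conn_cosets cU) UU.
rewrite fU => /(_ b b (lcos_mem b cV) (lcos_mem b cV)).
rewrite {1}/lcos /= mulgA mulVg mul1g => Vb.
have <- : lcos 1 V = lcos b V by apply: lcos_eq => //; rewrite lcos1.
by rewrite lcos1.
Qed.
End CosetIsoConn.

Section CosetIso.
Variables (G K : topGroupType) (f : set G -> set K) (f' : set K -> set G).
Hypotheses (tG : tame G) (tK : tame K) (ff' : coset_iso f f').
Implicit Types (g : G) (U P : set G).
Let f'f := coset_iso_sym ff'.

Let ccG U : conn U -> cosets U.
Proof. by move=> cU; rewrite -[U]lcos1; exact: conn_coset. Qed.
Let ccK (V : set K) : conn V -> cosets V.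
Proof. by move=> cV; rewrite -[V]lcos1; exact: conn_coset. Qed.
Let fK P : cosets P -> f' (f P) = P.
Proof. by case/(ci_K ff'). Qed.
Let f'K (P : set K) : cosets P -> f (f' P) = P.
Proof. by case/(ci_VK ff'). Qed.
Let fc P : cosets P -> cosets (f P).
Proof. by case/(ci_K ff'). Qed.
Let cfG U : conn U -> conn (f U). Proof. exact: (ci_conn tG ff'). Qed.
Let cfK (V : set K) : conn V -> conn (f' V). Proof. exact: (ci_conn tK f'f). Qed.

(** [U] is the largest connected subgroup [W] with [P * W <= P] for [P = g U], a description that
    [f] respects. *)
Lemma ci_lcos g U : conn U -> exists b, f (lcos g U) = lcos b (f U).
Proof.
move=> cU; have cP := conn_coset tG g cU.
have [n [W [b [cW rW fP]]]] := fc cP; exists b; rewrite fP; congr lcos.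
have [[_ U1 UM UV] _] := cU; have [[_ W1 WM WV] _] := cW.
apply/seteqP; split.
  rewrite -(f'K (ccK cW)); apply/(ci_sub ff'); [exact/ccG/cfK|exact: ccG|].
  have : mul_sub (f (lcos g U)) (f (f' W)) (f (lcos g U)).
    by rewrite f'K ?fP; [move=> x y; rewrite /lcos /= mulgA; exact: WM|exact: ccK].
  move=> /(ci_mulR ff' cP (ccG (cfK cW)) cP) H x Wx.
  by have := H g x (lcos_mem g cU) Wx; rewrite /lcos /= mulgA mulVg mul1g.
have : mul_sub (lcos g U) U (lcos g U).
  by move=> x y; rewrite /lcos /= mulgA; exact: UM.
move=> /(ci_mulL ff' cP (ccG cU) cP); rewrite fP => H x fUx.
by have := H b x (lcos_mem b cW) fUx; rewrite /lcos /= mulgA mulVg mul1g.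
Qed.

(** The mirror image: the conjugate of [U] by [g] is the largest connected [W] with [W * P <= P].
    This gives [f] control over right cosets. *)
Lemma ci_conjs g b U : conn U -> f (lcos g U) = lcos b (f U) ->
  conjs b (f U) = f (conjs g U).
Proof.
move=> cU fgU; have cP := conn_coset tG g cU.
have cgU := conn_conjs g cU; have cbU := conn_conjs b (cfG cU).
have [[_ U1 UM UV] _] := cU; have [[_ fU1 fUM fUV] _] := cfG cU.
apply/seteqP; split.
  rewrite -(f'K (ccK cbU)); apply/(ci_sub ff'); [exact/ccG/cfK|exact: ccG|].
  have : mul_sub (f (f' (conjs b (f U)))) (f (lcos g U)) (f (lcos g U)).
    rewrite fgU f'K; last exact: ccK.
    move=> x y; rewrite /lcos /conjs /= => xb yb.
    by have := fUM _ _ xb yb; rewrite !mulgA mulgK.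
  move=> /(ci_mulR ff' (ccG (cfK cbU)) cP cP) H x Wx.
  by have := H x g Wx (lcos_mem g cU); rewrite /lcos /conjs /= mulgA.
have : mul_sub (conjs g U) (lcos g U) (lcos g U).
  move=> x y; rewrite /lcos /conjs /= => xb yb.
  by have := UM _ _ xb yb; rewrite !mulgA mulgK.
move=> /(ci_mulL ff' (ccG cgU) cP cP); rewrite fgU => H x fUx.
by have := H x b fUx (lcos_mem b (cfG cU)); rewrite /lcos /conjs /= mulgA.
Qed.

(** The images of the cosets containing [g] form a family to which [tame_complete] applies; its
    right-coset premise is met by starting from the conjugate subgroup and using [ci_conjs]. *)
Lemma ci_point g : exists k, forall U, conn U -> f (lcos g U) k.
Proof.
have [||W cW|k kP] := @tame_complete _ tK (fun V => f (lcos g (f' V))).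
- move=> V cV; have [b ->] := ci_lcos g (cfK cV); exists b.
  by rewrite f'K//; exact: ccK.
- move=> V W cV cW VW; apply/(ci_sub ff'); [exact/conn_coset/cfK|exact/conn_coset/cfK|].
  apply/(lcos_sub _ _ (cfK cV)); apply/(ci_sub ff'); [exact/ccG/cfK|exact/ccG/cfK|].
  by rewrite f'K ?f'K//; exact: ccK.
- pose U := conjs g^-1 (f' W); have cU : conn U := conn_conjs _ (cfK cW).
  have [b bE] := ci_lcos g cU; exists (f U), b; split; first exact: cfG.
  rewrite (fK (ccG cU)) bE lcos_conjs (ci_conjs cU bE) /U.
  by rewrite -conjsM mulgV conjs1 f'K//; exact: ccK.
- by exists k => U cU; have := kP _ (cfG cU); rewrite (fK (ccG cU)).
Qed.

Lemma ci_point_mem g k : (forall U, conn U -> f (lcos g U) k) ->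
  forall P, cosets P -> P g <-> f P k.
Proof.
move=> gk P cP; have [n [U [a [cU rU PE]]]] := cP.
split=> [Pg|fPk].
  by rewrite PE (lcos_eq cU (g := g)) -?PE//; exact: gk.
have fgU := gk U cU; suff -> : P = lcos g U by exact: lcos_mem.
have [b bE] := ci_lcos g cU; have [c cE] := ci_lcos a cU.
rewrite -(fK cP) PE -(fK (conn_coset tG g cU)); congr f'.
rewrite bE cE; rewrite PE cE in fPk; rewrite bE in fgU.
by rewrite (lcos_eq (cfG cU) fPk) (lcos_eq (cfG cU) fgU).
Qed.
End CosetIso.

Lemma coset_sep (G : topGroupType) (tG : tame G) (x y : G) :
  (forall P, cosets P -> P x -> P y) -> x = y.
Proof.
move=> xy; have /(congr1 (fun z => x * z)) : x^-1 * y = 1.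
  apply: (tame_sep tG) => U cU.
  by have := xy _ (conn_coset tG x cU) (lcos_mem x cU).
by rewrite mulgA mulgV mul1g mulg1.
Qed.

Lemma coset_iso_homeo (G K : topGroupType) (f : set G -> set K) (f' : set K -> set G) :
  tame G -> tame K -> coset_iso f f' ->
  exists (phi : G -> K) (psi : K -> G), group_homeo phi psi /\
    forall P g, cosets P -> P g <-> f P (phi g).
Proof.
move=> tG tK ff'; have f'f := coset_iso_sym ff'.
have /choice[phi phiP] := ci_point tG tK ff'.
have /choice[psi psiP] := ci_point tK tG f'f.
have phiE P g : cosets P -> P g <-> f P (phi g).
  by move=> cP; exact: (ci_point_mem tG tK ff' (phiP g)).
have psiE Q k : cosets Q -> Q k <-> f' Q (psi k).
  by move=> cQ; exact: (ci_point_mem tK tG f'f (psiP k)).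
have phiK : cancel phi psi.
  move=> g; apply/esym/(coset_sep tG) => P cP Pg.
  have [cfP <-] := ci_K ff' cP; apply/(psiE _ _ cfP).
  by have [+ _] := phiE P g cP; apply.
have psiK : cancel psi phi.
  move=> k; apply/esym/(coset_sep tK) => Q cQ Qk.
  have [cfQ <-] := ci_VK ff' cQ; apply/(phiE _ _ cfQ).
  by have [+ _] := psiE Q k cQ; apply.
have cont (G1 K1 : topGroupType) (f1 : set G1 -> set K1) f1' (p : G1 -> K1) :
    tame G1 -> tame K1 -> coset_iso f1 f1' ->
    (forall P g, cosets P -> P g <-> f1 P (p g)) -> continuous p.
  move=> t1 t2 ci pE g N /= /(tame_nbhs t2)[V cV VN].
  have cV' := ci_conn t2 (coset_iso_sym ci) cV.
  have ccV : cosets V by rewrite -[V]lcos1; exact: conn_coset.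
  have f1V : f1 (f1' V) = V by case: (ci_VK ci ccV).
  apply: filterS (nbhs_lcos g cV') => x gx; apply: VN.
  have [b bE] := ci_lcos t1 t2 ci g cV'.
  have /(pE _ x (conn_coset t1 g cV')) := gx.
  have /(pE _ g (conn_coset t1 g cV')) := lcos_mem g cV'.
  by rewrite bE f1V => /(lcos_eq cV) ->.
exists phi, psi; split=> //; split=> // [x y||].
- apply/(coset_sep tK) => Q cQ Qxy.
  have [cfQ QE] := ci_VK ff' cQ; rewrite -QE.
  have {}Qxy : f' Q (x * y) by apply/(phiE _ _ cfQ); rewrite QE.
  have [n [U [a [cU rU PE]]]] := cfQ.
  have cyU := conn_conjs y cU; have [[_ _ UM _] _] := cU.
  (* The product of [x y U y^-1] and [y U] is [x y U]. This inclusion between cosets around [x], [y]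
     and [x y] is carried by [f] to one around [phi x] and [phi y]. *)
  have : mul_sub (lcos x (conjs y U)) (lcos y U) (f' Q).
    rewrite PE (@lcos_eq _ a (x * y) U cU) -?PE// => u v; rewrite /lcos /conjs /= => xu yv.
    by have := UM _ _ xu yv; rewrite invgM !mulgA mulgK.
  move=> /(ci_mulL ff' (conn_coset tG x cyU) (conn_coset tG y cU) cfQ) H.
  apply: (H (phi x) (phi y)).
    by apply/(phiE _ _ (conn_coset tG x cyU)); exact: lcos_mem.
  by apply/(phiE _ _ (conn_coset tG y cU)); exact: lcos_mem.
- exact: cont tG tK ff' phiE.
- exact: cont tK tG f'f psiE.
Qed.

(** * Automorphism groups *)

Lemma ultra_bigcup (I X : Type) (U : set_system X) (F : set I) (B : I -> set X) :
  UltraFilter U -> finite_set F -> U (\bigcup_(i in F) B i) -> exists2 i, F i & U (B i).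
Proof.
move=> uU /finite_set_enum[n [u ->]] UB; apply: contrapT => nB.
have : U [set x | forall j, ~ B (u j) x].
  apply: filter_forall => j; have [Bj|//] := in_ultra_setVsetC (B (u j)) uU.
  by exfalso; apply: nB; exists (u j) => //; exists j.
move=> nU; have [x [[_ [j _ <-] Bx] nx]] := filter_ex (filterI UB nU).
exact: nx Bx.
Qed.

Section ContinuousAutomorphismAction.
Variable G : topGroupType.
Implicit Types (f h : cont_aut G) (P Q U V : set G) (g x : G).

Lemma cont_aut_homeo f : group_homeo f (cont_aut_fun f^-1).
Proof.
split; [exact: cont_autKV|exact: cont_autVK|exact: cont_aut_mulg|
  exact: cont_aut_continuous|exact: cont_aut_continuous].
Qed.

Lemma cont_aut_ex (phi psi : G -> G) : group_homeo phi psi ->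
  exists f : cont_aut G, f =1 phi.
Proof.
move=> [phiK psiK phiM cphi cpsi].
have H : sg_set (cont_aut_subgroup G) (Sym phiK psiK) by split.
by exists (SigSub (mem_set H)).
Qed.

Lemma image_cont_autM f h P : cont_aut_fun (f * h) @` P = f @` (h @` P).
Proof. by rewrite image_comp; apply: eq_imagel. Qed.

Lemma image_cont_aut1 P : cont_aut_fun (1 : cont_aut G) @` P = P.
Proof. by rewrite -[RHS]image_id. Qed.

Lemma image_cont_autK f P : cont_aut_fun f^-1 @` (f @` P) = P.
Proof. by rewrite -image_cont_autM mulVg image_cont_aut1. Qed.

Lemma image_cont_autVK f P : f @` (cont_aut_fun f^-1 @` P) = P.
Proof. by rewrite -image_cont_autM mulgV image_cont_aut1. Qed.

Lemma image_cont_autE f P : f @` P = cont_aut_fun f^-1 @^-1` P.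
Proof. exact: (gh_image (cont_aut_homeo f)). Qed.

Lemma image_coset f n P : coset n P -> coset n (f @` P).
Proof.
by rewrite image_cont_autE; exact: (coset_preim (group_homeo_sym (cont_aut_homeo f))).
Qed.

Lemma image_cosets f P : cosets P -> cosets (f @` P).
Proof. by move=> [n /(image_coset f)]; exists n. Qed.

Lemma image_conn f U : conn U -> conn (f @` U).
Proof.
by rewrite image_cont_autE; exact: (conn_preim (group_homeo_sym (cont_aut_homeo f))).
Qed.

Lemma image_conjs f g P : f @` (conjs g P) = conjs (f g) (f @` P).
Proof.
rewrite !image_cont_autE; apply/seteqP; split=> x; rewrite /conjs /=;
  by rewrite !cont_aut_mulg !cont_autgV cont_autKV.
Qed.

Lemma inner_ex g : exists2 f : cont_aut G, sg_set (inner G) f &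
  forall P, f @` P = conjs g P.
Proof.
have [f fE] := cont_aut_ex (group_homeo_sym (group_homeo_conj g)).
exists f; first by exists g.
move=> P; rewrite (eq_imagel (f' := fun x => g * x * g^-1)); last by move=> x _; exact: fE.
exact: (gh_image (group_homeo_sym (group_homeo_conj g))).
Qed.

Lemma open_cosetE A : open_coset A <->
  exists U a, open_sub U /\ A = lcos a U.
Proof.
have E a (U : set G) : [set a * u | u in U] = lcos a U.
  apply/seteqP; split=> x; rewrite /lcos /=.
    by move=> [u Uu <-]; rewrite mulgA mulVg mul1g.
  by move=> Ux; exists (a^-1 * x) => //; rewrite mulgA mulgV mul1g.
split=> [[U [a [oU ->]]]|[U [a [[oU U1 UM UV] ->]]]].
  by exists (sg_set U), a; rewrite E; split=> //; split=> //; [exact: sg1|exact: sgM|exact: sgV].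
by exists (Subgroup U1 UM UV), a; split=> //; rewrite -E.
Qed.

Lemma cont_aut_open (V : set (cont_aut G)) f : open V -> V f ->
  exists S : set (set G), [/\ finite_set S, S `<=` @open_coset G &
    forall h, (forall A, S A -> h @` A = A) -> V (f * h)].
Proof.
by move=> oV Vf; have [_ [S [fS oS] <-] SV] := oV f Vf; exists S; split.
Qed.

Lemma coset_stab_open (S : set (set G)) : finite_set S -> S `<=` @open_coset G ->
  open (sg_set (coset_stab S)).
Proof.
move=> fS oS; suff H : forall f, sg_set (coset_stab S) f ->
    exists2 B, @cont_aut_base G B & forall h, sg_set B h -> sg_set (coset_stab S) (f * h).
  exact: H.
by move=> f fSt; exists (coset_stab S); [exists S|move=> h hS; exact: sgM].
Qed.

Lemma coset_open_coset P : cosets P -> open_coset P.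
Proof. by move=> [n [U [a [[oU _] _ ->]]]]; apply/open_cosetE; exists U, a. Qed.

Hypothesis tG : tame G.

(** [A = a U] is a finite union of cosets [a b V] with [V] connected of finite index in [U], and
    each of these is an intersection of finitely many cosets of level [r]. So level [r] alone
    determines the topology of the automorphism group. *)
Lemma open_coset_fix r A : (forall V, conn V -> exists S : set (set G),
    [/\ finite_set S, forall W, S W -> conn W /\ rk r W & V = \bigcap_(W in S) W]) ->
  open_coset A -> exists S : set (set G), [/\ finite_set S, S `<=` coset r &
    forall f, (forall P, S P -> f @` P = P) -> f @` A = A].
Proof.
move=> rP /open_cosetE[U [a [oU ->]]].
have [V [cV VU [F fF UF]]] := tame_index tG oU.
have [S [fS SP VE]] := rP V cV.
exists [set lcos (a * b) W | b in F & W in S]; split.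
- exact: finite_image2.
- by move=> _ [b Fb [W SW <-]]; have [cW rW] := SP W SW; exists W, (a * b).
have [_ _ UM UV] := oU.
have sub f : (forall P, [set lcos (a * b) W | b in F & W in S] P -> f @` P = P) ->
    f @` lcos a U `<=` lcos a U.
  move=> fP _ [x ax <-]; have [b Fb bx] := UF _ ax.
  have Ub : U b.
    have := UM _ _ ax (UV _ (VU _ bx)).
    by rewrite !invgM !invgK !mulgA mulgK mulVg mul1g.
  have Vx : V ((a * b)^-1 * f x).
    rewrite VE => W SW; suff : lcos (a * b) W (f x) by [].
    have <- : f @` lcos (a * b) W = lcos (a * b) W.
      by apply: fP; exists b => //; exists W.
    exists x => //; have : V (b^-1 * (a^-1 * x)) by [].
    by rewrite VE => /(_ W SW); rewrite /lcos /= invgM mulgA.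
  by have := UM _ _ Ub (VU _ Vx); rewrite /lcos /= invgM !mulgA mulgV mul1g.
move=> f fP; apply/seteqP; split; first exact: sub.
have fV : forall P, [set lcos (a * b) W | b in F & W in S] P -> cont_aut_fun f^-1 @` P = P.
  by move=> P /fP fPP; rewrite -{1}fPP image_cont_autK.
move=> x Ux; exists (cont_aut_fun f^-1 x); last exact: cont_autVK.
by apply: (sub _ fV); exists x.
Qed.

(* The conjugating elements, each defined up to finitely many cosets of a given
   [U], have a limit along an ultrafilter. *)
Lemma inner_of_finite f : (forall S : set (set G), finite_set S -> S `<=` @cosets G ->
    exists g, forall P, S P -> f @` P = conjs g P) ->
  sg_set (inner G) f.
Proof.
move=> fS; pose B (S : set (set G)) := [set g | forall P, S P -> f @` P = conjs g P].
pose F0 : set_system G := [set X | exists S, [/\ finite_set S, S `<=` @cosets G & B S `<=` X]].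
have pF0 : ProperFilter F0.
  split; first by move=> [S [fS' Sc SB]]; have [g gS] := fS S fS' Sc; exact: SB gS.
  split.
  - by exists set0; split=> //; exact: finite_set0.
  - move=> X Y [S [fS1 Sc SX]] [S' [fS2 Sc' SY]]; exists (S `|` S'); split.
    + by rewrite finite_setU.
    + by rewrite subUset.
    + by move=> g gB; split; [apply: SX|apply: SY] => P SP; apply: gB; [left|right].
  - by move=> X Y XY [S [fS1 Sc SX]]; exists S; split=> //; exact: subset_trans XY.
have [U [uU FU]] := ultraFilterLemma pF0.
have UB P : cosets P -> U [set g | f @` P = conjs g P].
  move=> cP; apply: FU; exists [set P]; split; first exact: finite_set1.
    by move=> _ ->.
  by move=> g; apply.
have ccos V : conn V -> cosets V by move=> cV; rewrite -[V]lcos1; exact: conn_coset.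
have /choice[b bP] : forall V, exists b, conn V -> U (lcos b V).
  move=> V; have [cV|ncV] := pselect (conn V); last by exists 1.
  have UV := UB V (ccos V cV); have [g0 /= g0E] := filter_ex UV.
  have [F fF VF] := tame_norm tG cV.
  (* Two elements conjugating [V] to its image differ by the normaliser of [V], which finitely many
     cosets of [V] cover; the ultrafilter selects one. *)
  have [|a Fa Ua] := @ultra_bigcup _ _ U F (fun a => lcos (g0 * a) V) uU fF.
    apply: filterS UV => g /= gE; have [|a Fa ag] := VF (g0^-1 * g).
      by rewrite /= conjsM -gE g0E conjsK.
    by exists a => //; move: ag; rewrite /lcos /= invgM mulgA.
  by exists (g0 * a).
have [|V W cV cW VW|W cW|h hP] := @tame_complete _ tG (fun V => lcos (b V) V).
- by move=> V cV; exists (b V).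
- have [g [gV gW]] := filter_ex (filterI (bP V cV) (bP W cW)).
  by rewrite (lcos_eq cV gV) (lcos_eq cW gW); apply/lcos_sub.
- pose V := cont_aut_fun f^-1 @` W; have cV : conn V := image_conn f^-1 cW.
  have [g [gV gE]] := filter_ex (filterI (bP V cV) (UB V (ccos V cV))).
  exists V, g; split=> //; rewrite (lcos_eq cV gV) lcos_conjs.
  by move: gE => /= <-; rewrite image_cont_autVK.
exists h => x; apply/(coset_sep tG) => P cP Pfx.
pose Q := cont_aut_fun f^-1 @` P; have cQ : cosets Q := image_cosets f^-1 cP.
have fQ : f @` Q = P by exact: image_cont_autVK.
have Qx : Q x by exists (f x) => //; exact: cont_autKV.
have [n [V [a [cV rV QE]]]] := cQ.
have cxV := conn_conjs x cV.
have [g [[gV gxV] gE]] := filter_ex (filterI (filterI (bP V cV) (bP _ cxV)) (UB Q cQ)).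
have [[_ _ VM VV] _] := cV; move: gE => /= gE.
rewrite -fQ gE QE; rewrite QE in Qx; rewrite (lcos_eq cV Qx) /conjs /lcos /=.
have := hP V cV; have := hP _ cxV; rewrite (lcos_eq cV gV) (lcos_eq cxV gxV).
rewrite /lcos /conjs /= => h1 h2; have := VM _ _ h1 (VV _ h2).
by rewrite !invgM !invgK !mulgA.
Qed.
End ContinuousAutomorphismAction.

(** * Limits of automorphisms and profiniteness of the outer automorphism group *)

Section OuterAutomorphisms.
Variable G : topGroupType.
Implicit Types (f h : cont_aut G) (P Q U V : set G) (g x : G).
Hypothesis tG : tame G.

Local Notation Q := (quotient_group (inner G)).
Local Notation "[q f ]" := (\pi_Q f : Q).

Definition maps (S : set (set G * set G)) f := forall p, S p -> f @` p.1 = p.2.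

Lemma tame_open_coset_fix A : open_coset A -> exists S : set (set G),
  [/\ finite_set S, S `<=` @cosets G &
    forall f, (forall P, S P -> f @` P = P) -> f @` A = A].
Proof.
have [r rP] := tame_gen tG; move=> /(open_coset_fix tG rP)[S [fS Sr SA]].
by exists S; split=> // P /Sr; exists r.
Qed.

Lemma tame_coset_stab (S : set (set G)) : finite_set S -> S `<=` @open_coset G ->
  exists S' : set (set G), [/\ finite_set S', S' `<=` @cosets G &
    forall f, (forall P, S' P -> f @` P = P) -> forall A, S A -> f @` A = A].
Proof.
move=> fS oS; have /choice[s sP] : forall A, exists S' : set (set G), S A ->
    [/\ finite_set S', S' `<=` @cosets G &
      forall f, (forall P, S' P -> f @` P = P) -> f @` A = A].
  move=> A; have [SA|nSA] := pselect (S A); last by exists set0.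
  by have [S' H] := tame_open_coset_fix (oS A SA); exists S'.
exists (\bigcup_(A in S) s A); split.
- by apply: bigcup_finite => // A /sP[].
- by move=> P [A /sP[_ + _]]; apply.
- by move=> f fP A SA; have [_ _] := sP A SA; apply=> P sAP; apply: fP; exists A.
Qed.

(** Every stage is realised by an automorphism, so the limit preserves and reflects inclusion and
    [mul_sub], and reconstruction makes it an automorphism. The condition [E] is left free to serve
    both compactness of [Out(G)] and closedness of the image of [Aut(G)]. *)
Lemma cont_aut_of_maps (E : set (set G * set G) -> Prop) S0 :
  (forall S, E S -> S `<=` @cosets G `*` @cosets G /\ exists f, maps S f) -> E S0 ->
  (forall S P, E S -> cosets P -> exists P', E ((P, P') |` S)) ->
  (forall S P', E S -> cosets P' -> exists P, E ((P, P') |` S)) ->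
  exists f, forall l : set (set G), finite_set l -> l `<=` @cosets G ->
    exists2 S, E S & S0 `<=` S /\ forall P, l P -> S (P, f @` P).
Proof.
move=> Emaps ES0 forth back.
have Einj S p q : E S -> S p -> S q -> p.1 = q.1 <-> p.2 = q.2.
  move=> /Emaps[_ [f fS]] Sp Sq; rewrite -(fS p Sp) -(fS q Sq); split=> [->//|].
  by move=> /(congr1 (image^~ (cont_aut_fun f^-1))); rewrite !image_cont_autK.
have [a [b [ab ba lS]]] := @back_and_forth _ _ set0 set0 (@cosets G) (@cosets G) E S0
  (tame_countable tG) (tame_countable tG) (fun S ES => (Emaps S ES).1) Einj ES0 forth back.
have agree l : finite_set l -> l `<=` @cosets G -> exists f, forall P, l P -> f @` P = a P.
  move=> fl lc; have [S ES [_ Sl]] := lS l fl lc; have [_ [f fS]] := Emaps S ES.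
  by exists f => P lP; exact: (fS (P, a P) (Sl P lP)).
have image_sub f P P' : P `<=` P' <-> f @` P `<=` f @` P'.
  split=> [|H]; first exact: image_subset.
  by move/(@image_subset _ _ (cont_aut_fun f^-1)): H; rewrite !image_cont_autK.
have image_mul f P P' P'' : mul_sub P P' P'' -> mul_sub (f @` P) (f @` P') (f @` P'').
  by move=> H _ _ [x Px <-] [y Py <-]; exists (x * y); [exact: H|exact: cont_aut_mulg].
have ci : coset_iso a b.
  split=> [//|//|P P' cP cP'|P P' P'' cP cP' cP''].
    have [||f fE] := agree [set P; P']; first exact: finite_set2.
      by move=> _ [] ->.
    by rewrite -!fE; [exact: image_sub|by right|by left].
  have [||f fE] := agree [set P; P'; P'']; first exact: finite_set3.
    by move=> _ [[]|] ->.
  rewrite -!fE; [|by right|by left; right|by left; left].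
  split=> [|/(image_mul f^-1)]; first exact: image_mul.
  by rewrite !image_cont_autK.
have [phi [psi [hom phiE]]] := coset_iso_homeo tG tG ci.
have [f fE] := cont_aut_ex hom.
have faE P : cosets P -> f @` P = a P.
  move=> cP; rewrite image_cont_autE; apply/seteqP; split=> x /=.
    by move=> /(phiE _ _ cP); rewrite -fE cont_autVK.
  by move=> ax; apply/(phiE _ _ cP); rewrite -fE cont_autVK.
exists f => l fl lc; have [S ES [S0S Sl]] := lS l fl lc.
by exists S => //; split=> // P lP; rewrite (faE _ (lc _ lP)); exact: Sl.
Qed.

Lemma out_inner f h : sg_set (inner G) h -> [q h * f] = [q f].
Proof.
move=> Ih; apply/quo_eqP; have := nsgJ f^-1 (sgV Ih).
by rewrite !invgK invgM.
Qed.

Lemma out_innerr f h : sg_set (inner G) h -> [q f * h] = [q f].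
Proof. by move=> Ih; apply/quo_eqP; rewrite invgM -mulgA mulVg mulg1; exact: sgV. Qed.

Lemma out_pi_continuous : continuous (fun f => [q f]).
Proof. exact: pi_continuous. Qed.

Lemma out_compact : compact [set: out G].
Proof.
rewrite compact_ultra => F uF _; rewrite setTI.
(* Almost every class, in the sense of the ultrafilter, has a representative realising [S]; the
   representatives for different [S] need not agree. *)
pose E S := finite_set S /\ S `<=` @cosets G `*` @cosets G /\
  F [set [q f] | f in maps S].
have [|||| f fE] := @cont_aut_of_maps E set0.
- move=> S [fS [Sc FS]]; split=> //; have [_ [f fS' _]] := filter_ex FS.
  by exists f.
- split; first exact: finite_set0.
  split=> //; apply: filterS (@filterT _ F _) => a _.
  by move: a; apply: quo_ind => f; exists f.
- move=> S P [fS [Sc FS]] [n cP].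
  have [||L fL [Lc LP]] := @tame_orbits _ tG n [set p.2 | p in S].
    - exact: finite_image.
    - by move=> _ [p /Sc[_ ?] <-].
  have [|P' LP' FP'] := @ultra_bigcup _ _ F L
      (fun P' => [set [q f] | f in maps ((P, P') |` S)]) uF fL.
    apply: filterS FS => _ [f fS' <-].
    (* The inner automorphism of [g^-1], composed on the left, moves the image of [P] to one of
       finitely many representatives while keeping the values on [S] and the class of [f]. *)
    have [P' LP' [g PE gS]] := LP _ (image_coset f cP).
    exists P' => //; have [i Ii iE] := inner_ex g^-1.
    exists (i * f); last exact: out_inner.
    move=> p [->|Sp] /=; rewrite image_cont_autM iE; first by rewrite PE conjsK.
    rewrite (fS' p Sp) -{1}(gS p.2); last by exists p.
    by rewrite conjsK.
  exists P'; split; first by rewrite finite_setU; split=> //; exact: finite_set1.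
  by split=> // p [->|/Sc//]; split=> /=; [exists n|exists n; exact: Lc].
- move=> S P' [fS [Sc FS]] [n cP'].
  have [||L fL [Lc LP]] := @tame_orbits _ tG n [set p.1 | p in S].
    - exact: finite_image.
    - by move=> _ [p /Sc[? _] <-].
  have [|P LP0 FP] := @ultra_bigcup _ _ F L
      (fun P => [set [q f] | f in maps ((P, P') |` S)]) uF fL.
    apply: filterS FS => _ [f fS' <-].
    (* Now the preimage is adjusted, so the inner automorphism is composed on the right. *)
    have [P LP0 [g PE gS]] := LP _ (image_coset f^-1 cP').
    exists P => //; have [i Ii iE] := inner_ex g.
    exists (f * i); last exact: out_innerr.
    move=> p [->|Sp] /=; rewrite image_cont_autM iE; first by rewrite -PE image_cont_autVK.
    by rewrite gS ?fS'//; exists p.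
  exists P; split; first by rewrite finite_setU; split=> //; exact: finite_set1.
  by split=> // p [->|/Sc//]; split=> /=; [exists n; exact: Lc|exists n].
exists [q f] => N /= Nf.
have : nbhs f ((fun h => [q h]) @^-1` N) := @out_pi_continuous f N Nf.
rewrite nbhsE => -[V [oV Vf] VN].
have [S [fS oS SV]] := cont_aut_open oV Vf.
have [S' [fS' cS' S'S]] := tame_coset_stab fS oS.
have [S1 [_ [_ FS1]] [_ S1f]] := fE S' fS' cS'.
apply: filterS FS1 => _ [h hS1 <-]; apply: VN.
have -> : h = f * (f^-1 * h) by rewrite mulgA mulgV mul1g.
apply: SV; apply: S'S => P S'P.
rewrite image_cont_autM (hS1 (P, f @` P)) /= ?image_cont_autK//.
exact: S1f.
Qed.

(** By [inner_of_finite], failure to be inner shows on a finite set [S] of cosets. The stabiliser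
    [V] of [S] is an open subgroup, so its translates have open images [O k] that are cosets and
    hence also closed; the one around [f] misses the class of [h]. *)
Lemma out_zero_dimensional : zero_dimensional (out G).
Proof.
move=> a b; move: a b; apply: quo_ind => f; apply: quo_ind => h fh.
have nI : ~ sg_set (inner G) (f^-1 * h).
  by move=> /quo_eqP e; move: fh; rewrite e eqxx.
have [S [fS Sc nS]] : exists S : set (set G), [/\ finite_set S, S `<=` @cosets G &
    forall g, ~ forall P, S P -> (cont_aut_fun (f^-1 * h)) @` P = conjs g P].
  apply: contrapT => nS; apply: nI; apply: (inner_of_finite tG) => S fS Sc.
  apply: contrapT => ng; apply: nS; exists S; split=> // g gP; apply: ng.
  by exists g.
have oS : S `<=` @open_coset G by move=> P /Sc/coset_open_coset.
pose V := sg_set (coset_stab S).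
pose O k := [set [q k * v] | v in V].
have openO k : open (O k).
  have -> : O k = [set [q u] | u in (fun u => k^-1 * u) @^-1` V].
    apply/seteqP; split=> _ [u Vu <-].
      by exists (k * u) => //; rewrite /= mulgA mulVg mul1g.
    by exists (k^-1 * u) => //; rewrite mulgA mulgV mul1g.
  apply: quo_pi_open; move/continuousP: (@mulg_continuousl _ k^-1); apply.
  exact: coset_stab_open.
have O1 k : O k [q k] by exists 1; [exact: sg1|rewrite mulg1].
exists (O f); split=> //.
- split=> //; rewrite -openC.
  have -> : ~` O f = \bigcup_(k in [set k | ~ O f [q k]]) O k.
    apply/seteqP; split=> [|_ [k nk [v Vv <-]] [w Vw]].
      by apply: quo_ind => k nk; exists k.
    move=> /esym/quo_eqP Iw; apply: nk; exists (w * v^-1); first exact: sgM (sgV Vv).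
    apply/esym/quo_eqP; move: Iw; rewrite invgM => Iw.
    have := nsgJ v Iw; rewrite !mulgA mulgV mul1g.
    by rewrite -!mulgA.
  exact: bigcup_open.
- move=> [v Vv /quo_eqP].
  rewrite invgM -mulgA => -[g gE].
  have H := nS (cont_aut_fun v g); apply: H => P SP.
  have -> : f^-1 * h = v * (v^-1 * (f^-1 * h)) by rewrite mulgA mulgV mul1g.
  rewrite image_cont_autM (eq_imagel (f := cont_aut_fun (v^-1 * (f^-1 * h)))
    (f' := fun x => g * x * g^-1)); last by move=> x _; exact: gE.
  rewrite (gh_image (group_homeo_sym (group_homeo_conj g))) -[X in cont_aut_fun v @` X]/(conjs g P).
  by rewrite image_conjs Vv.
Qed.

Theorem out_profinite : profinite (out G).
Proof.
split; [exact: out_compact| |exact: zero_dimension_totally_disconnected out_zero_dimensional].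
rewrite open_hausdorff => a b /out_zero_dimensional[U [[oU cU] Ua nUb]].
exists (U, ~` U); first by split; apply/mem_set.
by split=> //=; [rewrite openC|rewrite setICr].
Qed.
End OuterAutomorphisms.

Lemma sym_closure (T : Type) (A : set (sym T)) (g : sym T) : closure A g ->
  forall F : set T, finite_set F -> exists2 h, A h & forall x, F x -> h x = g x.
Proof.
move=> Ag F fF; have [|h [Ah hF]] := Ag [set h : sym T | forall x, F x -> h x = g x].
  by apply: open_nbhs_nbhs; split=> //; exact: sym_open_agree.
by exists h.
Qed.

(** * The automorphism group acting on the cosets of one level *)

Section QuasiOligomorphic.
Variable G : topGroupType.
Implicit Types (f h : cont_aut G) (P Q : set G) (g : G).
Hypothesis tG : tame G.
Variables (r : nat) (c : set G -> nat) (d : nat -> set G).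
Hypothesis rP : forall V, conn V -> exists S : set (set G),
  [/\ finite_set S, forall W, S W -> conn W /\ rk r W & V = \bigcap_(W in S) W].
Hypothesis dK : forall n, c (d n) = n.
Hypothesis cd : forall P, coset r P -> d (c P) = P.
Hypothesis dr : forall n, coset r (d n).

Let c_inj P Q : coset r P -> coset r Q -> c P = c Q -> P = Q.
Proof. by move=> /cd {2}<- /cd {2}<- ->. Qed.

Definition coset_fun f n := c (f @` d n).

Lemma coset_funM f h n : coset_fun (f * h) n = coset_fun f (coset_fun h n).
Proof. by rewrite /coset_fun image_cont_autM cd//; exact: image_coset. Qed.

Lemma coset_fun1 n : coset_fun 1 n = n.
Proof. by rewrite /coset_fun image_cont_aut1 dK. Qed.

Lemma coset_funK f : cancel (coset_fun f) (coset_fun f^-1).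
Proof. by move=> n; rewrite -coset_funM mulVg coset_fun1. Qed.

Lemma coset_funVK f : cancel (coset_fun f^-1) (coset_fun f).
Proof. by move=> n; rewrite -coset_funM mulgV coset_fun1. Qed.

Definition coset_sym f : sym nat := Sym (coset_funK f) (coset_funVK f).

Lemma coset_symM : {morph coset_sym : f h / f * h}.
Proof. by move=> f h; apply: symP => n; exact: coset_funM. Qed.

Lemma coset_sym1 : coset_sym 1 = 1.
Proof. by apply: symP => n; exact: coset_fun1. Qed.

Lemma coset_symE f P : coset r P -> coset_sym f (c P) = c (f @` P).
Proof. by move=> cP; rewrite /= /coset_fun cd. Qed.

Lemma coset_sym_agree f h P : coset r P ->
  coset_sym f (c P) = coset_sym h (c P) -> f @` P = h @` P.
Proof. by move=> cP; rewrite !coset_symE//; apply: c_inj; exact: image_coset. Qed.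

Lemma cont_aut_fix f h A (S : set (set G)) :
  (forall k : cont_aut G, (forall P, S P -> k @` P = P) -> k @` A = A) ->
  (forall P, S P -> f @` P = h @` P) -> f @` A = h @` A.
Proof.
move=> SA fh; have : cont_aut_fun (h^-1 * f) @` A = A.
  by apply: SA => P SP; rewrite image_cont_autM fh// image_cont_autK.
rewrite image_cont_autM => /(congr1 (fun X => h @` X)).
by rewrite image_cont_autVK.
Qed.

Lemma coset_sym_inj : injective coset_sym.
Proof.
move=> f h fh; apply: cont_autP => x; apply: (coset_sep tG) => P cP Pfx.
have fhE Q : cosets Q -> f @` Q = h @` Q.
  move=> /coset_open_coset/(open_coset_fix tG rP)[S [_ Sr SQ]].
  by apply: (cont_aut_fix SQ) => Q' /Sr cQ'; apply: coset_sym_agree => //; rewrite fh.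
have cQ : cosets (cont_aut_fun f^-1 @` P) := image_cosets _ cP.
have <- : f @` (cont_aut_fun f^-1 @` P) = P by exact: image_cont_autVK.
rewrite fhE//; exists x => //; exists (f x) => //; exact: cont_autKV.
Qed.

Lemma coset_sym_range1 : range coset_sym 1.
Proof. by exists 1 => //; exact: coset_sym1. Qed.

Lemma coset_sym_rangeM s t : range coset_sym s -> range coset_sym t ->
  range coset_sym (s * t).
Proof. by move=> [f _ <-] [h _ <-]; exists (f * h) => //; exact: coset_symM. Qed.

Lemma coset_sym_rangeV s : range coset_sym s -> range coset_sym s^-1.
Proof.
move=> [f _ <-]; exists f^-1 => //; apply: (mulgI (coset_sym f)).
by rewrite -coset_symM !mulgV coset_sym1.
Qed.

Definition coset_sym_group : subgroup (sym nat) :=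
  Subgroup coset_sym_range1 coset_sym_rangeM coset_sym_rangeV.

(** [E S] says that [S] is realised by automorphisms agreeing with [s] on any prescribed finite set.
    The image of a coset [P] depends only on the images of finitely many cosets of level [r], so all
    automorphisms agreeing with [s] on their codes treat [P] alike, and that common image extends
    [S]. *)
Lemma coset_sym_closed : closed (sg_set coset_sym_group).
Proof.
move=> s /sym_closure sF.
pose E (S : set (set G * set G)) := S `<=` @cosets G `*` @cosets G /\
  forall F : set nat, finite_set F ->
    exists2 f, (forall n, F n -> coset_sym f n = s n) & maps S f.
have [||||f fE] := @cont_aut_of_maps _ tG E set0.
- move=> S [Sc SF]; split=> //; have [f _ fS] := SF set0 (finite_set0 _).
  by exists f.
- by split=> // F fF; have [_ [f _ <-] fs] := sF F fF; exists f.
- move=> S P [Sc SF] cP.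
  have [S' [fS' S'r S'P]] := open_coset_fix tG rP (coset_open_coset cP).
  have [f0 f0s f0S] := SF (c @` S') (finite_image _ fS').
  exists (f0 @` P); split.
    by move=> p [->|/Sc//]; split=> //; exact: image_cosets.
  move=> F fF; have [|f fs fS] := SF (F `|` c @` S').
    by rewrite finite_setU; split=> //; exact: finite_image.
  exists f; first by move=> n Fn; apply: fs; left.
  move=> p [->|]; last exact: fS.
  apply: (cont_aut_fix S'P) => Q S'Q; apply: coset_sym_agree; first exact: S'r.
  have cQ : (c @` S') (c Q) by exists Q.
  by rewrite fs; [rewrite f0s|right].
- move=> S P' [Sc SF] cP'.
  have [S' [fS' S'r S'P]] := open_coset_fix tG rP (coset_open_coset cP').
  (* Preimages are wanted, so [f^-1] is controlled on [S'] by prescribing [f] where [s] takes values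
     in the codes of [S']. *)
  pose F0 := [set s^-1 (c Q) | Q in S'].
  have [f0 f0s f0S] := SF F0 (finite_image _ fS').
  exists (cont_aut_fun f0^-1 @` P'); split.
    by move=> p [->|/Sc//]; split=> //; exact: image_cosets.
  move=> F fF; have [|f fs fS] := SF (F `|` F0).
    by rewrite finite_setU; split=> //; exact: finite_image.
  exists f; first by move=> n Fn; apply: fs; left.
  move=> p [->|]; last exact: fS.
  suff -> : cont_aut_fun f0^-1 @` P' = cont_aut_fun f^-1 @` P' by exact: image_cont_autVK.
  apply: (cont_aut_fix S'P) => Q S'Q.
  have fQ h : (forall n, F0 n -> coset_sym h n = s n) ->
      cont_aut_fun h^-1 @` Q = d (s^-1 (c Q)).
    move=> hs; rewrite -[RHS](image_cont_autK h); congr (_ @` _); apply/esym.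
    apply: c_inj; [exact/image_coset|exact: S'r|].
    by have := hs (s^-1 (c Q)); rewrite symVK; apply; exists Q.
  by rewrite (fQ f0)// (fQ f)// => n Fn; apply: fs; right.
exists f => //; apply: symP => n.
have [||S [_ SF] [_ Sf]] := fE [set d n]; first exact: finite_set1.
  by move=> _ ->; exists r.
have [h hs hS] := SF [set n] (finite_set1 _).
by rewrite -hs//= /coset_fun; have /= -> := hS _ (Sf (d n) erefl).
Qed.

(** [tame_orbits] handles one coset over finitely many fixed ones, which is exactly the inductive
    step for tuples. *)
Lemma tuple_orbits n : exists L : set ('I_n -> set G),
  [/\ finite_set L, forall w i, L w -> coset r (w i) &
   forall w, (forall i, coset r (w i)) -> exists2 w', L w' &
     exists g, forall i, w i = conjs g (w' i)].
Proof.
elim: n => [|n [L [fL Lr LP]]].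
  exists [set fun=> set0]; split; first exact: finite_set1.
    by move=> w [].
  by move=> w _; exists (fun=> set0) => //; exists 1 => -[].
have /choice[l lP] : forall w : 'I_n -> set G, exists l : set (set G), L w ->
    [/\ finite_set l, l `<=` coset r & forall Q, coset r Q -> exists2 Q', l Q' &
      exists2 g, Q = conjs g Q' & forall i, conjs g (w i) = w i].
  move=> w; have [Lw|nLw] := pselect (L w); last by exists set0.
  have [||l fl [lr lQ]] := @tame_orbits _ tG r (range w).
  - exact: finite_image.
  - by move=> _ [i _ <-]; exists r; exact: Lr.
  exists l => _; split=> // Q /lQ[Q' lQ' [g QE gw]]; exists Q' => //.
  by exists g => // i; apply: gw; exists i.
exists (\bigcup_(w in L) [set env_cons Q w | Q in l w]); split.
- by apply: bigcup_finite => // w /lP[fl _ _]; exact: finite_image.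
- move=> _ i [w Lw [Q lQ <-]]; have [_ lr _] := lP w Lw.
  by case: (unliftP ord0 i) => [j|] ->; rewrite ?env_consS ?env_cons0; [exact: Lr|exact: lr].
move=> w wr; have [w' Lw' [g gw]] := LP (w \o lift ord0) (fun i => wr _).
have [_ _ lQ] := lP w' Lw'.
have [Q' lQ' [k QE kw]] := lQ _ (coset_conjs g^-1 (wr ord0)).
exists (env_cons Q' w'); first by exists w' => //; exists Q'.
exists (g * k) => i; rewrite conjsM.
case: (unliftP ord0 i) => [j|] ->; rewrite ?env_consS ?env_cons0; first by rewrite kw -gw.
by rewrite -QE -conjsM mulgV conjs1.
Qed.

Lemma coset_sym_oligomorphic : oligomorphic (sg_set coset_sym_group).
Proof.
apply/oligomorphicP => n; have [L [/finite_set_enum[k [u ->]] Lr LP]] := tuple_orbits n.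
exists k, (fun i j => c (u i j)) => e.
have [_ [i _ <-] [g gE]] := LP (d \o e) (fun j => dr (e j)).
exists i; have [f _ fE] := inner_ex g; exists (coset_sym f); first by exists f.
apply/funext => j; rewrite [LHS]coset_symE; last by apply: Lr; exists i.
by rewrite fE -gE /= dK.
Qed.

(** Basic neighbourhoods fix finitely many open cosets on one side and finitely many cosets of level
    [r] on the other; [open_coset_fix] reduces the former to the latter. *)
Lemma coset_sym_iso : topological_iso (cont_aut G) coset_sym_group.
Proof.
pose F f : coset_sym_group :=
  SigSub (mem_set (ex_intro2 _ _ f I erefl : range coset_sym (coset_sym f))).
have /choice[F' F'P] : forall s : coset_sym_group, exists f, coset_sym f = val s.
  by move=> s; have [f _ fs] := set_mem (valP s); exists f.
exists F, F'; split.
- by move=> f; apply: coset_sym_inj; rewrite F'P.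
- by move=> s; apply: val_inj; rewrite /= F'P.
- by move=> f h; apply: val_inj; exact: coset_symM.
- move=> f N; rewrite nbhsE => -[U [oU Uf] UN].
  have [D fD DU] := open_subset oU Uf.
  have oS : [set d n | n in D] `<=` @open_coset G.
    by move=> _ [n _ <-]; apply: coset_open_coset; exists r.
  have oC := coset_stab_open (finite_image d fD) oS.
  apply: (@filterS _ _ _ ((fun h => f^-1 * h) @^-1` sg_set (coset_stab [set d n | n in D]))).
    move=> h hD; apply: UN; apply: DU => n Dn.
    have := hD (d n); rewrite /= image_cont_autM => H.
    have /(congr1 (fun X => cont_aut_fun f @` X)) : cont_aut_fun f^-1 @` (h @` d n) = d n.
      by apply: H; exists n.
    by rewrite image_cont_autVK /act /= /coset_fun => ->.
  apply: open_nbhs_nbhs; split; last first.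
    by rewrite /preimage/= mulVg; exact: (sg1 (coset_stab [set d n | n in D])).
  by move/continuousP: (@mulg_continuousl _ f^-1); apply.
- move=> s N; rewrite nbhsE => -[V [oV Vf] VN].
  have [S [fS oS SV]] := cont_aut_open oV Vf.
  have /choice[S' S'P] : forall A, exists S' : set (set G), S A -> [/\ finite_set S',
      S' `<=` coset r & forall f, (forall P, S' P -> f @` P = P) -> f @` A = A].
    move=> A; have [/oS/(open_coset_fix tG rP)[S' H]|nSA] := pselect (S A); last by exists set0.
    by exists S'.
  pose D := \bigcup_(A in S) [set c P | P in S' A].
  have fD : finite_set D by apply: bigcup_finite => // A /S'P[fS' _ _]; exact: finite_image.
  apply: (@filterS _ _ _ [set t : coset_sym_group | forall n, D n -> act t n = act s n]).
    move=> t tD; apply: VN.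
    have -> : F' t = F' s * ((F' s)^-1 * F' t) by rewrite mulgA mulgV mul1g.
    apply: SV => A SA; have [_ S'r S'A] := S'P A SA; apply: S'A => P S'P0.
    rewrite image_cont_autM (_ : cont_aut_fun (F' t) @` P = cont_aut_fun (F' s) @` P).
      exact: image_cont_autK.
    apply: coset_sym_agree; first exact: S'r.
    by rewrite !F'P; apply: tD; exists A => //; exists P.
  by apply: open_nbhs_nbhs; split=> //; exact: open_agree.
Qed.

Lemma coset_sym_quasi_oligomorphic : quasi_oligomorphic (cont_aut G).
Proof.
exists (ClosedSubgroup coset_sym_closed).
by split; [exact: coset_sym_oligomorphic|exact: coset_sym_iso].
Qed.
End QuasiOligomorphic.

Theorem tame_quasi_oligomorphic (G : topGroupType) : tame G ->
  quasi_oligomorphic (cont_aut G).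
Proof.
move=> tG; have [r rP] := tame_gen tG.
have cO : countable [set P : set G | coset r P].
  apply: sub_countable (tame_countable tG); apply: subset_card_le => P cP.
  by exists r.
have /card_set_bijP[c [_ cinj csurj]] := eq_card_nat cO (tame_infinite tG rP).
have /choice[d dP] : forall n, exists P, coset r P /\ c P = n.
  by move=> n; have [P cP cPn] := csurj n I; exists P.
apply: (@coset_sym_quasi_oligomorphic G tG r c d rP).
- by move=> n; have [] := dP n.
- move=> P cP; have [cdP E] := dP (c P).
  by apply: cinj => //; exact/mem_set.
- by move=> n; have [] := dP n.
Qed.

(** The uniqueness demanded by weak elimination is recovered here: if [U] permutes the finite set
    [C] and [stab D] lies in [U], the points of [C] have finite orbits over [D], so [C] lies in the
    closed set [D]; the roles are symmetric. *)
Lemma weak_elimP L (T : countType) (M : structure L T) : aleph0_categorical M ->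
  weak_elimination_of_imaginaries M <-> weak_elim (aut M).
Proof.
move=> catM; split=> [wM U [oU U1 UM UV]|wM U oU].
  have [A [[fA aA AU UA] _]] := wM (Subgroup U1 UM UV) oU.
  by exists A; split=> //; apply/acl_orbit_closed.
have oU' : open_sub (sg_set U) by split=> //; [exact: sg1|exact: sgM|exact: sgV].
have [A [cA AU UA]] := wM _ oU'; exists A; split.
  split=> //; [exact: cA.1|exact/(acl_orbit_closed catM cA.1)].
move=> B [fB /(acl_orbit_closed catM fB) cB BU UB].
have sub C D : orbit_closed (aut M) C -> orbit_closed (aut M) D ->
    stab (H := aut M) D `<=` sg_set U -> (forall x, sg_set U x -> act x @` C = C) -> C `<=` D.
  move=> [fC _] /orbit_closedP[_ cD] DU UC t Ct; apply: cD.
  apply: sub_finite_set (finite_orbit UC fC Ct) => _ [x xD <-].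
  by exists x => //; exact: DU.
by apply/seteqP; split; apply: sub.
Qed.

Lemma categorical_tame L (T : countType) (M : structure L T) : aleph0_categorical M ->
  weak_elimination_of_imaginaries M -> tame (aut M).
Proof.
move=> catM /(weak_elimP catM) wM; apply: tame_permutation wM _ _ _.
- exact: (categorical_oligomorphic catM).
- exact: aut_complete.
- exact: (categorical_infinite catM).
Qed.

Lemma categorical_automorphisms L (T : Type) (M : structure L T) :
  aleph0_categorical M -> weak_elimination_of_imaginaries M ->
  quasi_oligomorphic (cont_aut (aut M)) /\ profinite (out (aut M)).
Proof.
move=> catM; have cT : countable [set: T].
  by rewrite (eq_countable catM.1); exact: countableP.
have [T' TE] := Pcountable cT; subst T => wM.
have tM := categorical_tame catM wM.
by split; [exact: tame_quasi_oligomorphic|exact: out_profinite].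
Qed.

(** * The theory of the cosets *)

(* De Bruijn variables; [CAll n] ranges over the cosets of rank at most [n]. *)
Inductive cform :=
| CSub of nat & nat
| CMul of nat & nat & nat
| CFalse
| CImp of cform & cform
| CAll of nat & cform.

Fixpoint cform_code (phi : cform) : GenTree.tree nat :=
  match phi with
  | CSub i j => GenTree.Node 0 [:: GenTree.Leaf i; GenTree.Leaf j]
  | CMul i j k => GenTree.Node 1 [:: GenTree.Leaf i; GenTree.Leaf j; GenTree.Leaf k]
  | CFalse => GenTree.Node 2 [::]
  | CImp phi psi => GenTree.Node 3 [:: cform_code phi; cform_code psi]
  | CAll n phi => GenTree.Node 4 [:: GenTree.Leaf n; cform_code phi]
  end.

Lemma cform_code_inj : injective cform_code.
Proof.
elim=> [i j|i j k||a IHa b IHb|n a IHa] [i' j'|i' j' k'||a' b'|n' a'] //=.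
- by case=> -> ->.
- by case=> -> -> ->.
- by case=> /IHa -> /IHb ->.
- by case=> -> /IHa ->.
Qed.

Definition cnot phi := CImp phi CFalse.
Definition cand phi psi := cnot (CImp phi (cnot psi)).
Definition cex n phi := cnot (CAll n (cnot phi)).

Definition scons (X : Type) (x : X) (u : nat -> X) : nat -> X :=
  fun i => if i is j.+1 then u j else x.

Fixpoint crename (phi : cform) (r : nat -> nat) : cform :=
  match phi with
  | CSub i j => CSub (r i) (r j)
  | CMul i j k => CMul (r i) (r j) (r k)
  | CFalse => CFalse
  | CImp phi psi => CImp (crename phi r) (crename psi r)
  | CAll n phi => CAll n (crename phi (scons 0 (S \o r)))
  end.

Section CosetSat.
Variable G : topGroupType.

Fixpoint csat (phi : cform) (u : nat -> set G) : Prop :=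
  match phi with
  | CSub i j => u i `<=` u j
  | CMul i j k => mul_sub (u i) (u j) (u k)
  | CFalse => False
  | CImp phi psi => csat phi u -> csat psi u
  | CAll n phi => forall P, coset n P -> csat phi (scons P u)
  end.

Lemma csat_rename phi : forall r u, csat (crename phi r) u <-> csat phi (u \o r).
Proof.
elim: phi => [i j|i j k||a IHa b IHb|n a IHa] r u //=; first by rewrite IHa IHb.
have E P : scons P u \o scons 0 (S \o r) = scons P (u \o r).
  by apply/funext => -[|i].
by split=> H P cP; move: (H P cP); rewrite IHa E.
Qed.

Lemma csat_and phi psi u : csat (cand phi psi) u <-> csat phi u /\ csat psi u.
Proof.
split=> /=; first by move=> H; split; apply: contrapT => nH; apply: H.
by case=> H1 H2; apply.
Qed.

Lemma csat_ex n phi u : csat (cex n phi) u <-> exists2 P, coset n P & csat phi (scons P u).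
Proof.
split=> /=; last by move=> [P cP HP] /(_ P cP); apply.
by move=> H; apply: contrapT => nH; apply: H => P cP HP; apply: nH; exists P.
Qed.

Definition cconj (s : seq cform) := foldr cand (cnot CFalse) s.

Lemma csat_conj (I : finType) (F : I -> cform) u :
  csat (cconj [seq F i | i <- enum I]) u <-> forall i, csat (F i) u.
Proof.
have: csat (cconj [seq F i | i <- enum I]) u <-> forall i, i \in enum I -> csat (F i) u.
  elim: (enum I) => [|i s IH]; first by split=> // _ /= [].
  rewrite [cconj _]/(cand (F i) (cconj (map F s))) csat_and IH; split.
    by move=> [Hi Hs] j; rewrite inE => /orP[/eqP ->|/Hs].
  by move=> H; split=> [|j js]; apply: H; rewrite inE ?eqxx ?js ?orbT.
by move=> ->; split=> H i; [apply: H; rewrite mem_enum|move=> _].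
Qed.
End CosetSat.

Lemma csat_preim (G K : topGroupType) (f : G -> K) (f' : K -> G) : group_homeo f f' ->
  forall phi u, csat phi u <-> csat phi (fun i => f @^-1` u i).
Proof.
move=> ff'; have f'f := group_homeo_sym ff'.
have sub (P P' : set K) : P `<=` P' <-> f @^-1` P `<=` f @^-1` P'.
  by split=> H x; [exact: H|have := H (f' x); rewrite /= (ghVK ff')].
elim=> [i j|i j k||a IHa b IHb|n a IHa] u //=.
- split=> H x y; first by rewrite /= (ghM ff'); exact: H.
  by have := H (f' x) (f' y); rewrite /= (ghM ff') !(ghVK ff').
- by rewrite IHa IHb.
- have E P : (fun i => f @^-1` (scons P u) i) = scons (f @^-1` P) (fun i => f @^-1` u i).
    by apply/funext => -[|i].
  split=> H P cP.
    have := H _ (coset_preim f'f cP); rewrite IHa E.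
    by rewrite (gh_preimK f'f).
  by rewrite IHa E; exact/H/(coset_preim ff').
Qed.

(** Assignments are infinite sequences; positions not filled from [S] hold the pair of empty sets,
    which are not cosets and which every group isomorphism preserves. *)
Definition agreeing (G K : topGroupType) (S : set (set G * set K)) :=
  [/\ finite_set S, S `<=` @cosets G `*` @cosets K &
  forall phi (u : nat -> set G * set K), (forall i, S (u i) \/ u i = (set0, set0)) ->
    csat phi (fst \o u) <-> csat phi (snd \o u)].

Lemma agreeing_swap (G K : topGroupType) (S : set (set G * set K)) :
  agreeing S -> agreeing [set p | S (p.2, p.1)].
Proof.
move=> [fS Sc Sphi]; split.
- have -> : [set p | S (p.2, p.1)] = (fun p => (p.2, p.1)) @` S.
    by apply/seteqP; split=> [[P Q] /= SPQ|_ [[P Q] SPQ <-]//]; exists (Q, P).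
  exact: finite_image.
- by move=> [P Q] /= /Sc[].
- move=> phi u uS; apply: iff_sym.
  apply: (Sphi phi (fun i => ((u i).2, (u i).1))) => i /=.
  by case: (uS i) => [|->]; [left|right].
Qed.

(** If each of the finitely many representatives of the level over [S] is refuted by a formula, the
    conjunction of these formulas holds at [P], so its bounded existential closure transfers to [K].
    The witness there is conjugate over [S] to a representative, which contradicts its own
    formula. *)
Lemma agreeing_forth (G K : topGroupType) (S : set (set G * set K)) P :
  tame K -> agreeing S -> cosets P -> exists Q, agreeing ((P, Q) |` S).
Proof.
move=> tK [fS Sc Sphi] [n cP].
have [||L fL [Lc LP]] := @tame_orbits _ tK n [set p.2 | p in S].
- exact: finite_image.
- by move=> _ [p /Sc[_ ?] <-].
apply: contrapT => nQ.
have [k [v vE]] := finite_set_enum fS.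
pose w i := if insub i is Some j then v j else (set0, set0) : set G * set K.
have wS i : S (w i) \/ w i = (set0, set0).
  by rewrite /w; case: insubP => [j _ _|_]; [left; rewrite vE; exists j|right].
have /choice[phi phiP] : forall Q, exists phi, L Q ->
    csat phi (scons P (fst \o w)) /\ ~ csat phi (scons Q (snd \o w)).
  move=> Q; have [LQ|nLQ] := pselect (L Q); last by exists CFalse.
  have {nQ} : ~ agreeing ((P, Q) |` S) by move=> aQ; apply: nQ; exists Q.
  move=> nQ; apply: contrapT => nphi; apply: nQ; split.
  - by rewrite finite_setU; split=> //; exact: finite_set1.
  - by move=> p [->|/Sc//]; split=> /=; [exists n|exists n; exact: Lc].
  move=> phi u uS.
  have /choice[r rE] : forall i, exists j, u i = scons (P, Q) w j.
    move=> i; case: (uS i) => [[->|]|->]; first by exists 0.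
      by rewrite vE => -[j _ <-]; exists j.+1; rewrite /= /w valK.
    (* Position [k] of [w] is the first one beyond the list [v], hence holds the default pair;
       [scons] shifts it by one. *)
    by exists k.+1; rewrite /= /w insubF ?ltnn.
  have sE (X : Type) (p : set G * set K -> X) : p \o u = scons (p (P, Q)) (p \o w) \o r.
    by apply/funext => i /=; rewrite rE; case: (r i).
  rewrite 2!sE -2!csat_rename; have [|] := pselect (csat (crename phi r) (scons P (fst \o w))).
    move=> H; split=> // _; apply: contrapT => nH; apply: nphi; by exists (crename phi r).
  move=> nH; split=> // H; exfalso; apply: nphi; exists (cnot (crename phi r)).
  by split=> //=; apply.
have [m [q qE]] := finite_set_enum fL.
have Lq i : L (q i) by rewrite qE; exists i.
pose psi := cconj [seq phi (q i) | i <- enum 'I_m].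
have : csat (cex n psi) (fst \o w).
  by apply/csat_ex; exists P => //; apply/csat_conj => i; have [] := phiP _ (Lq i).
rewrite (Sphi (cex n psi) w wS) => /csat_ex[Q cQ /csat_conj psiQ].
have [Q' LQ' [g QE gS]] := LP Q cQ.
have [_] := phiP Q' LQ'; apply.
rewrite (csat_preim (group_homeo_conj g)).
have -> : (fun i => (fun x => g^-1 * x * g) @^-1` scons Q' (snd \o w) i) = scons Q (snd \o w).
  apply/funext => -[|i] /=; first by rewrite QE.
  have [Swi|->] := wS i; last by [].
  by have := gS (w i).2; apply; exists (w i).
by move: LQ'; rewrite qE => -[i _ <-].
Qed.

Lemma theory_iso (G K : topGroupType) : tame G -> tame K ->
  topological_iso G K <->
  forall phi, csat (G := G) phi (fun=> set0) <-> csat (G := K) phi (fun=> set0).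
Proof.
move=> tG tK; split=> [[f [f' [fK f'K fM cf cf']]] phi|thGK].
  have ff' : group_homeo f f' by split.
  by rewrite (csat_preim ff' phi (fun=> set0)).
have a0 : agreeing (set0 : set (set G * set K)).
  split; [exact: finite_set0|by []|move=> phi u u0].
  have -> : fst \o u = fun=> set0 by apply/funext => i /=; case: (u0 i) => [[]|->].
  by have -> : snd \o u = fun=> set0 by apply/funext => i /=; case: (u0 i) => [[]|->].
have sub (S : set (set G * set K)) p q : agreeing S -> S p -> S q -> p.1 `<=` q.1 <-> p.2 `<=` q.2.
  move=> [_ _ aS] Sp Sq; have := aS (CSub 0 1) (scons p (fun=> q)); apply.
  by move=> [|i]; left.
have [||||f [f' [fP f'P fS]]] := @back_and_forth _ _ set0 set0 (@cosets G) (@cosets K)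
  (@agreeing G K) set0 (tame_countable tG) (tame_countable tK) _ _ a0.
- by move=> S [].
- move=> S p q aS Sp Sq; have := sub S p q aS Sp Sq; have := sub S q p aS Sq Sp.
  move=> [qp qp'] [pq pq']; split=> E; apply/seteqP; split.
  + by apply: pq; rewrite E.
  + by apply: qp; rewrite E.
  + by apply: pq'; rewrite E.
  + by apply: qp'; rewrite E.
- by move=> S P; exact: agreeing_forth.
- move=> S Q /agreeing_swap/(agreeing_forth tG) H cQ.
  have [P /agreeing_swap aP] := H _ cQ; exists P.
  suff -> : (P, Q) |` S = [set p | ((Q, P) |` [set p0 | S (p0.2, p0.1)]) (p.2, p.1)] by [].
  apply/seteqP; split=> [[A B]|[A B]] /= [].
  + by case=> -> ->; left.
  + by right.
  + by case=> -> ->; left.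
  + by right.
have mul (S : set (set G * set K)) p q t : agreeing S -> S p -> S q -> S t ->
    mul_sub p.1 q.1 t.1 <-> mul_sub p.2 q.2 t.2.
  move=> [_ _ aS] Sp Sq St.
  have := aS (CMul 0 1 2) (scons p (scons q (fun=> t))); apply.
  by move=> [|[|i]]; left.
have ci : coset_iso f f'.
  split=> [//|//|P Q cP cQ|P Q R cP cQ cR].
    have [||S aS [_ SP]] := fS [set P; Q]; first exact: finite_set2.
      by move=> _ [] ->.
    by apply: (sub S (P, f P) (Q, f Q) aS); apply: SP; [left|right].
  have [||S aS [_ SP]] := fS [set P; Q; R]; first exact: finite_set3.
    by move=> _ [[]|] ->.
  by apply: (mul S (P, f P) (Q, f Q) (R, f R) aS); apply: SP;
    [left; left|left; right|right].
have [phi [psi [[phiK psiK phiM cphi cpsi] _]]] := coset_iso_homeo tG tK ci.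
by exists phi, psi.
Qed.

(** * Measurability *)

Section MeasurablePredicates.
Context d (X : measurableType d).
Implicit Types P Q : X -> Prop.

Lemma measurable_set_exists (I : countType) (P : I -> X -> Prop) :
  (forall i, measurable [set x | P i x]) -> measurable [set x | exists i, P i x].
Proof.
move=> mP; have -> : [set x | exists i, P i x] = \bigcup_i [set x | P i x].
  by apply/seteqP; split=> x [i] => [Pix|_ Pix]; exists i.
by apply: countable_bigcupT_measurable => //; exact: countableP.
Qed.

Lemma measurable_set_neg P : measurable [set x | P x] -> measurable [set x | ~ P x].
Proof. exact: measurableC. Qed.

Lemma measurable_set_forall (I : countType) (P : I -> X -> Prop) :
  (forall i, measurable [set x | P i x]) -> measurable [set x | forall i, P i x].
Proof.
move=> mP; have -> : [set x | forall i, P i x] = ~` [set x | exists i, ~ P i x].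
  apply/seteqP; split=> x /= H; first by case=> i; apply.
  by move=> i; apply: contrapT => nP; apply: H; exists i.
by apply: measurableC; apply: measurable_set_exists => i; exact: measurable_set_neg.
Qed.

Lemma measurable_set_and P Q : measurable [set x | P x] -> measurable [set x | Q x] ->
  measurable [set x | P x /\ Q x].
Proof. exact: measurableI. Qed.

Lemma measurable_set_and3 P Q R : measurable [set x | P x] -> measurable [set x | Q x] ->
  measurable [set x | R x] -> measurable [set x | [/\ P x, Q x & R x]].
Proof.
move=> mP mQ mR; have := measurableI _ _ mP (measurableI _ _ mQ mR).
by congr measurable; apply/seteqP; split=> x /= => [[? [? ?]]|[? ? ?]].
Qed.

Lemma measurable_set_or P Q : measurable [set x | P x] -> measurable [set x | Q x] ->
  measurable [set x | P x \/ Q x].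
Proof. exact: measurableU. Qed.

Lemma measurable_set_imp P Q : measurable [set x | P x] -> measurable [set x | Q x] ->
  measurable [set x | P x -> Q x].
Proof.
move=> mP mQ; have -> : [set x | P x -> Q x] = ~` [set x | P x] `|` [set x | Q x].
  apply/seteqP; split=> x /=; last by case=> // nP /nP.
  by move=> PQ; have [/PQ|] := pselect (P x); [right|left].
by apply: measurableU => //; exact: measurableC.
Qed.

Lemma measurable_set_prop (A : Prop) : measurable [set x : X | A].
Proof.
have [a|na] := pselect A.
  by rewrite (_ : [set x | A] = setT)//; apply/seteqP; split.
by rewrite (_ : [set x | A] = set0)//; apply/seteqP; split.
Qed.
End MeasurablePredicates.

Definition orb (T : countType) (H : subgroup (sym T)) (s t : seq T) :=
  exists x : H, map (act x) s = t.

(** That [H] carries [s] to [t] means that [H] meets the open set of permutations doing so, a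
    generator of the Effros sigma-algebra. *)
Lemma measurable_orb (s t : seq nat) :
  measurable ([set H : closed_subgroup (sym nat) | orb H s t] :
    set (closed_subgroup_space (sym nat))).
Proof.
pose W := [set g : sym nat | map g s = t].
have oW : open W.
  have -> : W = \bigcup_(g in W) [set h : sym nat | forall x, [set` s] x -> h x = g x].
    apply/seteqP; split=> [g Wg|h [g Wg hg]]; first by exists g.
    by rewrite /W /= -Wg; apply/eq_in_map.
  by apply: bigcup_open => g _; exact: sym_open_agree.
exists [set F : effros_space (sym nat) | F `&` W !=set0].
  by apply: sub_sigma_algebra; exists W.
rewrite setTI; apply/seteqP; split=> H /=.
  move=> [g [Hg gs]]; have [x xg] := act_ex Hg; by exists x; rewrite xg.
by move=> [x xs]; exists (val x); split=> //; exact: act_mem.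
Qed.

(** * Translation into countable conditions on finite tuples *)

Section Codes.
Variables (T : countType) (H : subgroup (sym T)).
Implicit Types (s t : seq T).
Local Notation O := (orb H).

Definition cclosed s := forall x : T,
  (exists l : seq T, forall y : T, O (x :: s) (y :: s) -> y \in l) -> x \in s.

Fixpoint crk n s := forall s' : seq T, cclosed s' -> {subset s' <= s} ->
  {subset s <= s'} \/ if n is m.+1 then crk m s' else False.

Definition ccoset n (p : seq T * seq T) := [/\ cclosed p.1, crk n p.1 & O p.1 p.2].

(** A pair [(s, f)] codes [agree s f]. If its lengths differ the coset is empty and the clause holds
    vacuously. Otherwise group elements are replaced by their effect on tuples: in [CMul], [u] is
    where the second factor sends the tuple of the third coset and [v] is where the product sends
    it. *)
Fixpoint ccsat (phi : cform) (e : nat -> seq T * seq T) : Prop :=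
  match phi with
  | CSub i j => size (e i).1 = size (e i).2 -> forall t : seq T,
      O ((e i).1 ++ (e j).1) ((e i).2 ++ t) -> t = (e j).2
  | CMul i j k => size (e i).1 = size (e i).2 -> size (e j).1 = size (e j).2 ->
      forall u v : seq T, O ((e j).1 ++ (e k).1) ((e j).2 ++ u) ->
      O ((e i).1 ++ u) ((e i).2 ++ v) -> v = (e k).2
  | CFalse => False
  | CImp phi psi => ccsat phi e -> ccsat psi e
  | CAll n phi => forall p : seq T * seq T, ccoset n p -> ccsat phi (scons p e)
  end.

Lemma orb_cat s t s' t' : size s = size t -> O (s ++ s') (t ++ t') <->
  exists x : H, map (act x) s = t /\ map (act x) s' = t'.
Proof.
move=> st; split=> [[x /eqP]|[x [<- <-]]]; last by exists x; rewrite map_cat.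
by rewrite map_cat eqseq_cat ?size_map// => /andP[/eqP ? /eqP ?]; exists x.
Qed.

Lemma cclosedP s : cclosed s <-> orbit_closed H [set` s].
Proof.
have E x : finite_set [set act g x | g in stab (H := H) [set` s]] <->
    exists l : seq T, forall y : T, O (x :: s) (y :: s) -> y \in l.
  split=> [/finite_seqP[l lE]|[l lP]].
    exists l => y [g /= [gx gs]]; suff: [set` l] y by [].
    rewrite -lE; exists g => //.
    by rewrite -agree_stab.
  apply: (@sub_finite_set _ _ [set` l]) => // _ [g gs <-]; apply: lP; exists g => /=.
  by congr cons; rewrite -agree_stab in gs.
split=> [cs|/orbit_closedP[_ cs]]; last by move=> x /E/cs.
by apply/orbit_closedP; split=> // x /E/cs.
Qed.

(** An open subgroup containing the stabiliser of the tuple [a] is a union of double cosets of that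
    stabiliser; [B] lists one image of [a] for each. *)
Definition orbit_code (a : seq T) (B : seq (seq T)) (c : seq T) :=
  exists b : seq T, b \in B /\ O (a ++ b) (a ++ c).

Definition subgroup_code (a : seq T) (B : seq (seq T)) :=
  [/\ forall b : seq T, b \in B -> size b = size a, orbit_code a B a &
    (forall c d d' : seq T, orbit_code a B c -> orbit_code a B d ->
      O (a ++ d) (c ++ d') -> orbit_code a B d') /\
    (forall c d : seq T, orbit_code a B c -> O (a ++ c) (d ++ a) -> orbit_code a B d)].

(* Each open subgroup is [[set x | orbit_code a B (map (act x) a)]] for some [a]
   and some finite list [B] of tuples. *)
Definition cweak_elim := forall (a : seq T) (B : seq (seq T)), subgroup_code a B ->
  exists s : seq T, [/\ cclosed s, forall c : seq T, O (s ++ a) (s ++ c) -> orbit_code a B c &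
    forall c s' : seq T, orbit_code a B c -> O (a ++ s) (c ++ s') -> s' =i s].

Definition coligomorphic := forall n : nat, exists l : seq (seq T),
  forall s : seq T, size s = n -> exists t : seq T, t \in l /\ O t s.

Lemma coligomorphicP (t0 : T) : oligomorphic (sg_set H) <-> coligomorphic.
Proof.
split=> [olig n|olig].
  have [|L fL [_ LP]] := @orbit_reps _ H olig [set s | size s = n] n.
    by move=> s /= ->.
  have [l lE] := (finite_seqP _).1 fL; exists l => s /LP[t Lt st]; exists t; split=> //.
  by rewrite lE in Lt.
apply/oligomorphicP => n; have [l lP] := olig n.
exists (size l), (fun i j => nth t0 (nth [::] l i) j) => e.
have [|t [tl [x xt]]] := lP [seq e j | j <- enum 'I_n].
  by rewrite size_map size_enum_ord.
have il : (index t l < size l)%N by rewrite index_mem.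
exists (Ordinal il), (val x); first exact: act_mem.
apply/funext => j /=; rewrite nth_index//.
have sz : size t = n by rewrite -(size_map (act x)) xt size_map size_enum_ord.
have := congr1 (fun s => nth t0 s j) xt.
by rewrite (nth_map t0) ?sz// (nth_map j) ?size_enum_ord// nth_ord_enum.
Qed.

Lemma map_act_image (x : H) s : [set` map (act x) s] = act x @` [set` s].
Proof.
apply/seteqP; split=> z /=; first by move=> /mapP[y ys ->]; exists y.
by move=> [y ys <-]; exact: map_f.
Qed.

(** Oligomorphicity makes the list finite: the tuples [a ++ x a] with [x] in [U] fall into finitely
    many orbits. The quantifier over open subgroups thus becomes one over the countable set of
    codes. *)
Lemma cweak_elimP : oligomorphic (sg_set H) -> weak_elim H <-> cweak_elim.
Proof.
move=> olig; split=> [wH a B [Ba Va [VM VV]]|wH U oU].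
  have szV c : orbit_code a B c -> size c = size a.
    move=> [b [/Ba bB [x /(congr1 size)]]].
    by rewrite size_map !size_cat => /addnI <-.
  pose U := [set x : H | orbit_code a B (map (act x) a)].
  have oU : open_sub U.
    split.
    - have -> : U = \bigcup_(x in U) [set y : H | forall z, [set` a] z -> act y z = act x z].
        apply/seteqP; split=> [x Ux|y [x Ux yx]]; first by exists x.
        by rewrite /U /=; have -> : map (act y) a = map (act x) a by apply/eq_in_map.
      by apply: bigcup_open => x _; exact: open_agree.
    - by rewrite /U /= (_ : map _ a = a)// -[RHS]map_id; apply: eq_map => z; exact: act1.
    - move=> x y Ux Uy; apply: (VM _ _ _ Ux Uy); exists x.
      by rewrite map_cat -map_comp.
    - move=> x Ux; apply: (VV _ _ Ux); exists x^-1.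
      rewrite map_cat -map_comp; congr cat.
      by rewrite -[RHS]map_id; apply: eq_map => z /=; exact: actK.
  have [A [gA AU UA]] := wH U oU; have [s sE] := orbit_closed_seq gA; subst A.
  exists s; split; first exact/cclosedP.
    move=> c /orb_cat-/(_ erefl)[x [xs <-]]; apply: AU.
    by rewrite -agree_stab.
  move=> c s' Vc /orb_cat-/(_ (esym (szV c Vc)))[x [xa <-]] z.
  have /UA E : U x by rewrite /U /= xa.
  have {}E : [set` map (act x) s] = [set` s] by rewrite map_act_image.
  by apply/idP/idP => [zs|zs]; [have : [set` s] z by rewrite -E|
    have : [set` map (act x) s] z by rewrite E].
have [F fF FU] : exists2 F : set T, finite_set F & stab (H := H) F `<=` U.
  have [oU' U1 _ _] := oU; have [F fF FU] := open_subset oU' U1.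
  by exists F => // x xF; apply: FU => z /xF ->; rewrite act1.
have [a aE] := (finite_seqP _).1 fF; subst F.
have [_ U1 UM UV] := oU.
have [|L fL [LD LP]] := @orbit_reps _ H olig
    [set w | exists2 x, U x & w = a ++ map (act x) a] (size a + size a).
  by move=> _ [x _ ->]; rewrite size_cat size_map.
have [l lE] := (finite_seqP _).1 fL; subst L.
pose B := [seq drop (size a) w | w <- l].
have BU b : b \in B -> exists2 x, U x & b = map (act x) a.
  by move=> /mapP[w /LD[x Ux ->] ->]; exists x => //; rewrite drop_size_cat.
have codeP x : U x <-> orbit_code a B (map (act x) a).
  split=> [Ux|[b [/BU[y Uy ->] /orb_cat-/(_ erefl)[z [za yx]]]]].
    have [|w wl [y yw]] := LP (a ++ map (act x) a); first by exists x.
    have [z Uz wE] := LD _ wl.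
    exists (map (act z) a); split; last by exists y; rewrite -wE.
    by apply/mapP; exists w => //; rewrite wE drop_size_cat.
  have Uzz : U z by apply: FU; rewrite -agree_stab.
  have : U ((z * y)^-1 * x).
    apply: FU; rewrite -agree_stab /agree /=.
    have -> : map (act ((z * y)^-1 * x)) a = map (act (z * y)^-1) (map (act x) a).
      by rewrite -map_comp.
    by rewrite -yx -map_comp -map_comp -[RHS]map_id; apply: eq_map => t /=; exact: actK.
  by move=> /(UM _ _ (UM _ _ Uzz Uy)); rewrite !mulgA mulgV mul1g.
have codeE c : orbit_code a B c -> exists x : H, c = map (act x) a.
  move=> [b [/BU[y Uy ->] /orb_cat-/(_ erefl)[z [za <-]]]]; exists (z * y).
  by rewrite -map_comp.
have [|s [cs sa as']] := wH a B.
  split=> [b /BU[x _ ->]||]; first by rewrite size_map.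
    have : orbit_code a B (map (act (1 : H)) a) by apply/codeP.
    by rewrite (_ : map _ a = a)// -[RHS]map_id; apply: eq_map => z; exact: act1.
  split=> [c d d'|c d].
    move=> Vc Vd; have [x xE] := codeE c Vc; have [y yE] := codeE d Vd; subst c d.
    move=> /orb_cat-/(_ _)[|z [za <-]]; first by rewrite size_map.
    rewrite -map_comp -[map _ a]/(map (act (z * y)) a); apply/codeP/UM; last exact/codeP.
    by apply/codeP; rewrite za.
  move=> Vc; have [x xE] := codeE c Vc; subst c.
  move=> [z /eqP].
  have [sd|sd] := eqVneq (size d) (size a); last first.
    rewrite map_cat => /eqP/(congr1 size); rewrite !size_cat !size_map => /addIn sda.
    by rewrite sda eqxx in sd.
  rewrite map_cat eqseq_cat ?size_map// => /andP[/eqP <- /eqP zx].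
  apply/codeP; have -> : z = z * x * x^-1 by rewrite mulgK.
  apply: UM; last by apply/UV/codeP.
  by apply: FU; rewrite -agree_stab /agree /= -{2}zx -map_comp.
exists [set` s]; split; first exact/cclosedP.
  move=> x xs; apply/codeP; apply: sa; exists x; rewrite map_cat; congr cat.
  by rewrite -agree_stab in xs.
move=> x /codeP Vx; rewrite -map_act_image; apply/seteqP.
have sE := as' _ (map (act x) s) Vx.
have {}sE : map (act x) s =i s by apply: sE; exists x; rewrite map_cat.
by split=> z /=; rewrite sE.
Qed.

Hypothesis wH : weak_elim H.

Lemma crkP n s : cclosed s -> crk n s <-> rk n (stab (H := H) [set` s]).
Proof.
elim: n s => [|n IH] s cs; rewrite (rk_stabE wH _ ((cclosedP s).1 cs)).
  split=> rs.
    move=> B gB Bs; have [s' sE] := orbit_closed_seq gB; subst B.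
    by apply: rs => //; apply/cclosedP.
  by move=> s' /cclosedP/rs; apply.
split=> rs.
  move=> B gB Bs; have [s' sE] := orbit_closed_seq gB; subst B.
  have cs' : cclosed s' by apply/cclosedP.
  by have [|/(IH _ cs')] := rs s' cs' Bs; [left|right].
move=> s' cs' s's; have [|/(IH _ cs')] := rs [set` s'] ((cclosedP s').1 cs') s's.
  by left.
by right.
Qed.

Lemma ccosetP n p : ccoset n p <-> coset_code H n p.1 p.2.
Proof.
split=> [[cp rp [x xp]]|[gp rp [x xp]]].
  by split; [exact/cclosedP|exact/crkP|exists x].
have cp : cclosed p.1 by apply/cclosedP.
by split; [|exact/crkP|exists x].
Qed.

Lemma ccsatP phi e : ccsat phi e <-> csat phi (fun i => agree (H := H) (e i).1 (e i).2).
Proof.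
elim: phi e => [i j|i j k||a IHa b IHb|n a IHa] e //=.
- split=> [H' x /= xi|H' si t /orb_cat-/(_ si)[x [xi xj]]]; last by rewrite -xj; exact: H'.
  by apply: H'; [rewrite -xi size_map|exists x; rewrite map_cat xi].
- split=> [H' x y /= xi yj|H' si sj u v /orb_cat-/(_ sj)[y [yj yk]] /orb_cat-/(_ si)[x [xi xu]]].
    rewrite /agree /=; apply: (H' _ _ (map (act y) (e k).1)).
    + by rewrite -xi size_map.
    + by rewrite -yj size_map.
    + by exists y; rewrite map_cat yj.
    + by exists x; rewrite map_cat xi -map_comp.
  by rewrite -(H' x y)// -xu -yk -map_comp.
- by rewrite IHa IHb.
- have E p : (fun i => agree (H := H) (scons p e i).1 (scons p e i).2) =
      scons (agree p.1 p.2) (fun i => agree (H := H) (e i).1 (e i).2).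
    by apply/funext => -[|i].
  split=> H' P.
    by move=> /(cosetP wH)[s [t [st ->]]]; rewrite -(E (s, t)) -IHa; apply: H'; apply/ccosetP.
  move=> /ccosetP cP; rewrite IHa E; apply: H'; apply/(cosetP wH).
  by exists P.1, P.2.
Qed.
End Codes.

Lemma subgroup_eq (G : groupType) (A B : subgroup G) : sg_set A = sg_set B -> A = B.
Proof.
case: A B => [A A1 AM AV] [B B1 BM BV] /= AB; subst B.
by congr Subgroup; exact: Prop_irrelevance.
Qed.

Lemma closed_complete (T : Type) (H : closed_subgroup (sym T)) : complete_subgroup H.
Proof.
move=> g gH; apply: csg_closed => N; rewrite nbhsE => -[V [oV Vg] VN].
have [F fF FV] := sym_open oV Vg; have [h Hh hg] := gH F fF.
by exists h; split=> //; apply/VN/FV.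
Qed.

Definition wei_class : set (closed_subgroup (sym nat)) :=
  [set H | exists (L : language) (M : structure L nat),
     [/\ aleph0_categorical M, weak_elimination_of_imaginaries M &
         (H : set (sym nat)) = aut M]].

(** This removes the quantifier over languages and structures: conversely the orbit structure of [H]
    is a witness, its automorphism group being [H] because [H] is closed. *)
Lemma wei_classP H : wei_class H <-> coligomorphic H /\ cweak_elim H.
Proof.
split=> [[L [M [catM wM HM]]]|[/(coligomorphicP _ 0) olig /(cweak_elimP olig) wH]].
  have -> : csg_subgroup H = aut M by exact: subgroup_eq.
  have olig := categorical_oligomorphic catM.
  split; first exact/(coligomorphicP _ 0).
  by apply/(cweak_elimP olig)/(weak_elimP catM).
have cH := @closed_complete _ H.
exists (orbit_language nat), (orbit_structure H).
have HM := subgroup_eq (aut_orbit_structure cH).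
have catM := orbit_structure_categorical infinite_nat olig.
split=> //; last by rewrite HM.
by apply/(weak_elimP catM); rewrite HM.
Qed.

Lemma wei_class_tame H : wei_class H -> tame (csg_subgroup H).
Proof.
move=> [L [M [catM wM HM]]]; have -> : csg_subgroup H = aut M by exact: subgroup_eq.
exact: categorical_tame catM wM.
Qed.

Lemma wei_class_weak_elim H : wei_class H -> weak_elim H.
Proof.
move=> [L [M [catM wM HM]]]; have -> : csg_subgroup H = aut M by exact: subgroup_eq.
exact/(weak_elimP catM).
Qed.

Local Notation X := (closed_subgroup_space (sym nat)).
Local Notation msb P := (measurable ([set H : closed_subgroup (sym nat) | P H] : set X)).

Lemma measurable_cclosed s : msb (fun H => cclosed H s).
Proof.
apply: measurable_set_forall => x; apply: measurable_set_imp; last exact: measurable_set_prop.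
apply: measurable_set_exists => l; apply: measurable_set_forall => y.
by apply: measurable_set_imp; [exact: measurable_orb|exact: measurable_set_prop].
Qed.

Lemma measurable_crk n s : msb (fun H => crk H n s).
Proof.
elim: n s => [|n IH] s; apply: measurable_set_forall => s'; apply: measurable_set_imp;
  try exact: measurable_cclosed; apply: measurable_set_imp; try exact: measurable_set_prop.
suff : msb (fun H => {subset s <= s'} \/ crk H n s') by [].
apply: measurable_set_or; last exact: IH.
exact: measurable_set_prop.
Qed.

Lemma measurable_ccoset n p : msb (fun H => ccoset H n p).
Proof.
by apply: measurable_set_and3; [exact: measurable_cclosed|exact: measurable_crk|
  exact: measurable_orb].
Qed.

Lemma measurable_ccsat phi e : msb (fun H => ccsat H phi e).
Proof.
elim: phi e => [i j|i j k||a IHa b IHb|n a IHa] e.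
- apply: measurable_set_imp; first exact: measurable_set_prop.
  apply: measurable_set_forall => t.
  by apply: measurable_set_imp; [exact: measurable_orb|exact: measurable_set_prop].
- apply: measurable_set_imp; first exact: measurable_set_prop.
  apply: measurable_set_imp; first exact: measurable_set_prop.
  apply: measurable_set_forall => u; apply: measurable_set_forall => v.
  apply: measurable_set_imp; first exact: measurable_orb.
  by apply: measurable_set_imp; [exact: measurable_orb|exact: measurable_set_prop].
- exact: measurable_set_prop.
- by apply: measurable_set_imp.
- apply: measurable_set_forall => p; apply: measurable_set_imp; last exact: IHa.
  exact: measurable_ccoset.
Qed.

Lemma measurable_orbit_code a B c : msb (fun H => orbit_code H a B c).
Proof.
apply: measurable_set_exists => b.
by apply: measurable_set_and; [exact: measurable_set_prop|exact: measurable_orb].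
Qed.

Lemma measurable_subgroup_code a B : msb (fun H => subgroup_code H a B).
Proof.
apply: measurable_set_and3; first exact: measurable_set_prop.
  exact: measurable_orbit_code.
apply: measurable_set_and.
  apply: measurable_set_forall => c; apply: measurable_set_forall => d.
  apply: measurable_set_forall => d'.
  apply: measurable_set_imp; first exact: measurable_orbit_code.
  apply: measurable_set_imp; first exact: measurable_orbit_code.
  by apply: measurable_set_imp; [exact: measurable_orb|exact: measurable_orbit_code].
apply: measurable_set_forall => c; apply: measurable_set_forall => d.
apply: measurable_set_imp; first exact: measurable_orbit_code.
by apply: measurable_set_imp; [exact: measurable_orb|exact: measurable_orbit_code].
Qed.

Lemma measurable_cweak_elim : msb (fun H => cweak_elim H).
Proof.
apply: measurable_set_forall => a; apply: measurable_set_forall => B.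
apply: measurable_set_imp; first exact: measurable_subgroup_code.
apply: measurable_set_exists => s; apply: measurable_set_and3; first exact: measurable_cclosed.
  apply: measurable_set_forall => c.
  by apply: measurable_set_imp; [exact: measurable_orb|exact: measurable_orbit_code].
apply: measurable_set_forall => c; apply: measurable_set_forall => s'.
apply: measurable_set_imp; first exact: measurable_orbit_code.
by apply: measurable_set_imp; [exact: measurable_orb|exact: measurable_set_prop].
Qed.

Lemma measurable_coligomorphic : msb (fun H => coligomorphic H).
Proof.
apply: measurable_set_forall => n; apply: measurable_set_exists => l.
apply: measurable_set_forall => s.
apply: measurable_set_imp; first exact: measurable_set_prop.
apply: measurable_set_exists => t.
by apply: measurable_set_and; [exact: measurable_set_prop|exact: measurable_orb].
Qed.

Lemma measurable_wei_class : measurable (wei_class : set X).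
Proof.
have -> : wei_class = [set H | coligomorphic H /\ cweak_elim H].
  by apply/seteqP; split=> H /wei_classP.
by apply: measurable_set_and; [exact: measurable_coligomorphic|exact: measurable_cweak_elim].
Qed.

(** * Countably many Borel bits in one real number *)

Section Bits.
Import Order.TTheory GRing.Theory Num.Theory.
Local Open Scope ring_scope.

(* Ternary digits: the tail after a first difference cannot compensate for it. *)
Lemma measurable_bits (R : realType) d (Y : measurableType d) (A : nat -> set Y) :
  (forall i, measurable (A i)) -> exists2 f : Y -> R, measurable_fun setT f &
    forall x y, (forall i, A i x <-> A i y) <-> f x = f y.
Proof.
move=> mA; pose b i x : R := \1_(A i) x.
pose S n x : R := \sum_(i < n) b i x * 3^-1 ^+ i.
(* [3 / 2 * 3^-n] is the full geometric tail from [n] on, so every [V n] bounds the series from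
   above. *)
pose V n x : R := S n x + 3 / 2 * 3^-1 ^+ n.
have b01 i x : 0 <= b i x <= 1.
  by rewrite /b indicE; case: (x \in A i); rewrite /= ?lexx ler01.
have p3 n : 0 < (3^-1 : R) ^+ n by rewrite exprn_gt0// invr_gt0.
have SS n x : S n.+1 x = S n x + b n x * 3^-1 ^+ n by rewrite /S big_ord_recr.
have S_nd x : nondecreasing_seq (S ^~ x).
  apply/nondecreasing_seqP => n; by rewrite SS lerDl mulr_ge0.
have V_ni x : nonincreasing_seq (V ^~ x).
  apply/nonincreasing_seqP => n; rewrite /V SS exprS.
  have /andP[_ b1] := b01 n x; have := p3 n.
  move: b1; set t := b n x; set q := _ ^+ n => b1 q0.
  have : t * q <= q by rewrite ler_piMl// ltW.
  lra.
have SV m n x : S m x <= V n x.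
  apply: (@le_trans _ _ (S (maxn m n) x)); first exact/S_nd/leq_maxl.
  apply: (@le_trans _ _ (V (maxn m n) x)); last exact/V_ni/leq_maxr.
  by rewrite lerDl mulr_ge0// ltW.
have ubS x : has_ubound (range (S ^~ x)) by exists (V 0%N x) => _ [m _ <-].
pose f x := sup (range (S ^~ x)).
have Sf n x : S n x <= f x by apply: ub_le_sup => //; exists n.
have fV n x : f x <= V n x.
  by apply: ge_sup => [|_ [m _ <-]//]; exists (S 0%N x), 0%N.
exists f.
  apply: (@measurable_fun_cvg _ _ _ _ S) => [n|x _]; last exact: nondecreasing_cvgn.
  elim: n => [|n IH].
    by rewrite (_ : S 0%N = cst 0); [exact: measurable_cst|apply/funext => x; rewrite /S big_ord0].
  rewrite (_ : S n.+1 = S n \+ (b n \* cst (3^-1 ^+ n))); last by apply/funext => x; rewrite SS.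
  apply: measurable_funD => //; apply: measurable_funM; last exact: measurable_cst.
  exact: measurable_indic.
move=> x y; split=> [Axy|fxy].
  suff SE : S ^~ x = S ^~ y by rewrite /f SE.
  apply/funext => n; rewrite /S; apply: eq_bigr => i _; congr (_ * _).
  rewrite /b !indicE; suff -> : (x \in A i) = (y \in A i) by [].
  by apply/idP/idP => /set_mem/Axy/mem_set.
(* Digit one at [i] puts the value at least [3^-i] above the common prefix, digit zero at most half
   of that. *)
have main i x' y' : S i x' = S i y' -> f x' = f y' -> A i x' -> A i y'.
  move=> Sxy f_eq Ax; apply: contrapT => nAy.
  have := Sf i.+1 x'; have := fV i.+1 y'; rewrite /V !SS -f_eq -Sxy exprS.
  rewrite /b !indicE (mem_set Ax) (memNset nAy) /=; have := p3 i.
  by set q := _ ^+ i; set s := S i x'; lra.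
have AS i : (forall j, (j < i)%N -> A j x <-> A j y) -> S i x = S i y.
  move=> Aj; rewrite /S; apply: eq_bigr => j _; congr (_ * _); rewrite /b !indicE.
  suff -> : (x \in A j) = (y \in A j) by [].
  by apply/idP/idP => /set_mem/(Aj j (ltn_ord j))/mem_set.
move=> i; have [n] := ubnP i; elim: n i => // n IH i; rewrite ltnS => ni.
have Si : S i x = S i y by apply: AS => j ji; apply: IH; exact: leq_trans ni.
by split; apply: main.
Qed.
End Bits.

(* Codes [set0], as the sizes differ. *)
Definition empty_code : seq nat * seq nat := ([::], [:: 0%N]).

Lemma wei_class_iso H K : wei_class H -> wei_class K ->
  topological_iso H K <-> forall phi, ccsat H phi (fun=> empty_code) <->
                                    ccsat K phi (fun=> empty_code).
Proof.
move=> cH cK; rewrite (theory_iso (wei_class_tame cH) (wei_class_tame cK)).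
have E (H' : closed_subgroup (sym nat)) phi : wei_class H' ->
    ccsat H' phi (fun=> empty_code) <-> csat (G := H') phi (fun=> set0).
  move=> cH'; rewrite (ccsatP (wei_class_weak_elim cH')).
  have -> : agree (H := H') empty_code.1 empty_code.2 = set0 by apply/seteqP; split.
  by [].
by split=> th phi; have := th phi; rewrite !E.
Qed.

Theorem wei_class_smooth (R : realType) :
  smooth R (X := X) wei_class (fun H K => topological_iso H K).
Proof.
split; first exact: measurable_wei_class.
have [F FP] : exists F : nat -> cform, forall phi, exists k, F k = phi.
  apply: (@inj_enum _ CFalse (fun phi => pickle (cform_code phi))).
  by move=> phi psi /(pcan_inj pickleK_inv)/cform_code_inj.
have [f mf fP] := measurable_bits R (fun i => measurable_ccsat (F i) (fun=> empty_code)).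
exists f; first exact: measurable_funTS.
move=> H K cH cK; rewrite (wei_class_iso cH cK) -fP; split=> th; first by move=> i; exact: th.
by move=> phi; have [i <-] := FP phi; exact: th.
Qed.

Theorem corollary5p16 (R : realType) :
  smooth R (X := closed_subgroup_space (sym nat))
    [set H : closed_subgroup (sym nat) | exists (L : language) (M : structure L nat),
       [/\ aleph0_categorical M, weak_elimination_of_imaginaries M &
           (H : set (sym nat)) = aut M]]
    (fun H K : closed_subgroup (sym nat) => topological_iso H K)
  /\
  (forall (L : language) (T : Type) (M : structure L T),
     aleph0_categorical M -> weak_elimination_of_imaginaries M ->
     quasi_oligomorphic (cont_aut (aut M)) /\ profinite (out (aut M))).
Proof.
split; [exact: wei_class_smooth|move=> L T M; exact: categorical_automorphisms].
Qed.
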